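(* The second price auction with a PLSC and weakly risk averse buyers generates (weakly) higher expected total revenue than the second price auction with a POSC with the same share fraction: for any $\alpha\in(0,1)$, $$R^{plsc}_{sp}(\alpha)\ \ge\ R^{posc}_{sp}(\alpha),$$ where $R^{plsc}_{sp}(\alpha)=\mathbb{E}[\alpha X_1+(1-\alpha)t(\alpha,Z_1,Z_1)\mid Y_1>Z_1]$ and $R^{posc}_{sp}(\alpha)=\mathbb{E}[s(\alpha,Z_1,Z_1)+\alpha[X_1-s(\alpha,Z_1,Z_1)]^+\mid Y_1>Z_1]$, with $s,t$ as defined in the context.
   Context: ''Increasing'' means strictly increasing; $[a]^+=\max\{0,a\}$. There are $N\ge 2$ buyers. Real random variables $X_n$ (value of the resource to buyer $n$, possibly negative) and $Y_n$ (signal observed only by buyer $n$), $1\le n\le N$, have a commonly known joint law; $\mathbf{Y}=(Y_1,\dots,Y_N)$ and $\mathbf{Y}_{-n}$ is $\mathbf{Y}$ without the $n$-th entry. Symmetry: the joint CDF of $(X_n,Y_n,\mathbf{Y}_{-n})$ is the same for every $n$ and symmetric in the last $N-1$ components. Each $Y_n$ takes values in an interval $\mathcal{I}_Y\subset\mathbb{R}$; $\mathbf{Y}$ has a joint density that is positive on all of $\mathcal{I}_Y^N$ ($(X_n,\mathbf{Y})$ need not have a density). Positive dependence: for any increasing $h:\mathbb{R}\to\mathbb{R}$ and $a_n\le b_n$ in $\mathcal{I}_Y$, $\mathbb{E}[h(X_1)\mid Y_1\in[a_1,b_1],\dots,Y_N\in[a_N,b_N]]$ is increasing in $a_1$ and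 $b_1$ and nondecreasing in $a_n,b_n$ for $n\ge2$, whenever it exists ($a_n=b_n$ means conditioning on $Y_n=a_n$). Weakly risk averse buyers: all buyers have the same utility of money $u:\mathbb{R}\to\mathbb{R}$, concave (possibly linear), increasing, $u(0)=0$. All expectations and conditional expectations of interest exist and are finite, and $\mathbb{E}[u(X_1)\mid\mathbf{Y}=\mathbf{y}]>0$ for all $\mathbf{y}\in\mathcal{I}_Y^N$. The seller is risk neutral. $Z_1=\max\{Y_2,\dots,Y_N\}$. For $\alpha\in[0,1)$ and $y_1,z_1\in\mathcal{I}_Y$: $s(\alpha,y_1,z_1)$ is the unique $b$ with $\mathbb{E}[u(X_1-b-\alpha[X_1-b]^+)\mid Y_1=y_1,Z_1=z_1]=0$, and $t(\alpha,y_1,z_1)$ is the unique $b$ with $\mathbb{E}[u((1-\alpha)(X_1-b))\mid Y_1=y_1,Z_1=z_1]=0$. In the second price auction the highest bidder wins and pays the second highest bid $b$; when his value $x$ is revealed he additionally pays $\alpha[x-b]^+$ (profit only sharing contract, POSC) or $\alpha(x-b)$ (profit and loss sharing contract, PLSC). The total revenues are those at the symmetric equilibria in which buyer $n$ bids $s(\alpha,Y_n,Y_n)$ (POSC), resp. $t(\alpha,Y_n,Y_n)$ (PLSC). *)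

(* Defs.v *)
From HB Require Import structures.
From mathcomp Require Import all_boot all_order all_algebra perm.
From mathcomp Require Import all_classical all_reals all_analysis.

Set Implicit Arguments.
Unset Strict Implicit.
Unset Printing Implicit Defensive.

Import Order.TTheory GRing.Theory Num.Theory.
Import numFieldNormedType.Exports.

Local Open Scope classical_set_scope.
Local Open Scope ring_scope.

(* R^n, with the sigma-algebra generated by the coordinates *)
Notation "R '^^' n" := (n.-tuple (measurableTypeR R)) (at level 30) : type_scope.

Section product_measure.
Context {R : realType}.

Definition cons_pair n (p : (R ^^ n) * measurableTypeR R) : R ^^ n.+1 :=
  [the n.+1.-tuple (measurableTypeR R) of p.2 :: p.1].

Lemma measurable_cons_pair n : measurable_fun setT (@cons_pair n).
Proof. exact: measurable_cons. Qed.

Section cons_measure.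
Context n (m : {measure set (R ^^ n) -> \bar R}).
Variable mu : {sigma_finite_measure set (measurableTypeR R) -> \bar R}.

Definition cons_measure : set (R ^^ n.+1) -> \bar R :=
  pushforward (m \x mu)%E (@cons_pair n).

HB.instance Definition _ := Measure.copy cons_measure
  (measure_function_pushforward__canonical__measure_function_Measure
     (m \x mu)%E (@measurable_cons_pair n)).

End cons_measure.

(* mu_0 \x ... \x mu_(n-1) *)
Fixpoint prod_measure n :
    ('I_n -> {sigma_finite_measure set (measurableTypeR R) -> \bar R}) ->
    {measure set (R ^^ n) -> \bar R} :=
  match n with
  | 0 => fun _ => \d_([tuple] : R ^^ 0)
  | n'.+1 => fun mu =>
      cons_measure (prod_measure (fun i => mu (lift ord0 i))) (mu ord0)
  end.

Definition lebesgueN n : {measure set (R ^^ n) -> \bar R} :=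
  prod_measure (fun=> lebesgue_measure).

(* Reference measure for the condition "the coordinate lies in the interval J":
   a degenerate J = {a} conditions on the coordinate being equal to a. *)
Definition slice_measure (J : set R) :
    {sigma_finite_measure set (measurableTypeR R) -> \bar R} :=
  if `[< J = [set get J] >]
  then [the {sigma_finite_measure set _ -> \bar R}
          of \d_(get J : measurableTypeR R)]
  else [the {sigma_finite_measure set _ -> \bar R} of lebesgue_measure].

Definition box n (J : 'I_n -> set R) : set (R ^^ n) :=
  [set y | forall i, J i (tnth y i)].

End product_measure.

(* Conditional expectations of g(X_1) are computed from a version f of the
   density of Y (with respect to lebesgueN) and a version kappa of the
   conditional law of X_1 given Y.  Fixing f and kappa once and for all gives a
   meaning to conditioning on events of probability zero, simultaneously for all
   the conditions considered below. *)
Section conditional_expectation.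
Context {R : realType} {n : nat}.
Variables (f : R ^^ n -> R) (kappa : R.-pker (R ^^ n) ~> measurableTypeR R).
Implicit Types (J : 'I_n -> set R) (g : R -> R).

Definition slice_mass J : \bar R :=
  (\int[prod_measure (fun i => slice_measure (J i))]_(y in box J) (f y)%:E)%E.

Definition slice_integral J g : \bar R :=
  (\int[prod_measure (fun i => slice_measure (J i))]_(y in box J)
     ((\int[kappa y]_x (g x)%:E) * (f y)%:E))%E.

(* Expectation of g(X_1) conditionally on the union over k of the conditions
   "Y_i \in J k i for all i", which are assumed to overlap only on a null set
   (or to coincide). *)
Definition cexp_exists K (J : 'I_K -> 'I_n -> set R) g : Prop :=
  ((\sum_(k < K) slice_mass (J k) < +oo) /\
   (\sum_(k < K) slice_integral (J k) (fun x => `|g x|%R) < +oo))%E.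

Definition cexp K (J : 'I_K -> 'I_n -> set R) g : R :=
  fine (\sum_(k < K) slice_integral (J k) g)%E /
  fine (\sum_(k < K) slice_mass (J k))%E.

End conditional_expectation.

Section auction.
Context {R : realType} {m : nat}.
(* There are m + 2 buyers; ord0 is buyer 1. *)
Let N := m.+2.

Definition all_in (I : interval R) (c : 'I_N -> R) : Prop :=
  forall i, c i \in I.

Section law.
Context {d : measure_display} {T : measurableType d} {P : probability T R}.
Variables X Y : 'I_N -> {RV P >-> R}.

(* CDF of (X_n, Y_n, Y_{-n}): lift n enumerates the buyers other than n in
   increasing order. *)
Definition joint_cdf (n : 'I_N) (x y : R) (v : 'I_m.+1 -> R) : \bar R :=
  P [set w | X n w <= x /\ Y n w <= y /\ forall j, Y (lift n j) w <= v j].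

Definition symmetric_law : Prop :=
  (forall n x y v, joint_cdf n x y v = joint_cdf ord0 x y v) /\
  (forall n x y v (s : {perm 'I_m.+1}),
     joint_cdf n x y (v \o s) = joint_cdf n x y v).

Definition signals (w : T) : R ^^ N := [tuple Y i w | i < N].

Definition joint_density (f : R ^^ N -> R) : Prop :=
  [/\ measurable_fun setT f, forall y, 0 <= f y &
      forall B, measurable B ->
        P (signals @^-1` B) = (\int[lebesgueN N]_(y in B) (f y)%:E)%E].

Definition conditional_law (kappa : R.-pker (R ^^ N) ~> measurableTypeR R) :
    Prop :=
  forall (A : set (measurableTypeR R)) (B : set (R ^^ N)),
    measurable A -> measurable B ->
    P ((X ord0 @^-1` A) `&` (signals @^-1` B)) =
    (\int[P]_(w in signals @^-1` B) kappa (signals w) A)%E.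

Definition Z1 (w : T) : R :=
  \big[Num.max/Y (lift ord0 ord0) w]_(j < m.+1) Y (lift ord0 j) w.

Definition event_mean (A : set T) (g : T -> R) : R :=
  (\int[P]_(w in A) g w) / fine (P A).

End law.

Section bids.
Variables (I : interval R) (u : R -> R).
Variables (f : R ^^ N -> R) (kappa : R.-pker (R ^^ N) ~> measurableTypeR R).

(* Y_n \in [a_n, b_n] for all n *)
Definition box_cond (a b : 'I_N -> R) (k : 'I_1) (i : 'I_N) : set R :=
  `[a i, b i].

Definition box_cexp_exists a b g := cexp_exists f kappa (box_cond a b) g.
Definition box_cexp a b g := cexp f kappa (box_cond a b) g.

(* The two boxes differ in exactly one of the 2N endpoints. *)
Definition positive_dependence : Prop :=
  forall (h : R -> R) (i : 'I_N) (a b a' b' : 'I_N -> R),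
    {homo h : x y / x < y} ->
    all_in I a -> all_in I b -> (forall j, a j <= b j) ->
    all_in I a' -> all_in I b' -> (forall j, a' j <= b' j) ->
    box_cexp_exists a b h -> box_cexp_exists a' b' h ->
    (forall j, j != i -> a' j = a j /\ b' j = b j) ->
    (a i < a' i /\ b' i = b i) \/ (a' i = a i /\ b i < b' i) ->
    if i == ord0 then box_cexp a b h < box_cexp a' b' h
    else box_cexp a b h <= box_cexp a' b' h.

(* Y_1 = y and Z_1 = z, split according to the buyer (lift ord0 k) attaining
   the maximum. *)
Definition YZ_cond (y z : R) (k : 'I_m.+1) (i : 'I_N) : set R :=
  if i == ord0 then [set y]
  else if i == lift ord0 k then [set z]
  else [set x | x \in I /\ x <= z].

Definition YZ_cexp_exists y z g := cexp_exists f kappa (YZ_cond y z) g.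
Definition YZ_cexp y z g := cexp f kappa (YZ_cond y z) g.

Definition posc_payoff (alpha b x : R) : R := x - b - alpha * Num.max 0 (x - b).
Definition plsc_payoff (alpha b x : R) : R := (1 - alpha) * (x - b).

(* The default value 0 of xget is irrelevant: the set below is a singleton for
   0 <= alpha < 1 and y, z in I as soon as the expectations involved are
   finite and E[u(X_1) | Y] > 0. *)
Definition s_bid (alpha y z : R) : R :=
  xget 0 [set b | YZ_cexp y z (u \o posc_payoff alpha b) = 0].
Definition t_bid (alpha y z : R) : R :=
  xget 0 [set b | YZ_cexp y z (u \o plsc_payoff alpha b) = 0].

Context {d : measure_display} {T : measurableType d} {P : probability T R}.
Variables X Y : 'I_N -> {RV P >-> R}.

Definition buyer1_wins : set T := [set w | Z1 Y w < Y ord0 w].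

Definition posc_payment (alpha : R) (w : T) : R :=
  let b := s_bid alpha (Z1 Y w) (Z1 Y w) in
  b + alpha * Num.max 0 (X ord0 w - b).
Definition plsc_payment (alpha : R) (w : T) : R :=
  alpha * X ord0 w + (1 - alpha) * t_bid alpha (Z1 Y w) (Z1 Y w).

Definition R_posc (alpha : R) : R :=
  event_mean (P := P) buyer1_wins (posc_payment alpha).
Definition R_plsc (alpha : R) : R :=
  event_mean (P := P) buyer1_wins (plsc_payment alpha).

End bids.

End auction.

(* Main.v *)
Require Import Defs.
From HB Require Import structures.
From mathcomp Require Import all_boot all_order all_algebra perm.
From mathcomp Require Import all_classical all_reals all_analysis.
From mathcomp Require Import measurable_realfun ring lra.

Import Order.TTheory GRing.Theory Num.Theory.
Import numFieldNormedType.Exports.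
Local Open Scope classical_set_scope.
Local Open Scope ring_scope.

(* Write [s(z)] and [t(z)] for the bids at [Y_1 = Z_1 = z].  Conditionally on
   [Y_1 = Z_1 = z] the two payoffs cross once as functions of [X_1], so concavity
   of [u] turns the equality of the expected utilities into
     alpha E[(s(z) - X_1)^+ | Y_1 = Z_1 = z] <= (1 - alpha) (t(z) - s(z)).
   The payment difference at [Z_1 = z] is
     (1 - alpha) (t(z) - s(z)) - alpha (s(z) - X_1)^+,
   and positive dependence makes the last term smaller on average on the winning
   event [Y_1 > Z_1 = z] than on [Y_1 = Z_1 = z].
   Conditional expectations given single points are only tied to probabilities
   through positive dependence, which compares the condition [Y_1 = Z_1 = z] with
   the event "[Y_1 >= z'], one competitor in [z, z'], the others below [z]".  So the
   winning event is cut along a grid of values of [Z_1]; replacing [s(Z_1)] by [s(z)]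
   costs an increment of the nondecreasing function [s] on each cell, and these
   costs telescope against the largest cell probability. *)

(** * Concave functions *)

(** The versions [f] and [kappa] are only known to inherit the symmetry of the law almost
    everywhere, so competitors cannot be exchanged under a point condition. They can be exchanged in
    boxes with nondegenerate sides, whose slice laws are probabilities; a comparison that changes
    the maximal competitor therefore passes through such a box. Every intermediate box must also
    have finite mass, since otherwise positive dependence says nothing about it. With only [Y_1]
    frozen at [z] this holds for almost every [z], by Tonelli; with [Y_1] and one competitor frozen
    at [z] it comes from the assumed existence of the conditional expectations. The exceptional [z],
    together with a possible least element of [I], form a null set, which the grids and the outcomes
    under consideration avoid. The bids are shown to be monotone only at the remaining, regular
    values, and neither bid is integrated by itself: only the integrable payment difference is. The
    range of [s] may grow without bound as the grids exhaust [I]; absolute continuity of the signals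
    lets the mesh be chosen after that range, so that the telescoped cost still vanishes. *)

Lemma concave_three_chords {R : realType} (phi : R -> R) :
  (forall l x y, 0 <= l <= 1 ->
    l * phi x + (1 - l) * phi y <= phi (l * x + (1 - l) * y)) ->
  forall x y z, x < y -> y < z ->
  (phi z - phi y) * (y - x) <= (phi y - phi x) * (z - y).
Proof.
move=> conc x y z xy yz; have xz := lt_trans xy yz.
have zx : 0 < z - x by rewrite subr_gt0.
pose l := (z - y) / (z - x).
have l01 : 0 <= l <= 1.
  apply/andP; split; first by rewrite divr_ge0// subr_ge0 ltW.
  by rewrite ler_pdivrMr// mul1r lerD2l lerN2 ltW.
have := conc l x z l01.
have -> : l * x + (1 - l) * z = y.
  by rewrite /l; field; rewrite gt_eqF.
have -> : l * phi x + (1 - l) * phi z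
   = ((z - y) * phi x + (y - x) * phi z) / (z - x).
  by rewrite /l; field; rewrite gt_eqF.
rewrite ler_pdivrMr// => H; lra.
Qed.

Section concave_functions.
Context {R : realType} (u : R -> R).
Hypothesis u_incr : {homo u : x y / x < y}.
Hypothesis u_conc : convex_function [set: R^o] (fun x => - u x).

Lemma concave_le_conv (l x y : R) : 0 <= l <= 1 ->
  l * u x + (1 - l) * u y <= u (l * x + (1 - l) * y).
Proof.
move=> /andP[l0 l1].
have l01 : (0 <= l <= 1)%O by rewrite l0 l1.
have := @u_conc (@Itv01 R l l0 l1) x y (in_setT _) (in_setT _).
rewrite !convRE /= /unstable.onem /= => H.
rewrite -lerN2; apply: le_trans H _.
by rewrite !mulrN -opprD lexx.
Qed.

(** [k] is the right derivative of [u] at [p]: every slope to the left of [p] bounds the slopes to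
    the right, so their supremum exists. The inequality is needed from any [x] between [p] and [y],
    not only from [p]; it extends because slopes beyond [p] are at most [k] on the right and at
    least [k] on the left. *)
Lemma concave_supergradient (p : R) : exists2 k, 0 < k &
  forall x y, (p <= x <= y) || (y <= x <= p) -> u y - u x <= k * (y - x).
Proof.
pose S := [set (u q - u p) / (q - p) | q in [set q | p < q]].
have S1 : S ((u (p + 1) - u p) / (p + 1 - p)).
  by exists (p + 1) => //=; rewrite ltrDl.
have left_slope q r : q < p -> p < r ->
    (u r - u p) / (r - p) <= (u p - u q) / (p - q).
  move=> qp pr; rewrite ler_pdivrMr ?subr_gt0// mulrAC ler_pdivlMr ?subr_gt0//.
  exact: (concave_three_chords u concave_le_conv).
have ubS q : q < p -> ubound S ((u p - u q) / (p - q)).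
  by move=> qp _ [r /= pr <-]; exact: left_slope.
have p1p : p - 1 < p by rewrite ltrBlDr ltrDl.
have supS : has_sup S by split; [eexists; exact: S1 | eexists; exact: ubS p1p].
pose k := sup S.
have kge r : p < r -> u r - u p <= k * (r - p).
  move=> pr; rewrite -ler_pdivrMr ?subr_gt0//.
  by apply: ub_le_sup; [case: supS|exists r].
have kle q : q < p -> k * (p - q) <= u p - u q.
  move=> qp; rewrite -ler_pdivlMr ?subr_gt0//.
  by apply: ge_sup; [case: supS|exact: ubS].
exists k.
  have : 0 < u (p + 1) - u p by rewrite subr_gt0 u_incr// ltrDl.
  have pp1 : p < p + 1 by rewrite ltrDl.
  by have := kge _ pp1; lra.
move=> x y /orP[] /andP[].
  rewrite le_eqVlt => /predU1P[<-|px].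
    by rewrite le_eqVlt => /predU1P[<-|/kge//]; lra.
  rewrite le_eqVlt => /predU1P[<-|xy]; first lra.
  have := concave_three_chords u concave_le_conv p x y px xy.
  have := kge _ px => h1 h2.
  have xp : 0 < x - p by rewrite subr_gt0.
  rewrite -(ler_pM2r xp); apply: le_trans h2 _.
  have yx : 0 < y - x by rewrite subr_gt0.
  by have := ler_wpM2r (ltW yx) h1; lra.
rewrite le_eqVlt => /predU1P[->|yx]; first by move=> _; lra.
rewrite le_eqVlt => /predU1P[xp|xp].
  by subst x; have := kle _ yx; lra.
have := concave_three_chords u concave_le_conv y x p yx xp.
have := kle _ xp => h1 h2.
have px : 0 < p - x by rewrite subr_gt0.
have xy : 0 < x - y by rewrite subr_gt0.
have := ler_wpM2r (ltW xy) h1 => h3.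
have : k * (x - y) * (p - x) <= (u x - u y) * (p - x) by lra.
by rewrite ler_pM2r//; lra.
Qed.

End concave_functions.

(* A finite concave function that decreases strictly tends to [-oo] at [+oo]. *)
Lemma concave_decreasing_root {R : realType} (phi : R -> R) (b0 : R) :
  {homo phi : x y /~ x < y} ->
  (forall l x y, 0 <= l <= 1 ->
    l * phi x + (1 - l) * phi y <= phi (l * x + (1 - l) * y)) ->
  0 <= phi b0 -> exists b, phi b = 0.
Proof.
move=> phi_decr phi_conc phi0.
have chord := concave_three_chords phi phi_conc.
have phi_nincr x y : x <= y -> phi y <= phi x.
  by rewrite le_eqVlt => /predU1P[->//|/phi_decr/ltW].
pose d := phi b0 - phi (b0 + 1).
have d0 : 0 < d by rewrite subr_gt0 phi_decr// ltrDl.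
(* The line through the graph at [b0] and [b0 + 1] has slope [- d] and vanishes at
   [b0 + phi b0 / d]. Concavity keeps [phi] below this line beyond [b0 + 1], and [b1] lies beyond
   both points. *)
pose b1 := b0 + 1 + phi b0 / d + 1.
have b01 : b0 + 1 < b1.
  have : 0 <= phi b0 / d by rewrite divr_ge0// ltW.
  by rewrite /b1; lra.
have b01' : b0 < b1 by apply: lt_trans b01; rewrite ltrDl.
have phib1 : phi b1 <= 0.
  have := chord b0 (b0 + 1) b1 _ b01; rewrite ltrDl => /(_ ltr01).
  have -> : (phi (b0 + 1) - phi b0) * (b1 - (b0 + 1)) = - (phi b0 + d).
    have -> : phi (b0 + 1) - phi b0 = - d by rewrite opprB.
    have -> : b1 - (b0 + 1) = phi b0 / d + 1 by rewrite /b1; lra.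
    by rewrite mulrDr mulNr mulrCA divff ?gt_eqF// !mulr1; lra.
  have -> : b0 + 1 - b0 = 1 by lra.
  by rewrite mulr1; move: d0; rewrite /d; lra.
(* To the left of [c] a concave function falls no faster than over [[c, c + 1]]. This local
   Lipschitz bound gives the continuity required by the intermediate value theorem. *)
have lip c x y : x < y -> y <= c -> phi x - phi y <= (phi c - phi (c + 1)) * (y - x).
  move=> xy yc; have c1 : c < c + 1 by rewrite ltrDl.
  have [yc1|cy] := ltP y c; last first.
    have {cy yc} yc : y = c by apply/eqP; rewrite eq_le yc cy.
    by subst y; have := chord x c (c + 1) xy c1; lra.
  have h1 := chord x y c xy yc1; have h2 := chord y c (c + 1) yc1 c1.
  have yx0 : 0 < y - x by rewrite subr_gt0.
  have cy0 : 0 < c - y by rewrite subr_gt0.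
  rewrite -(ler_pM2r cy0).
  by have := ler_wpM2r (ltW yx0) h2; lra.
have phi_cont : continuous phi.
  move=> x; apply/cvgrPdist_le => e e0.
  pose L := phi (x + 1) - phi (x + 1 + 1).
  have L0 : 0 < L by rewrite subr_gt0 phi_decr// ltrDl.
  exists (Num.min 1 (e / L)); first by rewrite /= lt_min ltr01 divr_gt0.
  move=> y; rewrite /ball_/= lt_min => /andP[xy1].
  have yx1 : y <= x + 1 by move: xy1; rewrite ltr_norml; lra.
  rewrite ltr_pdivlMr//.
  have [xy|yx|->] := ltgtP x y.
  - rewrite ltr0_norm ?subr_lt0// opprB => h.
    have := lip _ x y xy yx1.
    rewrite ger0_norm ?subr_ge0 ?phi_nincr ?(ltW xy)// -/L; lra.
  - rewrite gtr0_norm ?subr_gt0// => h.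
    have xx1 : x <= x + 1 by rewrite lerDl.
    have := lip _ y x yx xx1.
    rewrite ler0_norm ?subr_le0 ?phi_nincr ?(ltW yx)// -/L; lra.
  - by rewrite !subrr normr0 ltW.
have [|b _ <-] := @IVT _ phi _ _ 0 (ltW b01') (continuous_subspaceT phi_cont); last by exists b.
by rewrite ge_min phib1 orbT le_max phi0.
Qed.

(** * Laws conditional on boxes of signals *)

Section kernel_density.
Local Open Scope ereal_scope.
Context {d1 d2 : measure_display} {T1 : measurableType d1}
  {T2 : measurableType d2} {R : realType}.
Variables (mu : {measure set T1 -> \bar R}) (k : R.-ker T1 ~> T2).
Variables (D : set T1) (f : T1 -> R).
Hypotheses (mD : measurable D) (mf : measurable_fun D f).
Hypothesis f0 : forall y, (0 <= f y)%R.

Let F y := (f y)%:E.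
Let mF : measurable_fun D F. Proof. exact/measurable_EFinP. Qed.
Let F0 y : 0 <= F y. Proof. by rewrite lee_fin. Qed.

Let mkF A : measurable A -> measurable_fun D (fun y => k y A * F y).
Proof.
move=> mA; apply: emeasurable_funM => //; apply: measurable_funTS.
exact: (measurable_kernel k _ mA).
Qed.

(** A mixture of the measures [k y] with weight [f]. It serves for the laws on slices and, with the
    Dirac kernel of a random variable, for image laws restricted to an event. *)
Lemma kernel_density_exists : exists rho : {measure set T2 -> \bar R},
  forall A, measurable A -> rho A = \int[mu]_(y in D) (k y A * (f y)%:E).
Proof.
pose nu A := \int[mu]_(y in D) (k y A * (f y)%:E).
have nu0 : nu set0 = 0.
  by rewrite /nu integral0_eq// => y _; rewrite measure0 mul0e.
have nu_ge0 A : 0 <= nu A.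
  by apply: integral_ge0 => y _; rewrite mule_ge0// F0.
have nu_sigma : semi_sigma_additive nu.
  move=> A mA tA mUA; rewrite /nu.
  rewrite [X in _ --> X](_ : _ =
      \int[mu]_(y in D) \sum_(n <oo) (k y (A n) * F y)); last first.
    apply: eq_integral => y _.
    rewrite (measure_semi_bigcup (k y))//.
    rewrite muleC /F -nneseriesZl; last by move=> n _.
    by apply: eq_eseriesr => n _; rewrite muleC.
  rewrite [X in X @ _ --> _](_ : _ =
      (fun n => \sum_(0 <= i < n) \int[mu]_(y in D) (k y (A i) * F y)))//.
  rewrite integral_nneseries//.
  - apply: is_cvg_ereal_nneg_natsum_cond => n _ _.
    by apply: integral_ge0 => y _; rewrite mule_ge0// F0.
  - by move=> n; exact: mkF.
  - by move=> n y _; rewrite mule_ge0// F0.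
pose HM := isMeasure.Build _ _ _ nu nu0 nu_ge0 nu_sigma.
pose rho : {measure set T2 -> \bar R} := HB.pack nu HM.
by exists rho.
Qed.

Variable rho : {measure set T2 -> \bar R}.
Hypothesis rhoE :
  forall A, measurable A -> rho A = \int[mu]_(y in D) (k y A * (f y)%:E).

Import HBNNSimple.

Let mulk_ge0 (g : {nnsfun T2 >-> R}) y r : 0 <= r%:E * k y (g @^-1` [set r]).
Proof.
have [r0|r0] := leP 0%R r; first by rewrite mule_ge0.
by rewrite preimage_nnfun0// measure0 mule0.
Qed.

Let integral_nnsfun (g : {nnsfun T2 >-> R}) :
  \int[rho]_x (g x)%:E = \int[mu]_(y in D) (\int[k y]_x (g x)%:E * F y).
Proof.
transitivity (\int[mu]_(y in D) \sum_(r \in range g)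
    (r%:E * (k y (g @^-1` [set r]) * F y))).
  rewrite ge0_integral_fsum//; last 2 first.
  - move=> r; apply: emeasurable_funM => //.
    exact/mkF/measurable_sfunP.
  - move=> r y _; rewrite muleA mule_ge0//.
  rewrite integralT_nnsfun sintegralE.
  apply: eq_fsbigr => r _.
  have [r0|r0] := leP 0%R r.
    by rewrite rhoE// ge0_integralZl// => [|y _]; [exact: mkF|rewrite mule_ge0].
  rewrite preimage_nnfun0// measure0 mule0 integral0_eq// => y _.
  by rewrite measure0 mul0e mule0.
apply: eq_integral => y _; rewrite integralT_nnsfun sintegralE.
rewrite ge0_mule_fsuml.
  by apply: eq_fsbigr => r _; rewrite muleA.
by move=> r; exact: mulk_ge0.
Qed.

(** The identity defining [rho] on sets passes to simple functions by linearity and then to [g] by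
    monotone convergence, applied under [rho], under each [k y] and under [mu]. *)
Lemma ge0_integral_kernel_density (g : T2 -> \bar R) :
  measurable_fun setT g -> (forall x, 0 <= g x) ->
  \int[rho]_x g x = \int[mu]_(y in D) (\int[k y]_x g x * (f y)%:E).
Proof.
move=> mg g0; pose g_ := nnsfun_approx measurableT mg.
have g_nd x a b : (a <= b)%N -> (g_ a x)%:E <= (g_ b x)%:E.
  by move=> ab; rewrite lee_fin; exact/lefP/nd_nnsfun_approx.
have mint n : measurable_fun setT (fun y => \int[k y]_x (g_ n x)%:E).
  apply: measurable_fun_integral_kernel => //.
  - by move=> U mU; exact: (measurable_kernel k).
  - by move=> z; rewrite lee_fin.
  - exact/measurable_EFinP.
have int_nd y a b : (a <= b)%N ->
    \int[k y]_x (g_ a x)%:E <= \int[k y]_x (g_ b x)%:E.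
  move=> ab; apply: ge0_le_integral => //.
  - by move=> z _; rewrite lee_fin.
  - exact/measurable_EFinP.
  - exact/measurable_EFinP.
  - by move=> x _; exact: g_nd.
have gE (m : {measure set T2 -> \bar R}) :
    (\int[m]_x (g_ n x)%:E) @[n --> \oo] --> \int[m]_x g x.
  rewrite (_ : \int[m]_x g x = \int[m]_x limn (fun n => (g_ n x)%:E)).
    apply: cvg_monotone_convergence => //.
    - by move=> n; exact/measurable_EFinP.
    - by move=> n x _; rewrite lee_fin.
    - by move=> x _ a b; exact: g_nd.
  by apply: eq_integral => x _; apply/esym/cvg_lim => //;
    exact: cvg_nnsfun_approx.
apply: (cvg_unique _ (gE rho)) => //=.
rewrite (_ : \int[mu]_(y in D) _ =
    \int[mu]_(y in D) limn (fun n => \int[k y]_x (g_ n x)%:E * F y)).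
  under eq_fun do rewrite integral_nnsfun.
  apply: cvg_monotone_convergence => //.
  - by move=> n; apply: emeasurable_funM => //; exact: measurable_funTS.
  - move=> n y _; rewrite mule_ge0//.
    by apply: integral_ge0 => x _; rewrite lee_fin.
  - by move=> y _ a b ab; rewrite lee_wpmul2r//; exact: int_nd.
apply: eq_integral => y _; apply/esym/cvg_lim => //.
by apply: cvgeZr => //; exact: gE.
Qed.

End kernel_density.

(** * Product measures on tuples *)

Section product_of_lines.
Local Open Scope ereal_scope.
Context {R : realType}.
Notation sfm := {sigma_finite_measure set (measurableTypeR R) -> \bar R}.

Lemma measurable_box n (J : 'I_n -> set R) :
  (forall i, measurable (J i : set (measurableTypeR R))) -> measurable (box J).
Proof.
move=> mJ; rewrite (_ : box J = \bigcap_(i in [set: 'I_n])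
    ((fun y : R ^^ n => tnth y i) @^-1` (J i))).
  apply: fin_bigcap_measurable => [|i _]; first exact: finite_finset.
  rewrite -[X in measurable X]setTI.
  exact: (@measurable_tnth _ (measurableTypeR R) n i).
by apply/seteqP; split => y yJ i; [move=> _|]; exact: yJ.
Qed.

Lemma preimage_cons_pair_box n (J : 'I_n.+1 -> set R) :
  @cons_pair R n @^-1` (box J) = box (fun i => J (lift ord0 i)) `*` J ord0.
Proof.
apply/seteqP; split => -[y x] /= yJ.
  split => /=; last by have := yJ ord0; rewrite (tnth_nth x).
  by move=> i; have := yJ (lift ord0 i); rewrite tnthS.
case: yJ => /= yJ xJ i; case: (unliftP ord0 i) => [j ->|->].
  by rewrite tnthS; exact: yJ.
by rewrite (tnth_nth x).
Qed.

Lemma prod_measure_box n (mu : 'I_n.+1 -> sfm) (J : 'I_n.+1 -> set R) :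
  (forall i, measurable (J i : set (measurableTypeR R))) ->
  prod_measure mu (box J) =
  prod_measure (fun i => mu (lift ord0 i)) (box (fun i => J (lift ord0 i))) *
  mu ord0 (J ord0).
Proof.
move=> mJ; rewrite /= /cons_measure /pushforward preimage_cons_pair_box.
by rewrite product_measure1E//; exact: measurable_box.
Qed.

Lemma prod_measure_box_gt0 n (mu : 'I_n -> sfm) (J : 'I_n -> set R) :
  (forall i, measurable (J i : set (measurableTypeR R))) -> (forall i, 0 < mu i (J i)) ->
  0 < prod_measure mu (box J).
Proof.
elim: n => [|n IH] in mu J *; move=> mJ muJ; last first.
  by rewrite prod_measure_box// mule_gt0// IH.
rewrite /= diracE mem_set ?lte01//.
by move=> -[].
Qed.

Lemma prod_measure_sigma_finite n (mu : 'I_n -> sfm) :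
  sigma_finite setT (prod_measure mu).
Proof.
elim: n => [|n IH] in mu *.
  exists (fun _ => setT); first by rewrite bigcup_const//; exists 0%N.
  by move=> _; split=> //=; rewrite diracT ltry.
have /sigma_finiteP[F [TF ndF Foo]] := IH (fun i => mu (lift ord0 i)).
have /sigma_finiteP[G [TG ndG Goo]] := sigma_finiteT (mu ord0).
pose H k := (fun y : R ^^ n.+1 => [tuple of behead y]) @^-1` (F k)
  `&` (fun y : R ^^ n.+1 => tnth y ord0) @^-1` (G k).
have HE k : @cons_pair R n @^-1` (H k) = F k `*` G k.
  apply/seteqP; split => -[y x] /=; rewrite /H /=.
    by move=> [Fy Gx]; split => //=; move: Fy; congr (F k _); exact: val_inj.
  by move=> [/= Fy Gx]; split => //=; move: Fy; congr (F k _); exact: val_inj.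
exists H.
  apply/seteqP; split => // y _.
  have : [set: R ^^ n] [tuple of behead y] by [].
  have : [set: measurableTypeR R] (tnth y ord0) by [].
  rewrite TF TG => -[a _ Ga] [b _ Fb]; exists (maxn a b) => //; split.
    by have /subsetPset := ndF _ _ (leq_maxr a b); apply.
  by have /subsetPset := ndG _ _ (leq_maxl a b); apply.
move=> k; have [mF Fk] := Foo k; have [mG Gk] := Goo k; split.
  apply: measurableI; rewrite -[X in measurable X]setTI.
    by apply: measurable_behead.
  by apply: (measurable_tnth ord0).
rewrite /= /cons_measure /pushforward HE product_measure1E//.
by rewrite lte_mul_pinfty// ge0_fin_numE.
Qed.

(** A named copy of [prod_measure] to which the sigma-finite structure required by Tonelli's theorem
    is attached. *)
Definition sfprod_measure n (mu : 'I_n -> sfm) : set (R ^^ n) -> \bar R :=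
  prod_measure mu.

HB.instance Definition _ n (mu : 'I_n -> sfm) :=
  Measure.copy (sfprod_measure n mu) (prod_measure mu).

HB.instance Definition _ n (mu : 'I_n -> sfm) :=
  Measure_isSigmaFinite.Build _ _ _ (sfprod_measure n mu)
    (prod_measure_sigma_finite n mu).

Lemma integral_prod_measureS n (mu : 'I_n.+1 -> sfm) (F : R ^^ n.+1 -> \bar R) :
  measurable_fun setT F -> (forall y, 0 <= F y) ->
  \int[prod_measure mu]_y F y =
  \int[prod_measure (fun i => mu (lift ord0 i))]_y
    \int[mu ord0]_x F (cons_pair (y, x)).
Proof.
move=> mF F0; pose m' := [the {sigma_finite_measure set (R ^^ n) -> \bar R} of
  sfprod_measure n (fun i => mu (lift ord0 i))].
rewrite [LHS](_ : _ = \int[pushforward (prod_measure (fun i => mu (lift ord0 i)) \x mu ord0) (@cons_pair R n)]_y F y)//.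
rewrite ge0_integral_pushforward//; last exact: measurable_cons_pair.
rewrite preimage_setT.
rewrite (fubini_tonelli1 (m1 := m') (F \o @cons_pair R n))//.
  by apply: measurableT_comp => //; exact: measurable_cons_pair.
by move=> x; exact: F0.
Qed.

Lemma integral_prod_measureS_swap n (mu : 'I_n.+1 -> sfm)
    (F : R ^^ n.+1 -> \bar R) :
  measurable_fun setT F -> (forall y, 0 <= F y) ->
  measurable_fun setT (fun x => \int[prod_measure (fun i => mu (lift ord0 i))]_y
     F (cons_pair (y, x))) /\
  \int[prod_measure mu]_y F y = \int[mu ord0]_x
    \int[prod_measure (fun i => mu (lift ord0 i))]_y F (cons_pair (y, x)).
Proof.
move=> mF F0; pose m' := [the {sigma_finite_measure set (R ^^ n) -> \bar R} of
  sfprod_measure n (fun i => mu (lift ord0 i))].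
have Fc0 x : 0 <= (F \o @cons_pair R n) x by exact: F0.
have mFc : measurable_fun setT (F \o @cons_pair R n).
  by apply: measurableT_comp => //; exact: measurable_cons_pair.
split.
  exact: (measurable_fun_fubini_tonelli_G (m1 := m') _ mFc Fc0).
rewrite [LHS](_ : _ = \int[pushforward (prod_measure (fun i => mu (lift ord0 i)) \x mu ord0) (@cons_pair R n)]_y F y)//.
rewrite ge0_integral_pushforward//; last exact: measurable_cons_pair.
by rewrite preimage_setT (fubini_tonelli2 (m1 := m') _ mFc Fc0).
Qed.

Lemma prod_measure_box_eq0 n (mu : 'I_n -> sfm) (J : 'I_n -> set R) (i : 'I_n) :
  (forall i, measurable (J i : set (measurableTypeR R))) -> mu i (J i) = 0 ->
  prod_measure mu (box J) = 0.
Proof.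
elim: n => [|n IH] in mu J i *; first by case: i.
move=> mJ Ji0; rewrite prod_measure_box//.
case: (unliftP ord0 i) Ji0 => [j|] -> Ji0; last by rewrite Ji0 mule0.
by rewrite (IH _ _ j)// mul0e.
Qed.

Lemma measurable_tie n (i j : 'I_n) :
  measurable [set y : R ^^ n | tnth y i = tnth y j].
Proof.
have mtnth l : measurable_fun setT (fun y : R ^^ n => tnth y l : R).
  exact: (@measurable_tnth _ (measurableTypeR R) n l).
rewrite (_ : [set y | _] = setT `&`
    (fun y : R ^^ n => tnth y i - tnth y j : R)%R @^-1` [set 0%R]).
  by apply: measurable_funB.
rewrite setTI; apply/seteqP; split => y /=; first by move=> ->; rewrite subrr.
by move/eqP; rewrite subr_eq0 => /eqP.
Qed.

(** If one of the indices is the first, the section of the tie at fixed other coordinates is a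
    singleton; otherwise the set is a cylinder over a tie in one dimension less. *)
Lemma lebesgueN_tie n (i j : 'I_n) : i != j ->
  lebesgueN (R := R) n [set y | tnth y i = tnth y j] = 0.
Proof.
elim: n => [|n IH] in i j *; first by case: i.
have tie0 (l : 'I_n) : lebesgueN (R := R) n.+1 [set y | tnth y ord0 = tnth y (lift ord0 l)] = 0.
  rewrite /lebesgueN /= /cons_measure /pushforward /product_measure1.
  apply: integral0_eq => y _.
  rewrite /= (_ : xsection _ _ = [set (tnth y l : measurableTypeR R)]).
    exact: lebesgue_measure_set1.
  apply/seteqP; split => x; rewrite /xsection/= ?inE/= tnthS.
    by [].
  by [].
case: (unliftP ord0 i) => [i'|] ->; case: (unliftP ord0 j) => [j'|] -> ij.
- have {ij} ij : i' != j' by apply: contra ij => /eqP ->.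
  rewrite /lebesgueN /= /cons_measure /pushforward.
  rewrite (_ : _ @^-1` _ = [set y | tnth y i' = tnth y j'] `*` setT).
    by rewrite product_measure1E//; [rewrite (IH _ _ ij) mul0e|exact: measurable_tie].
  by apply/seteqP; split => -[y x] /=; rewrite !tnthS//; case.
- rewrite -(tie0 i'); congr (lebesgueN (R := R) _ _).
  by apply/seteqP; split => y /= ->.
- exact: tie0.
- by rewrite eqxx in ij.
Qed.

(** By Tonelli the slice integral is an integrable function of the first coordinate, hence finite
    almost everywhere. This provides the [z] at which boxes with [Y_1] frozen have finite mass. *)
Lemma slice_finite_ae n (f : R ^^ n.+1 -> R) :
  measurable_fun setT f -> (forall y, (0 <= f y)%R) ->
  \int[lebesgueN n.+1]_y (f y)%:E < +oo ->
  exists M : set (measurableTypeR R),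
    [/\ measurable M, lebesgue_measure M = 0 &
      forall z, ~ M z -> \int[lebesgueN n]_y (f (cons_pair (y, z)))%:E < +oo].
Proof.
move=> mf f0 foo.
have [||mG GE] := integral_prod_measureS_swap n (fun=> lebesgue_measure) (EFin \o f).
  exact/measurable_EFinP.
  by move=> y; rewrite lee_fin.
set G := (fun x => _) in mG.
have G0 z : 0 <= G z by apply: integral_ge0 => y _; rewrite lee_fin.
exists (setT `&` G @^-1` [set +oo]); split.
- by apply: mG => //; exact: emeasurable_set1.
- have iG : lebesgue_measure.-integrable setT G.
    apply/integrableP; split => //.
    under eq_integral do rewrite gee0_abs//.
    by rewrite -GE.
  rewrite setTI; have := integrable_ae measurableT iG.
  case=> N [mN N0 NE].
  apply/eqP; rewrite eq_le measure_ge0 andbT -N0 le_measure// ?inE//.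
    by rewrite -[X in measurable X]setTI; apply: mG => //; exact: emeasurable_set1.
  by move=> z /= Gz; apply: NE => /= /(_ I); rewrite Gz.
- by move=> z; rewrite setTI => /= /eqP; rewrite -/(G z) ltey.
Qed.

Lemma integral_prod_measure_dirac n (mu : 'I_n.+1 -> sfm) (z : R)
    (F : R ^^ n.+1 -> \bar R) :
  measurable_fun setT F -> (forall y, 0 <= F y) ->
  mu ord0 = [the sfm of \d_(z : measurableTypeR R)] ->
  \int[prod_measure mu]_y F y =
  \int[prod_measure (fun i => mu (lift ord0 i))]_y F (cons_pair (y, z)).
Proof.
move=> mF F0 mu0; rewrite integral_prod_measureS// mu0.
apply: eq_integral => y _; rewrite integral_dirac// ?diracT ?mul1e//.
apply: measurableT_comp => //.
apply: (@measurableT_comp _ _ _ _ _ _ (@cons_pair R n)) => //.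
exact: measurable_cons_pair.
Qed.

Lemma integral_gt0 d (T : measurableType d) (mu : {measure set T -> \bar R})
    (D : set T) (g : T -> R) :
  measurable D -> measurable_fun D g -> (forall x, D x -> (0 < g x)%R) ->
  0 < mu D -> 0 < \int[mu]_(x in D) (g x)%:E.
Proof.
move=> mD mg g0 D0.
rewrite lt0e integral_ge0 ?andbT; last by move=> x /g0/ltW; rewrite lee_fin.
apply/eqP => int0.
have mg' : measurable_fun D (EFin \o g) by exact/measurable_EFinP.
have : ae_eq mu D (EFin \o g) (cst 0).
  apply/ae_eq_integral_abs => //.
  rewrite -[RHS]int0; apply: eq_integral => x /set_mem /g0 /ltW gx.
  by rewrite gee0_abs// lee_fin.
case=> N [mN N0 NE].
have : mu D <= 0.
  rewrite -N0 le_measure ?inE// => x Dx; apply: NE => /= /(_ Dx) [].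
  by apply/eqP; rewrite gt_eqF// g0.
by rewrite leNgt D0.
Qed.

End product_of_lines.

(** For a single [y] the positive and the negative part of an integral against [kappa y] may both be
    infinite, so distributivity has to cover [+oo - +oo]; [r] will be the density at [y]. *)
Lemma ge0_muleBl {R : realDomainType} (a b : \bar R) (r : R) :
  (0 <= a -> 0 <= b -> 0 <= r%:E -> (a - b) * r%:E = a * r%:E - b * r%:E)%E.
Proof.
move=> a0 b0; rewrite lee_fin le_eqVlt => /predU1P[<-|r0].
  by rewrite !mule0 sube0.
case: a b a0 b0 => [a||] [b||] //= _ _.
- by exact: (congr1 EFin (mulrBl r a b)).
- by rewrite gt0_mulye ?lte_fin//= gt0_mulNye ?lte_fin.
- by rewrite gt0_mulye ?lte_fin//= gt0_mulye ?lte_fin.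
- by rewrite gt0_mulye ?lte_fin//= gt0_mulNye ?lte_fin.
Qed.

Section slice_measure_facts.
Context {R : realType}.
Notation sfm := {sigma_finite_measure set (measurableTypeR R) -> \bar R}.

Lemma slice_measure1 (z : R) :
  slice_measure [set z] = [the sfm of \d_(z : measurableTypeR R)].
Proof.
have zE : get [set z] = z by have := getI (x := z) (P := [set z]) erefl.
by rewrite /slice_measure asboolT zE.
Qed.

Lemma slice_measure_lebesgue (J : set R) (a b : R) :
  J a -> J b -> a < b -> slice_measure J = [the sfm of lebesgue_measure].
Proof.
move=> Ja Jb ab; rewrite /slice_measure asboolF// => JE.
by move: Ja Jb; rewrite JE /= => aE bE; rewrite {1}aE bE ltxx in ab.
Qed.

Lemma slice_measure_itv_gt0 (J : set R) (a b : R) :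
  measurable (J : set (measurableTypeR R)) -> `[a, b] `<=` J -> a < b ->
  (0 < slice_measure J J)%E.
Proof.
move=> mJ abJ ab; rewrite (slice_measure_lebesgue J a b)//; last 2 first.
- by apply: abJ; rewrite /= in_itv/= lexx ltW.
- by apply: abJ; rewrite /= in_itv/= lexx andbT ltW.
have mI : measurable (`[a, b] : set (measurableTypeR R)) by exact: measurable_itv.
have : (lebesgue_measure (`[a, b] : set (measurableTypeR R)) <=
        lebesgue_measure J)%E by rewrite le_measure// inE.
apply: lt_le_trans; rewrite lebesgue_measure_itv/= lte_fin ab.
by rewrite -EFinD lte_fin subr_gt0.
Qed.

Lemma slice_measure1_gt0 (z : R) : (0 < slice_measure [set z] [set z])%E.
Proof. by rewrite slice_measure1 /= diracE mem_set. Qed.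

End slice_measure_facts.

Section slice_law.
Local Open Scope ereal_scope.
Context {R : realType} {n : nat} (f : R ^^ n -> R)
  (kappa : R.-pker (R ^^ n) ~> measurableTypeR R).
Implicit Types J : 'I_n -> set R.
Notation mcond J := (forall i, measurable (J i : set (measurableTypeR R))).

(** The hypotheses stand under the existential, with the zero measure as default, so that
    [slice_law] is defined for every [J]. *)
Lemma slice_law_exists J : exists rho : {measure set (measurableTypeR R) -> \bar R},
  measurable_fun setT f -> (forall y, (0 <= f y)%R) ->
  mcond J -> forall A, measurable A -> rho A =
    \int[prod_measure (fun i => slice_measure (J i))]_(y in box J)
      (kappa y A * (f y)%:E).
Proof.
have [[mf [f0 mJ]]|nmJ] := pselect
  (measurable_fun setT f /\ (forall y, (0 <= f y)%R) /\ mcond J); last first.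
  by exists mzero => mf f0 mJ; exfalso; apply: nmJ.
have [rho rhoE] := kernel_density_exists
  (prod_measure (fun i => slice_measure (J i))) kappa (box J) f
  (measurable_box _ _ mJ) (measurable_funTS mf) f0.
by exists rho.
Qed.

(* Unnormalized law of [X_1] on a condition that may have probability zero. *)
Definition slice_law J : {measure set (measurableTypeR R) -> \bar R} :=
  sval (cid (slice_law_exists J)).

Hypotheses (mf : measurable_fun setT f) (f0 : forall y, (0 <= f y)%R).

Lemma slice_lawE J : mcond J -> forall A, measurable A -> slice_law J A =
    \int[prod_measure (fun i => slice_measure (J i))]_(y in box J)
      (kappa y A * (f y)%:E).
Proof. by move=> mJ; rewrite /slice_law; case: cid => rho /= /(_ mf f0 mJ). Qed.

Lemma ge0_integral_slice_law J (g : R -> \bar R) : mcond J ->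
  measurable_fun (setT : set (measurableTypeR R)) g -> (forall x, 0 <= g x) ->
  \int[slice_law J]_x g x =
    \int[prod_measure (fun i => slice_measure (J i))]_(y in box J)
      (\int[kappa y]_x g x * (f y)%:E).
Proof.
move=> mJ mg g0; apply: ge0_integral_kernel_density => //.
- exact: measurable_box.
- exact: measurable_funTS.
- exact: slice_lawE.
Qed.

Lemma slice_massE J : mcond J -> slice_mass f J = slice_law J setT.
Proof.
move=> mJ; rewrite slice_lawE//; apply: eq_integral => y _.
by rewrite prob_kernel mul1e.
Qed.

Let measurable_int_kappa (g : R -> \bar R) :
  measurable_fun (setT : set (measurableTypeR R)) g -> (forall x, 0 <= g x) ->
  measurable_fun setT (fun y => \int[kappa y]_x g x).
Proof.
move=> mg g0; apply: measurable_fun_integral_kernel => // U mU.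
exact: (measurable_kernel kappa).
Qed.

(** Turns the numerators of [cexp] into integrals against one measure on the line. Absolute
    integrability, as in [cexp_exists], allows the positive and negative parts to be treated
    separately. *)
Lemma slice_integralE J (g : R -> R) : mcond J ->
  measurable_fun (setT : set (measurableTypeR R)) g ->
  slice_integral f kappa J (fun x => `|g x|%R) < +oo ->
  (slice_law J).-integrable setT (EFin \o g) /\
  slice_integral f kappa J g = \int[slice_law J]_x (g x)%:E.
Proof.
move=> mJ mg goo; have mg' : measurable_fun setT (EFin \o g : measurableTypeR R -> _).
  exact/measurable_EFinP.
have ig : (slice_law J).-integrable setT (EFin \o g).
  apply/integrableP; split => //.
  apply: le_lt_trans goo; rewrite le_eqVlt; apply/orP; left; apply/eqP.
  by rewrite ge0_integral_slice_law//; exact: measurableT_comp.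
split=> //.
pose gp := (EFin \o g)^\+; pose gn := (EFin \o g)^\-.
have mgp : measurable_fun (setT : set (measurableTypeR R)) gp.
  exact: measurable_funepos.
have mgn : measurable_fun (setT : set (measurableTypeR R)) gn.
  exact: measurable_funeneg.
rewrite integralE -/gp -/gn.
rewrite !ge0_integral_slice_law//; [|exact: funeneg_ge0|exact: funepos_ge0].
rewrite /slice_integral.
have mD : measurable (box J) by exact: measurable_box.
have int_part (h : R -> \bar R) :
    measurable_fun (setT : set (measurableTypeR R)) h -> (forall x, 0 <= h x) ->
    \int[slice_law J]_x h x < +oo ->
    (prod_measure (fun i => slice_measure (J i))).-integrable (box J)
      (fun y => \int[kappa y]_x h x * (f y)%:E).
  move=> mh h0 hoo; apply/integrableP; split.
    apply: emeasurable_funM; apply: measurable_funTS.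
      exact: measurable_int_kappa.
    exact/measurable_EFinP.
  under eq_integral.
    move=> y _; rewrite gee0_abs ?mule_ge0 ?lee_fin//; last exact: integral_ge0.
    over.
  by rewrite -ge0_integral_slice_law.
rewrite -integralB//; last 2 first.
- apply: int_part => //; first exact: funepos_ge0.
  exact: integral_funepos_lt_pinfty.
- apply: int_part => //; first exact: funeneg_ge0.
  exact: integral_funeneg_lt_pinfty.
apply: eq_integral => y _; rewrite integralE ge0_muleBl//.
- by apply: integral_ge0 => x _; exact: funepos_ge0.
- by apply: integral_ge0 => x _; exact: funeneg_ge0.
- by rewrite lee_fin.
Qed.

Lemma le_slice_law J J' A : mcond J -> mcond J' ->
  (forall i, slice_measure (J i) = slice_measure (J' i)) ->
  (forall i, J i `<=` J' i) -> measurable A -> slice_law J A <= slice_law J' A.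
Proof.
move=> mJ mJ' JJ' JsubJ' mA; rewrite !slice_lawE//.
have -> : (fun i => slice_measure (J i)) = (fun i => slice_measure (J' i)).
  exact/funext.
apply: ge0_subset_integral; [exact: measurable_box|exact: measurable_box|..].
- apply: emeasurable_funM; apply: measurable_funTS.
    exact: (measurable_kernel kappa).
  exact/measurable_EFinP.
- by move=> y _; rewrite mule_ge0 ?lee_fin.
- by move=> y yJ i; exact/JsubJ'/yJ.
Qed.

(** Positive dependence concerns closed boxes, whereas the competitors below the maximum range over
    all of [I] up to [z]; such conditions are reached as increasing limits. The reference measures
    stay the same along the sequence. *)
Lemma cvg_integral_slice_law (J : nat -> 'I_n -> set R) J' (g : R -> \bar R) :
  (forall k, mcond (J k)) ->
  (forall k i, slice_measure (J k i) = slice_measure (J' i)) ->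
  (forall i a b, (a <= b)%N -> J a i `<=` J b i) ->
  (forall i, J' i = \bigcup_k J k i) ->
  measurable_fun (setT : set (measurableTypeR R)) g -> (forall x, 0 <= g x) ->
  \int[slice_law (J k)]_x g x @[k --> \oo] --> \int[slice_law J']_x g x.
Proof.
move=> mJ JJ' ndJ J'E mg g0.
have mJ' : mcond J'.
  by move=> i; rewrite J'E; apply: bigcupT_measurable => k; exact: mJ.
rewrite ge0_integral_slice_law//.
rewrite (_ : (fun k => _) = fun k => \int[prod_measure (fun i =>
    slice_measure (J' i))]_(y in box (J k)) (\int[kappa y]_x g x * (f y)%:E)); last first.
  apply/funext => k; rewrite ge0_integral_slice_law//.
  by have -> : (fun i => slice_measure (J k i)) = (fun i => slice_measure (J' i))
    by exact/funext.
have -> : box J' = \bigcup_k box (J k).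
  apply/seteqP; split => [y yJ'|y [k _ yJ] i]; last first.
    by rewrite J'E; exists k => //; exact: yJ.
  (* Each coordinate enters its set at an index of its own; as the sets increase, the largest of
     these indices works for all coordinates. *)
  have : forall i, exists k, J k i (tnth y i).
    by move=> i; have := yJ' i; rewrite J'E => -[k _ ?]; exists k.
  move=> /choice[k kP]; exists (\max_i k i)%N => // i.
  by apply: ndJ (kP i); exact: leq_bigmax.
apply: ge0_nondecreasing_set_cvg_integral.
- by move=> a b ab; apply/subsetPset => y yJ i; exact: ndJ ab _ (yJ i).
- by move=> k; exact: measurable_box.
- move=> k; apply: emeasurable_funM; apply: measurable_funTS.
    exact: measurable_int_kappa.
  exact/measurable_EFinP.
- move=> k y _; rewrite mule_ge0 ?lee_fin//; exact: integral_ge0.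
Qed.

Lemma slice_law_gt0 J : mcond J ->
  (forall i, 0 < slice_measure (J i) (J i)) ->
  (forall y, box J y -> (0 < f y)%R) -> 0 < slice_law J setT.
Proof.
move=> mJ J0 fJ; rewrite -slice_massE//; apply: integral_gt0 => //.
- exact: measurable_box.
- exact: measurable_funTS.
- exact: prod_measure_box_gt0.
Qed.

End slice_law.

(** * Slice laws of nondegenerate boxes as probabilities *)

Section law_of_signals.
Local Open Scope ereal_scope.
Context {R : realType} {m : nat}.
Context {d : measure_display} {T : measurableType d} {P : probability T R}.
Variables X Y : 'I_m.+2 -> {RV P >-> R}.
Variables (f : R ^^ m.+2 -> R)
  (kappa : R.-pker (R ^^ m.+2) ~> measurableTypeR R).
Hypotheses (f_density : joint_density Y f) (kappa_law : conditional_law X Y kappa).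
Let mf : measurable_fun setT f. Proof. by case: f_density. Qed.
Let f0 y : (0 <= f y)%R. Proof. by case: f_density. Qed.

Lemma measurable_signals : measurable_fun setT (signals Y).
Proof.
apply/measurable_fun_tnthP => i.
rewrite (_ : _ \o _ = Y i); first last.
  by apply/funext => w /=; rewrite /signals tnth_mktuple.
have mYi : measurable_fun setT (Y i) by exact: measurable_funPT.
exact: mYi.
Qed.

(** The law of the signals is the mixture of the Dirac kernel on tuples with weight [f], so the
    general formula for mixtures applies. *)
Lemma ge0_integral_density (h : R ^^ m.+2 -> \bar R) :
  measurable_fun setT h -> (forall y, 0 <= h y) ->
  \int[P]_w h (signals Y w) = \int[lebesgueN m.+2]_y (h y * (f y)%:E).
Proof.
move=> mh h0.
have pushE : \int[pushforward P (signals Y)]_y h y = \int[P]_w h (signals Y w).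
  rewrite (ge0_integral_pushforward measurable_signals P measurableT mh)//.
have mid : measurable_fun setT (@id (R ^^ m.+2)) by exact: measurable_id.
have dens (A : set (R ^^ m.+2)) : measurable A -> pushforward P (signals Y) A =
    \int[lebesgueN m.+2]_(y in setT) (kdirac mid y A * (f y)%:E).
  move=> mA; rewrite /pushforward; have [_ _ ->//] := f_density.
  rewrite integral_mkcond; apply: eq_integral => y _.
  rewrite patchE /kdirac /= diracE.
  by case: ifPn => yA; rewrite ?mul1e ?mul0e.
have := ge0_integral_kernel_density (lebesgueN m.+2) (kdirac mid) setT f
   measurableT mf f0 _ dens h mh h0.
rewrite -pushE => ->.
  by apply: eq_integral => y _; rewrite integral_dirac//= diracT mul1e.
exact: measurable_signals.
Qed.

(** The bridge from the fixed versions [f] and [kappa] to probabilities: when every reference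
    measure is Lebesgue measure, the slice law is a joint probability and no longer depends on the
    versions. *)
Lemma slice_law_signals (J : 'I_m.+2 -> set R) A :
  (forall i, measurable (J i : set (measurableTypeR R))) ->
  (forall i, slice_measure (J i) = [the {sigma_finite_measure set _ -> \bar R}
     of lebesgue_measure]) -> measurable A ->
  slice_law f kappa J A =
  P ((X ord0 @^-1` A) `&` [set w | forall i, J i (Y i w)]).
Proof.
move=> mJ JE mA; rewrite slice_lawE//.
have -> : (fun i => slice_measure (J i)) = (fun=> lebesgue_measure).
  exact/funext.
have -> : [set w | forall i, J i (Y i w)] = signals Y @^-1` box J.
  apply/seteqP; split => w /= wJ i; last by have := wJ i; rewrite tnth_mktuple.
  by rewrite tnth_mktuple.
have mB : measurable (box J) by exact: measurable_box.
rewrite kappa_law// [RHS]integral_mkcond [LHS]integral_mkcond.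
pose h y := ((kappa ^~ A) \_ (box J)) y.
have mh : measurable_fun setT h.
  apply/(measurable_restrictT _ mB).
  by apply: measurable_funTS; exact: (measurable_kernel kappa).
transitivity (\int[P]_w h (signals Y w)); last first.
  by apply: eq_integral => w _; rewrite /h !patchE.
rewrite ge0_integral_density//; last first.
  by move=> y; rewrite /h patchE; case: ifP.
by apply: eq_integral => y _; rewrite /h !patchE; case: ifPn; rewrite ?mul0e.
Qed.

Lemma integral_slice_law_signals (J : 'I_m.+2 -> set R) (g : R -> \bar R) :
  (forall i, measurable (J i : set (measurableTypeR R))) ->
  (forall i, slice_measure (J i) = [the {sigma_finite_measure set _ -> \bar R}
     of lebesgue_measure]) ->
  measurable_fun (setT : set (measurableTypeR R)) g -> (forall x, 0 <= g x) ->
  \int[slice_law f kappa J]_x g x =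
  \int[P]_(w in [set w | forall i, J i (Y i w)]) g (X ord0 w).
Proof.
move=> mJ JE mg g0.
have mB : measurable (box J) by exact: measurable_box.
have mE : measurable [set w | forall i, J i (Y i w)].
  have -> : [set w | forall i, J i (Y i w)] = setT `&` signals Y @^-1` box J.
    rewrite setTI; apply/seteqP; split => w /= wJ i.
      by rewrite tnth_mktuple.
    by have := wJ i; rewrite tnth_mktuple.
  exact: measurable_signals.
have mX' : measurable_fun setT (X ord0) by exact: measurable_funPT.
have mX : measurable_fun setT (X ord0 : T -> measurableTypeR R) by exact: mX'.
(* The same law is also a mixture over outcomes, of Dirac masses at [X_1]. *)
have dens A : measurable A -> slice_law f kappa J A =
    \int[P]_(w in [set w | forall i, J i (Y i w)]) (kdirac mX w A * 1%:E).
  move=> mA; rewrite slice_law_signals//.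
  rewrite -[LHS]integral_indic// ?setIC.
    rewrite [LHS]integral_mkcond [RHS]integral_mkcond.
    by apply: eq_integral => w _; rewrite !patchE /kdirac /= mule1 diracE indicE.
  by rewrite -[X in measurable X]setTI; exact: mX.
have := ge0_integral_kernel_density P (kdirac mX) _ (fun=> 1%R) mE
  (measurable_cst _) (fun=> ler01) _ dens g mg g0.
by move=> ->; apply: eq_integral => w _; rewrite mule1 integral_dirac//= diracT mul1e.
Qed.

End law_of_signals.

(** * From distribution functions to Borel boxes, and exchangeability of the competitors *)

Lemma finite_measure_eq_rays {R : realType}
    (m1 m2 : {measure set (measurableTypeR R) -> \bar R}) :
  (m1 setT < +oo)%E ->
  (forall x : R, m1 [set y | y <= x] = m2 [set y | y <= x]) ->
  forall A, measurable A -> m1 A = m2 A.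
Proof.
move=> m1oo m12.
have mray (x : R) : measurable ([set y | y <= x] : set (measurableTypeR R)).
  rewrite (_ : [set y | y <= x] = `]-oo, x]%classic); first exact: measurable_itv.
  by apply/seteqP; split => y /=; rewrite in_itv.
have m1fin A : measurable A -> (m1 A < +oo)%E.
  by move=> mA; apply: le_lt_trans m1oo; rewrite le_measure ?inE.
have m12oc (a b : R) : m1 `]a, b]%classic = m2 `]a, b]%classic.
  have [ab|ba] := leP a b; last first.
    by rewrite set_itv_ge ?bnd_simp -?leNgt ?(ltW ba)// !measure0.
  have -> : `]a, b]%classic = [set y | y <= b] `\` [set y | y <= a] :> set R.
    apply/seteqP; split => y /=; rewrite in_itv/=.
      by move=> /andP[ay ->]; split=> //; apply/negP; rewrite -ltNge.
    by move=> [-> /negP]; rewrite -ltNge => ->.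
  have sub : [set y | y <= b] `&` [set y | y <= a] = [set y | y <= a] :> set R.
    apply/seteqP; split => y /= => [[]//|ya]; split => //.
    exact: le_trans ya ab.
  rewrite (measureD (mray b) (mray a)); last by apply: m1fin; exact: mray.
  rewrite (measureD (mray b) (mray a)) ?sub; last first.
    apply: le_lt_trans (m1fin _ (mray b)).
    by rewrite le_eqVlt; apply/orP; left; apply/eqP; exact: esym (m12 b).
  by congr (_ - _)%E; exact: m12.
move=> A mA; apply: (@g_sigma_algebra_measure_unique _ _ (measurableTypeR R) (@ocitv R) _
    (fun n => `](- n%:R), n%:R]%classic : set (measurableTypeR R)) _ _ _ _ _ _ _ _ mA).
- by move=> {mA A} A [[a b] _ <-]; exact: measurable_itv.
- by move=> n; exists (- n%:R, n%:R).
- apply/seteqP; split => // x _; exists (Num.truncn `|x|).+1 => //=.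
  rewrite in_itv/=.
  have h : `|x| < (Num.truncn `|x|).+1%:R by exact: truncnS_gt.
  by rewrite ltrNl -ltrN2 opprK; move: h; rewrite ltr_norml => /andP[]; lra.
- exact: ocitvI.
- by move=> {mA A} A [[a b] _ <-] /=; exact: m12oc.
- by move=> n; apply: m1fin; exact: measurable_itv.
Qed.

Lemma restricted_law_exists {R : realType} {d : measure_display}
    {T : measurableType d} (P : probability T R) (E : set T) (Z : T -> R) :
  measurable E -> measurable_fun setT Z ->
  exists rho : {measure set (measurableTypeR R) -> \bar R},
  forall A, measurable A -> rho A = P (Z @^-1` A `&` E).
Proof.
move=> mE mZ.
have mZ' : measurable_fun setT (Z : T -> measurableTypeR R) by exact: mZ.
have [rho rhoE] := kernel_density_exists P (kdirac mZ') E (fun=> 1)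
  mE (measurable_cst _) (fun=> ler01).
exists rho => A mA; rewrite rhoE//.
rewrite -[RHS]integral_indic//; last first.
  by rewrite -[X in measurable X]setTI; exact: mZ.
by apply: eq_integral => w _; rewrite /kdirac /= mule1 diracE indicE.
Qed.

(** Coordinates pass from rays to Borel sets one at a time: [s] lists those already treated. With
    the conditions on the other coordinates fixed, one more coordinate is an equality of two finite
    measures on the line that agree on rays. *)
Lemma joint_law_eq_rays {R : realType} {d : measure_display}
    {T : measurableType d} (P : probability T R) (Ix : finType)
    (V W : Ix -> T -> R) :
  (forall i, measurable_fun setT (V i)) -> (forall i, measurable_fun setT (W i)) ->
  (forall c : Ix -> R,
    P [set w | forall i, V i w <= c i] = P [set w | forall i, W i w <= c i]) ->
  forall B : Ix -> set R, (forall i, measurable (B i : set (measurableTypeR R))) ->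
  P [set w | forall i, B i (V i w)] = P [set w | forall i, B i (W i w)].
Proof.
move=> mV mW VW B mB.
have mray (x : R) : measurable ([set y | y <= x] : set (measurableTypeR R)).
  rewrite (_ : [set y | y <= x] = `]-oo, x]%classic); first exact: measurable_itv.
  by apply/seteqP; split => y /=; rewrite in_itv.
have mvec (Z : Ix -> T -> R) (S : Ix -> set R) :
    (forall i, measurable_fun setT (Z i)) ->
    (forall i, measurable (S i : set (measurableTypeR R))) ->
    measurable [set w | forall i, S i (Z i w)].
  move=> mZ mS; rewrite (_ : [set w | _] =
      \bigcap_(i in [set: Ix]) (setT `&` Z i @^-1` S i)).
    apply: fin_bigcap_measurable => [|i _]; first exact: finite_finset.
    exact: (mZ i measurableT _ (mS i)).
  apply/seteqP; split => w /= wS i; first by move=> _; split.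
  by have [] := wS i I.
suff key (s : seq Ix) (c : Ix -> R) :
    P [set w | forall i, (if i \in s then B i else [set y | y <= c i]) (V i w)] =
    P [set w | forall i, (if i \in s then B i else [set y | y <= c i]) (W i w)].
  have := key (enum Ix) (fun=> 0).
  have E Z : [set w | forall i, (if i \in enum Ix then B i else [set y | y <= 0]) (Z i w)]
     = [set w | forall i, B i (Z i w)].
    by apply/seteqP; split => w /= wB i; have := wB i; rewrite mem_enum.
  by rewrite !E.
elim: s c => [|k s IH] c; first exact: VW.
have [ks|kns] := boolP (k \in s).
  rewrite (_ : (fun w => _) = fun w => forall i,
      (if i \in s then B i else [set y | y <= c i]) (V i w)).
    rewrite IH; congr (P _); apply/seteqP; split => w wE i; have := wE i;
      by rewrite inE; case: eqVneq => // ->; rewrite ks.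
  apply/funext => w; apply/propext; split => wE i; have := wE i;
    by rewrite inE; case: eqVneq => // ->; rewrite ks.
pose S i := if i \in s then B i else [set y | y <= c i].
have mS i : measurable (S i : set (measurableTypeR R)).
  by rewrite /S; case: ifP => _; [exact: mB|exact: mray].
pose E (Z : Ix -> T -> R) := [set w | forall i, i != k -> S i (Z i w)].
have mE Z : (forall i, measurable_fun setT (Z i)) -> measurable (E Z).
  move=> mZ; rewrite (_ : E Z = [set w | forall i,
      (if i == k then setT else S i) (Z i w)]).
    apply: (mvec Z (fun i => if i == k then setT else S i)) => // i.
    by case: ifP.
  apply/seteqP; split => w wE i; first by case: eqVneq => // ik; exact: wE.
  by move=> ik; have := wE i; rewrite (negbTE ik).
have split_k (Z : Ix -> T -> R) (A : set R) :
    Z k @^-1` A `&` E Z = [set w | forall i, (if i == k then A else S i) (Z i w)].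
  apply/seteqP; split => w /=.
    by move=> [Aw Ew] i; case: eqVneq => [->//|ik]; exact: Ew.
  move=> wE; split; first by have := wE k; rewrite eqxx.
  by move=> i ik; have := wE i; rewrite (negbTE ik).
have step (A : set (measurableTypeR R)) : measurable A ->
    P (V k @^-1` A `&` E V) = P (W k @^-1` A `&` E W).
  have [rV rVE] := restricted_law_exists P (E V) (V k) (mE _ mV) (mV k).
  have [rW rWE] := restricted_law_exists P (E W) (W k) (mE _ mW) (mW k).
  move=> mA; rewrite -rVE// -rWE//; apply: finite_measure_eq_rays mA.
    by rewrite rVE// preimage_setT setTI -ge0_fin_numE// fin_num_measure//; exact: mE.
  move=> x; rewrite rVE// rWE// !split_k.
  pose c' i := if i == k then x else c i.
  have cE Z : [set w | forall i, (if i == k then [set y | y <= x] else S i) (Z i w)] =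
      [set w | forall i, (if i \in s then B i else [set y | y <= c' i]) (Z i w)].
    apply/seteqP; split => w wE i; have := wE i; rewrite /c' /S;
      by case: eqVneq => [->|//]; rewrite (negbTE kns).
  by rewrite !cE.
have consE Z : [set w | forall i,
      (if i \in k :: s then B i else [set y | y <= c i]) (Z i w)] =
    Z k @^-1` B k `&` E Z.
  rewrite split_k; apply/seteqP; split => w wE i; have := wE i; rewrite inE /S;
    by case: eqVneq => [->|].
by rewrite !consE; exact: step.
Qed.

Section symmetric_boxes.
Local Open Scope ereal_scope.
Context {R : realType} {m : nat}.
Context {d : measure_display} {T : measurableType d} {P : probability T R}.
Variables X Y : 'I_m.+2 -> {RV P >-> R}.
Hypothesis XY_symmetric : symmetric_law X Y.

Lemma symmetric_law_box (s : {perm 'I_m.+1}) (A B0 : set R) (B : 'I_m.+1 -> set R) :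
  measurable (A : set (measurableTypeR R)) ->
  measurable (B0 : set (measurableTypeR R)) ->
  (forall j, measurable (B j : set (measurableTypeR R))) ->
  P [set w | A (X ord0 w) /\ B0 (Y ord0 w) /\ forall j, B (s j) (Y (lift ord0 j) w)] =
  P [set w | A (X ord0 w) /\ B0 (Y ord0 w) /\ forall j, B j (Y (lift ord0 j) w)].
Proof.
move=> mA mB0 mB.
(* The index [None] stands for the value, [Some None] for the signal of buyer 1 and [Some (Some j)]
   for the competitors. *)
pose Q (i : option (option 'I_m.+1)) : set R :=
  if i is Some i' then (if i' is Some j then B j else B0) else A.
pose V (p : 'I_m.+1 -> 'I_m.+1) (i : option (option 'I_m.+1)) : T -> R :=
  if i is Some i' then (if i' is Some j then Y (lift ord0 (p j)) else Y ord0) else X ord0.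
have VE (q : option (option 'I_m.+1) -> set R) p : [set w | forall i, q i (V p i w)] =
    [set w | q None (X ord0 w) /\ q (Some None) (Y ord0 w) /\
       forall j, q (Some (Some j)) (Y (lift ord0 (p j)) w)].
  apply/seteqP; split => w /=.
    move=> wq; split; first exact: (wq None).
    split; first exact: (wq (Some None)).
    by move=> j; exact: (wq (Some (Some j))).
  by move=> [h1 [h2 h3]] [[j|]|] //=; exact: h3.
have key := joint_law_eq_rays P (option (option 'I_m.+1)) (V (s^-1)%g) (V id) _ _ _ Q.
rewrite !VE /= in key.
rewrite -[RHS]key.
- congr (P _); apply/seteqP; split => w /= [h1 [h2 h3]]; split=> //; split=> // j.
    by have := h3 ((s^-1)%g j); rewrite permKV.
  by have := h3 (s j); rewrite permK.
- by move=> [[j|]|]; exact: measurable_funPT.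
- by move=> [[j|]|]; exact: measurable_funPT.
- move=> c; have VEc p : [set w | forall i, (V p i w <= c i)%R] = _ :=
    VE (fun i => [set y | (y <= c i)%R]) p.
  rewrite !VEc /=.
  have := (XY_symmetric.2 ord0 (c None) (c (Some None))
     (fun j => c (Some (Some j))) s).
  rewrite /joint_cdf => <-.
  congr (P _); apply/seteqP; split => w /= [h1 [h2 h3]]; split=> //; split=> // j.
    by have := h3 (s j); rewrite permK.
  by have := h3 ((s^-1)%g j); rewrite permKV.
- by move=> [[j|]|]; [exact: mB|exact: mB0|exact: mA].
Qed.

End symmetric_boxes.

(** * Null events and absolute continuity of the signals *)

Section null_events.
Local Open Scope ereal_scope.
Context {R : realType} {m : nat}.
Context {d : measure_display} {T : measurableType d} {P : probability T R}.
Variables Y : 'I_m.+2 -> {RV P >-> R}.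
Variables (f : R ^^ m.+2 -> R).
Hypotheses (f_density : joint_density Y f).

Let null_signals B : measurable B -> lebesgueN m.+2 B = 0 ->
  P (signals Y @^-1` B) = 0.
Proof.
move=> mB B0; have [mf f0 ->//] := f_density.
apply: null_set_integral => //.
apply/measurable_EFinP; exact: measurable_funTS.
Qed.

Lemma signal_null (i : 'I_m.+2) (M : set (measurableTypeR R)) :
  measurable M -> lebesgue_measure M = 0 -> P (Y i @^-1` M) = 0.
Proof.
move=> mM M0.
pose J (j : 'I_m.+2) : set (measurableTypeR R) := if j == i then M else setT.
have mJ j : measurable (J j) by rewrite /J; case: ifP.
have -> : Y i @^-1` M = signals Y @^-1` box J.
  apply/seteqP; split => w /=.
    by move=> Mw j; rewrite tnth_mktuple /J; case: eqVneq => [->|].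
  by move=> /(_ i); rewrite tnth_mktuple /J eqxx.
apply: null_signals; first exact: measurable_box.
by apply: (prod_measure_box_eq0 _ _ _ i) => //; rewrite /J eqxx.
Qed.

Lemma signal_tie_null (i j : 'I_m.+2) : i != j ->
  P [set w | Y i w = Y j w] = 0.
Proof.
move=> ij; rewrite -[RHS](null_signals _ (measurable_tie _ i j) (lebesgueN_tie _ _ _ ij)).
by congr (P _); apply/seteqP; split => w /=; rewrite !tnth_mktuple.
Qed.

(** Borel-Cantelli: otherwise there are sets of summable Lebesgue measure, each met by the signal
    with probability at least [e]. Their upper limit is Lebesgue null, yet the signal meets it with
    probability at least [e]. *)
Lemma signal_absolutely_continuous (i : 'I_m.+2) (e : R) : (0 < e)%R ->
  exists2 r : R, (0 < r)%R & forall A : set (measurableTypeR R), measurable A ->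
    lebesgue_measure A < r%:E -> P (Y i @^-1` A) < e%:E.
Proof.
move=> e0; apply: contrapT => H.
have {H} : forall n, exists A : set (measurableTypeR R),
    [/\ measurable A, lebesgue_measure A < (2 ^- n.+1)%:E & e%:E <= P (Y i @^-1` A)].
  move=> n; apply: contrapT => nA; apply: H.
  exists (2 ^- n.+1); first by rewrite invr_gt0 exprn_gt0.
  move=> A mA Ar; rewrite ltNge; apply/negP => eA.
  by apply: nA; exists A.
move=> /choice[F /= H].
have mF k : measurable (F k) by have [] := H k.
have mYF k : measurable (Y i @^-1` F k).
  have mYi : measurable_fun setT (Y i) by exact: measurable_funPT.
  by rewrite -[X in measurable X]setTI; exact: (mYi measurableT _ (mF k)).
have : lebesgue_measure (lim_sup_set F) = 0.
  apply: lim_sup_set_cvg0 => //.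
  apply: (@le_lt_trans _ _ (\sum_(0 <= n <oo) (1 / (2 ^ n.+1)%:R)%:E)).
    apply: lee_nneseries => // n _.
    by have [_ /ltW + _] := H n; rewrite div1r natrX.
  have h : (\sum_(0 <= n < k) (1 / (2 ^ n.+1)%:R : R)%:E)%E @[k --> \oo] --> (1%E : \bar R).
    rewrite (_ : (fun k => _) =
        fun k => \sum_(0 <= n < k) (1 / (2 ^ (n + 1))%:R : R)%:E); last first.
      by apply/funext => k; apply: eq_bigr => j _; rewrite addn1.
    have := @cvg_geometric_eseries_half R 1 0; rewrite expr0 divr1.
    exact.
  by move/cvg_lim : h => ->//; rewrite ltry.
have mL : measurable (lim_sup_set F).
  by apply: bigcap_measurable => // k _; exact: bigcup_measurable.
move=> /(signal_null i _ mL) PL0.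
have {}PL0 : P (lim_sup_set (fun k => Y i @^-1` F k)) = 0 := PL0.
have := @lim_sup_set_cvg _ _ _ P (fun k => Y i @^-1` F k) mYF.
move=> /(_ _) h.
have : e%:E <= 0%E.
  have hoo : P (\bigcup_(k in [set k | (0 <= k)%N]) (Y i @^-1` F k)) < +oo.
    by rewrite ltey_eq fin_num_measure//; exact: bigcup_measurable.
  rewrite -[leRHS]PL0; apply: (cvge_ge _ (h hoo)).
  apply: nearW => n; have [_ _ /le_trans] := H n; apply.
  rewrite le_measure// ?inE//; first exact: bigcup_measurable.
  by move=> w Fw; exists n => //=.
by rewrite lee_fin leNgt e0.
Qed.

End null_events.

(** The left end of [I] is approached by points of [I] itself, because positive dependence only
    allows endpoints in [I]. The three sequences correspond to a closed, an open and an infinite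
    left end. *)
Lemma cofinal_below {R : realType} (I : interval R) (x0 : R) : x0 \in I ->
  exists e : nat -> R, [/\ forall n, e n \in I,
    forall a b, (a <= b)%N -> e b <= e a, forall n, e n <= x0 &
    forall x, x \in I -> exists n, e n <= x].
Proof.
case: I => l r; rewrite itv_boundlr => /andP[lx0 x0r].
have below y : (l <= BLeft y)%O -> y <= x0 -> y \in Interval l r.
  move=> ly yx; rewrite itv_boundlr ly /=.
  by apply: le_trans x0r; rewrite leBRight_ltBLeft; rewrite bnd_simp.
have inv_le (a b : nat) : (a <= b)%N -> (b.+1%:R^-1 : R) <= a.+1%:R^-1.
  by move=> ab; rewrite lef_pV2 ?posrE// ler_nat.
case: l lx0 below => [[] l|[]] // lx0 below.
- exists (fun=> l); split=> //.
  + by move=> _; apply: below => //; move: lx0; rewrite bnd_simp.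
  + by move=> x; rewrite itv_boundlr => /andP[+ _]; rewrite bnd_simp; exists 0%N.
- have lx : l < x0 by move: lx0; rewrite bnd_simp.
  pose e n := l + (x0 - l) * n.+1%:R^-1.
  have le n : l < e n by rewrite /e ltrDl mulr_gt0// subr_gt0.
  have ex n : e n <= x0.
    have : (x0 - l) * n.+1%:R^-1 <= (x0 - l) * 1.
      by rewrite ler_wpM2l ?subr_ge0 ?(ltW lx)// invf_le1// ler1n.
    by rewrite /e mulr1 -lerBrDl.
  exists e; split => //.
  + by move=> n; apply: below => //; rewrite bnd_simp.
  + move=> a b ab; rewrite /e lerD2l ler_wpM2l ?subr_ge0 ?(ltW lx)//.
    exact: inv_le.
  + move=> x; rewrite itv_boundlr => /andP[+ _]; rewrite bnd_simp => lx'.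
    have q0 : 0 < (x - l) / (x0 - l) by rewrite divr_gt0 ?subr_gt0.
    exists (Num.truncn ((x - l) / (x0 - l))^-1).
    rewrite /e -lerBrDl -ler_pdivlMl ?subr_gt0// mulrC.
    rewrite -[leRHS]invrK lef_pV2 ?posrE ?invr_gt0//; last first.
      by rewrite mulr_gt0// ?invr_gt0 subr_gt0.
    rewrite mulrC.
    exact/ltW/truncnS_gt.
- exists (fun n => x0 - n%:R); split.
  + by move=> n; apply: below => //; rewrite gerBl.
  + by move=> a b ab; rewrite lerD2l lerN2 ler_nat.
  + by move=> n; rewrite gerBl.
  + move=> x _; exists (Num.truncn (x0 - x)).+1.
    have := truncnS_gt (x0 - x); lra.
Qed.

Lemma cofinal_above {R : realType} (I : interval R) (x0 : R) : x0 \in I ->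
  exists e : nat -> R, [/\ forall n, e n \in I,
    forall a b, (a <= b)%N -> e a <= e b &
    forall x, x \in I -> exists n, x <= e n].
Proof.
case: I => l r x0I.
(* The mirror image of [I] under negation, which reduces the claim to [cofinal_below]. *)
pose I' := 
  let opp c := match c with BSide b y => BSide (~~ b) (- y)
               | BInfty b => BInfty _ (~~ b) end in Interval (opp r) (opp l).
have opp_in (x : R) : x \in Interval l r -> - x \in I'.
  rewrite /I' !itv_boundlr => /andP[h1 h2]; apply/andP; split.
    by move: h2; case: (r) => [[]z|[]] //; rewrite !bnd_simp; lra.
  by move: h1; case: (l) => [[]z|[]] //; rewrite !bnd_simp; lra.
have in_opp (x : R) : x \in I' -> - x \in Interval l r.
  rewrite /I' !itv_boundlr => /andP[h1 h2]; apply/andP; split.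
    by move: h2; case: (l) => [[]z|[]] //; rewrite !bnd_simp; lra.
  by move: h1; case: (r) => [[]z|[]] //; rewrite !bnd_simp; lra.
have [e [eI end_ _ ecof]] := cofinal_below I' (- x0) (opp_in _ x0I).
exists (fun n => - e n); split.
- by move=> n; exact: in_opp.
- by move=> a b ab; rewrite lerN2 end_.
- by move=> x /opp_in /ecof[n en]; exists n; rewrite lerNr.
Qed.

Lemma bounded_integrable {R : realType} {d : measure_display}
    {T : measurableType d} (mu : {measure set T -> \bar R}) (h : T -> R) (M : R) :
  (mu setT < +oo)%E -> measurable_fun setT h -> (forall x, 0 <= h x <= M) ->
  mu.-integrable setT (EFin \o h).
Proof.
move=> muoo mh hM; apply: (le_integrable measurableT _ _ (g := EFin \o cst M)).
- exact/measurable_EFinP.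
- move=> x _ /=; have /andP[h0 hx] := hM x.
  by rewrite lee_fin !ger0_norm// (le_trans h0).
- apply/integrableP; split; first by apply/measurable_EFinP; exact: measurable_cst.
  rewrite [X in (X < _)%E](_ : _ = (\int[mu]_x (cst `|M|%:E) x)%E)//.
  by rewrite integral_cst//= lte_mul_pinfty.
Qed.

(** * Positive dependence *)

(* [positive_dependence] only concerns strictly increasing observables: a small
   multiple of [sigmoid] is added to those that are merely nondecreasing. *)
Section sigmoid.
Context {R : realType}.

Definition sigmoid (x : R) : R := expR x / (1 + expR x).

Lemma sigmoid_bounds x : 0 <= sigmoid x <= 1.
Proof.
have e0 := expR_gt0 x; have e1 : 0 < 1 + expR x by lra.
rewrite /sigmoid divr_ge0 ?(ltW e0) ?(ltW e1)//= ler_pdivrMr// mul1r; lra.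
Qed.

Lemma sigmoid_increasing : {homo sigmoid : x y / x < y}.
Proof.
move=> x y xy; rewrite /sigmoid.
have ex := expR_gt0 x; have ey := expR_gt0 y.
rewrite ltr_pdivrMr; last lra.
rewrite mulrAC ltr_pdivlMr; last lra.
have : expR x < expR y by rewrite ltr_expR.
by rewrite mulrDr mulrDr !mulr1 [expR y * _]mulrC ltrD2r.
Qed.

Lemma measurable_sigmoid : measurable_fun setT sigmoid.
Proof.
apply: continuous_measurable_fun => x; apply: cvgM; first exact: continuous_expR.
apply: cvgV; first by have := expR_gt0 x; lra.
by apply: cvgD; [exact: cvg_cst|exact: continuous_expR].
Qed.

End sigmoid.

Definition ratio {R : realType} (nu : {measure set (measurableTypeR R) -> \bar R})
  (h : R -> R) : R := (\int[nu]_x h x) / fine (nu setT).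

(* Configurations of conditions on the signals that treat buyer 1, one
   competitor [lift ord0 k] and the remaining competitors uniformly. *)
Definition cf {m : nat} {A : Type} (k : 'I_m.+1) (x0 xk xo : A) (i : 'I_m.+2) : A :=
  if i == ord0 then x0 else if i == lift ord0 k then xk else xo.

Lemma cfP {m : nat} {A : Type} (k : 'I_m.+1) (x0 xk xo : A) (p : A -> Prop) :
  p x0 -> p xk -> p xo -> forall i, p (cf k x0 xk xo i).
Proof. by move=> ? ? ? i; rewrite /cf; case: ifP => // _; case: ifP. Qed.

Section dependence.
Context {R : realType} {m : nat}.
Variables (I : interval R) (f : R ^^ m.+2 -> R)
  (kappa : R.-pker (R ^^ m.+2) ~> measurableTypeR R).
Hypotheses (mf : measurable_fun setT f) (f0 : forall y, 0 <= f y).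
Hypothesis f_positive : forall y : R ^^ m.+2, all_in I (tnth y) -> 0 < f y.
Hypothesis XY_dependence : positive_dependence I f kappa.
Implicit Types (a b : 'I_m.+2 -> R) (h : R -> R).

Notation law J := (slice_law f kappa J).
Definition itvs a b (i : 'I_m.+2) : set R := `[a i, b i]%classic.

Lemma measurable_itvs a b i : measurable (itvs a b i : set (measurableTypeR R)).
Proof. exact: measurable_itv. Qed.

Lemma itvs_cf k (a0 ak ao b0 bk bo : R) :
  itvs (cf k a0 ak ao) (cf k b0 bk bo) = cf k `[a0, b0]%classic `[ak, bk]%classic `[ao, bo]%classic.
Proof.
apply/funext => i; rewrite /itvs /cf; case: ifP => // _; by case: ifP.
Qed.

Lemma slice_measure_itv_self_gt0 (a b : R) : a <= b ->
  (0 < slice_measure `[a, b]%classic `[a, b]%classic)%E.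
Proof.
rewrite le_eqVlt => /predU1P[->|ab].
  by rewrite set_itv1; exact: slice_measure1_gt0.
apply: (slice_measure_itv_gt0 _ a b) => //; exact: measurable_itv.
Qed.

Lemma law_itvs_gt0 a b : all_in I a -> all_in I b -> (forall i, a i <= b i) ->
  (0 < law (itvs a b) setT)%E.
Proof.
move=> aI bI ab; apply: slice_law_gt0 => //.
- exact: measurable_itvs.
- by move=> i; exact: slice_measure_itv_self_gt0.
- move=> y yJ; apply: f_positive => i; have := yJ i.
  rewrite /itvs/= in_itv/= => /andP[ay yb].
  by apply: (@interval_is_interval _ I (a i) (b i)); rewrite /= ?aI ?bI ?ay.
Qed.

(** The form of positive dependence used from here on: bounded observables that are only
    nondecreasing, weak moves of an endpoint, and finiteness of the two masses instead of existence
    of the two expectations. *)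
Lemma dependence_step h (M : R) (i : 'I_m.+2) a b a' b' :
  {homo h : x y / x <= y} -> measurable_fun setT h -> (forall x, 0 <= h x <= M) ->
  all_in I a -> all_in I b -> (forall j, a j <= b j) ->
  all_in I a' -> all_in I b' -> (forall j, a' j <= b' j) ->
  (law (itvs a b) setT < +oo)%E -> (law (itvs a' b') setT < +oo)%E ->
  (forall j, j != i -> a' j = a j /\ b' j = b j) ->
  (a i <= a' i /\ b' i = b i) \/ (a' i = a i /\ b i <= b' i) ->
  ratio (law (itvs a b)) h <= ratio (law (itvs a' b')) h.
Proof.
move=> h_nd mh hM aI bI ab a'I b'I ab' oo oo' agree change.
(* Positive dependence only speaks of strict moves, so an endpoint that stays in place is set
   aside. *)
have [[ai bi]|ne] := pselect (a' i = a i /\ b' i = b i).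
  have -> : a' = a.
    by apply/funext => j; have [->//|/agree[]] := eqVneq j i.
  have -> // : b' = b.
  by apply/funext => j; have [->//|/agree[]] := eqVneq j i.
have {change} change : (a i < a' i /\ b' i = b i) \/ (a' i = a i /\ b i < b' i).
  case: change => -[].
    rewrite le_eqVlt => /predU1P[ai bi|ai bi]; last by left.
    by exfalso; apply: ne.
  move=> ai; rewrite le_eqVlt => /predU1P[bi|bi]; last by right.
  by exfalso; apply: ne.
have m0 := law_itvs_gt0 _ _ aI bI ab.
have m0' := law_itvs_gt0 _ _ a'I b'I ab'.
have mh' : measurable_fun (setT : set (measurableTypeR R)) h by exact: mh.
have ms : measurable_fun (setT : set (measurableTypeR R)) (@sigmoid R).
  exact: measurable_sigmoid.
have int_h (nu : {measure set (measurableTypeR R) -> \bar R}) :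
    (nu setT < +oo)%E -> nu.-integrable setT (EFin \o h).
  by move=> nuoo; exact: (bounded_integrable _ _ M).
have int_s (nu : {measure set (measurableTypeR R) -> \bar R}) :
    (nu setT < +oo)%E -> nu.-integrable setT (EFin \o sigmoid).
  by move=> nuoo; apply: (bounded_integrable _ _ 1) => //; exact: sigmoid_bounds.
pose he (e : R) x := h x + e * sigmoid x.
have mhe e : measurable_fun (setT : set (measurableTypeR R)) (he e).
  by apply: measurable_funD => //; apply: measurable_funM.
have he0 (e : R) x : 0 < e -> 0 <= he e x <= M + e.
  move=> e0; have /andP[h0 hM'] := hM x; have /andP[s0 s1] := sigmoid_bounds x.
  have := ler_wpM2l (ltW e0) s1; have := mulr_ge0 (ltW e0) s0.
  by rewrite /he; lra.
have rE e (nu : {measure set (measurableTypeR R) -> \bar R}) : (nu setT < +oo)%E ->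
    ratio nu (he e) = ratio nu h + e * ratio nu sigmoid.
  move=> nuoo; rewrite /ratio /he RintegralD//; last first.
  - by have := integrableZl measurableT e (int_s _ nuoo).
  - exact: int_h.
  by rewrite RintegralZl//; [rewrite mulrDl mulrA|exact: int_s].
have exists_e (e : R) a1 b1 : 0 < e -> (law (itvs a1 b1) setT < +oo)%E ->
    box_cexp_exists f kappa a1 b1 (he e) /\
    box_cexp f kappa a1 b1 (he e) = ratio (law (itvs a1 b1)) (he e).
  move=> e0 oo1.
  have mJ := measurable_itvs a1 b1.
  have Joo : (slice_integral f kappa (itvs a1 b1) (fun x => `|he e x|%R) < +oo)%E.
    have -> : slice_integral f kappa (itvs a1 b1) (fun x => `|he e x|%R) =
        (\int[law (itvs a1 b1)]_x (`|he e x|%R)%:E)%E.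
      rewrite (ge0_integral_slice_law _ kappa mf f0 _ _ mJ)//.
      apply/measurable_EFinP; exact: measurableT_comp.
    have : (law (itvs a1 b1)).-integrable setT (EFin \o he e).
      apply: (bounded_integrable _ _ (M + e)) => // x; exact: he0.
    by case/integrableP.
  have [ie SIE] := slice_integralE _ kappa mf f0 _ _ mJ (mhe e) Joo.
  have ME := slice_massE _ kappa mf f0 _ mJ.
  split; first by split; rewrite big_ord1 /box_cond -/(itvs a1 b1) ?ME.
  rewrite /box_cexp /cexp !big_ord1 /box_cond -/(itvs a1 b1) ME SIE.
  by rewrite /ratio.
have key (e : R) : 0 < e -> ratio (law (itvs a b)) (he e) <= ratio (law (itvs a' b')) (he e).
  move=> e0; have [ex1 <-] := exists_e e a b e0 oo.
  have [ex2 <-] := exists_e e a' b' e0 oo'.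
  have he_incr : {homo he e : x y / x < y}.
    move=> x y xy; rewrite /he ler_ltD// ?h_nd ?(ltW xy)//.
    by rewrite ltr_pM2l// sigmoid_increasing.
  have := XY_dependence (he e) i a b a' b' he_incr aI bI ab a'I b'I ab' ex1 ex2 agree change.
  move: (box_cexp f kappa a b (he e)) (box_cexp f kappa a' b' (he e)) => x y.
  by case: (i == ord0) => [/ltW|].
have key2 (e : R) : 0 < e -> ratio (law (itvs a b)) h + e * ratio (law (itvs a b)) sigmoid
    <= ratio (law (itvs a' b')) h + e * ratio (law (itvs a' b')) sigmoid.
  by move=> e0; rewrite -!rE//; exact: key.
apply/ler_addgt0Pr => e e0.
pose s := ratio (law (itvs a' b')) sigmoid - ratio (law (itvs a b)) sigmoid.
have s1 : 0 < `|s| + 1 by have := normr_ge0 s; lra.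
(* The perturbation enters the comparison only through [s] times its size; this size keeps that
   product below [e], also when [s] is zero. *)
have := key2 (e / (`|s| + 1)) (divr_gt0 e0 s1).
have : e / (`|s| + 1) * s <= e.
  rewrite mulrAC ler_pdivrMr// ler_pM2l//.
  by have := ler_norm s; lra.
by rewrite /s; lra.
Qed.

End dependence.

Lemma measurable_others {R : realType} (I : interval R) (z : R) :
  measurable ([set x | x \in I /\ x <= z] : set (measurableTypeR R)).
Proof.
have -> : [set x | x \in I /\ x <= z] = [set` I] `&` `]-oo, z]%classic.
  by apply/seteqP; split => x /=; rewrite in_itv.
by apply: measurableI; exact: measurable_itv.
Qed.

Lemma measurable_signal_event {R : realType} {m : nat} {d : measure_display}
    {T : measurableType d} {P : probability T R} (Y : 'I_m.+2 -> {RV P >-> R})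
    (J : 'I_m.+2 -> set R) :
  (forall i, measurable (J i : set (measurableTypeR R))) ->
  measurable [set w | forall i, J i (Y i w)].
Proof.
move=> mJ; have -> : [set w | forall i, J i (Y i w)] = setT `&` signals Y @^-1` box J.
  rewrite setTI; apply/seteqP; split => w /= wJ i.
    by rewrite tnth_mktuple.
  by have := wJ i; rewrite tnth_mktuple.
apply: measurable_signals => //; exact: measurable_box.
Qed.

(** * Chains of boxes between point conditions *)

Section chains.
Context {R : realType} {m : nat}.
Context {d : measure_display} {T : measurableType d} {P : probability T R}.
Variables X Y : 'I_m.+2 -> {RV P >-> R}.
Variables (I : interval R) (f : R ^^ m.+2 -> R)
  (kappa : R.-pker (R ^^ m.+2) ~> measurableTypeR R).
Hypotheses (XY_symmetric : symmetric_law X Y) (f_density : joint_density Y f).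
Hypothesis f_positive : forall y : R ^^ m.+2, all_in I (tnth y) -> 0 < f y.
Hypotheses (kappa_law : conditional_law X Y kappa)
  (XY_dependence : positive_dependence I f kappa).
Notation law J := (slice_law f kappa J).
Notation lebesgue := [the {sigma_finite_measure set (measurableTypeR R) -> \bar R}
  of lebesgue_measure].
Hypothesis yz_finite : forall z k, z \in I -> (law (YZ_cond I z z k) setT < +oo)%E.

Let mf : measurable_fun setT f.
Proof. by case: f_density. Qed.
Let f0 y : 0 <= f y.
Proof. by case: f_density. Qed.

(* For these [z], the boxes with [Y_1 = z] and non-degenerate intervals for the
   other signals have finite mass, so that [positive_dependence] applies to them. *)
Definition good (z : R) : Prop :=
  (\int[lebesgueN m.+1]_y (f (cons_pair (y, z)))%:E < +oo)%E.

Lemma slice_measure_itvs_lebesgue (a b : R) : a < b ->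
  slice_measure `[a, b]%classic = lebesgue.
Proof.
move=> ab; apply: (slice_measure_lebesgue _ a b) => //=;
  by rewrite in_itv/= ?lexx ?(ltW ab).
Qed.

Lemma law_itvs_finite_nondegenerate (a b : 'I_m.+2 -> R) :
  (forall i, a i < b i) -> (law (itvs a b) setT < +oo)%E.
Proof.
move=> ab; rewrite (slice_law_signals X Y f kappa f_density kappa_law)//.
- apply: (@le_lt_trans _ _ 1%E); last exact: ltry.
  apply: probability_le1; apply: measurableI.
    by rewrite preimage_setT.
  by apply: (measurable_signal_event Y) => i; exact: measurable_itvs.
- exact: measurable_itvs.
- by move=> i; exact: slice_measure_itvs_lebesgue.
Qed.

Lemma law_itvs_finite_good (a b : 'I_m.+2 -> R) (z : R) : good z ->
  a ord0 = z -> b ord0 = z -> (forall i, i != ord0 -> a i < b i) ->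
  (law (itvs a b) setT < +oo)%E.
Proof.
move=> gz a0 b0 ab; rewrite -(slice_massE _ kappa mf f0); last exact: measurable_itvs.
rewrite /slice_mass; apply: le_lt_trans gz.
have mEf : measurable_fun setT (EFin \o f) by exact/measurable_EFinP.
have -> : (\int[lebesgueN m.+1]_y (f (cons_pair (y, z)))%:E =
    \int[prod_measure (fun i => slice_measure (itvs a b i))]_y (f y)%:E)%E.
  rewrite (integral_prod_measure_dirac _ _ z (EFin \o f))//.
  - congr (integral (prod_measure _) _ _).
    apply/funext => i; rewrite slice_measure_itvs_lebesgue// ab//.
  - by rewrite /itvs a0 b0 set_itv1 slice_measure1.
apply: ge0_subset_integral => //.
- apply: measurable_box; exact: measurable_itvs.
- by move=> y _; rewrite lee_fin.
Qed.

Lemma slice_measure_others (e z : R) : e \in I -> z \in I -> e < z ->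
  slice_measure [set x | x \in I /\ x <= z] = lebesgue.
Proof.
move=> eI zI ez; apply: (slice_measure_lebesgue _ e z) => //=.
by split=> //; exact: ltW.
Qed.

(** With two signals frozen at [z], goodness of [z] says nothing. Finiteness is inherited from the
    larger condition [YZ_cond], which has the same reference measures since [e < z] makes the
    remaining sides nondegenerate. *)
Lemma law_itvs_finite_yz (z e : R) (k : 'I_m.+1) : z \in I -> e \in I -> e < z ->
  (law (itvs (cf k z z e) (cf k z z z)) setT < +oo)%E.
Proof.
move=> zI eI ez; apply: le_lt_trans (yz_finite z k zI).
have mJ' i : measurable (YZ_cond I z z k i : set (measurableTypeR R)).
  rewrite /YZ_cond; case: ifP => _; first exact: measurable_set1.
  by case: ifP => _; [exact: measurable_set1|exact: measurable_others].
rewrite itvs_cf; apply: (le_slice_law _ kappa mf f0) => //.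
- by apply: cfP; exact: measurable_itv.
- move=> i; rewrite /cf /YZ_cond !set_itv1; case: ifP => // _; case: ifP => // _.
  by rewrite slice_measure_itvs_lebesgue// (slice_measure_others e).
- move=> i; rewrite /cf /YZ_cond !set_itv1; case: ifP => [_ //|_].
  case: ifP => [_ //|_] x /=; rewrite in_itv/= => /andP[ex xz]; split => //.
  by apply: (@interval_is_interval _ I e z); rewrite /= ?eI ?zI ?ex.
Qed.

(** All sides have Lebesgue reference measure, so both laws are probabilities and the
    exchangeability of the competitors applies to the transposition of [k] and [l]. *)
Lemma law_swap (J0 Jk Jo : set R) (k l : 'I_m.+1) :
  measurable (J0 : set (measurableTypeR R)) ->
  measurable (Jk : set (measurableTypeR R)) ->
  measurable (Jo : set (measurableTypeR R)) ->
  slice_measure J0 = lebesgue -> slice_measure Jk = lebesgue ->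
  slice_measure Jo = lebesgue -> forall A, measurable A ->
  law (cf k J0 Jk Jo) A = law (cf l J0 Jk Jo) A.
Proof.
move=> mJ0 mJk mJo E0 Ek Eo A mA.
rewrite !(slice_law_signals X Y f kappa f_density kappa_law)//;
  try (by apply: cfP); try (by move=> i; rewrite /cf; case: ifP => // _; case: ifP).
pose B j : set R := if j == l then Jk else Jo.
have evE j : X ord0 @^-1` A `&` [set w | forall i : 'I_m.+2, cf j J0 Jk Jo i (Y i w)] =
   [set w | A (X ord0 w) /\ J0 (Y ord0 w) /\
      forall i, (if i == j then Jk else Jo) (Y (lift ord0 i) w)].
  apply/seteqP; split => w [Aw /= wE]; split=> //.
    split; first exact: (wE ord0).
    by move=> i; have := wE (lift ord0 i); rewrite /cf /= (inj_eq lift_inj).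
  case: wE => w0 wj i; case: (unliftP ord0 i) => [i'|] ->; last exact: w0.
  by rewrite /cf /= (inj_eq lift_inj); exact: wj.
rewrite !evE.
rewrite -(symmetric_law_box X Y XY_symmetric (tperm k l) A J0 B)//.
- congr (P _); apply/seteqP; split => w /= [Aw [w0 wj]]; split=> //; split=> // i;
    have := wj i; rewrite /B -(inj_eq (@perm_inj _ (tperm k l)) i k) tpermL//.
- by move=> j; rewrite /B; case: ifP.
Qed.

Lemma ratio_swap h (J0 Jk Jo : set R) (k l : 'I_m.+1) :
  measurable (J0 : set (measurableTypeR R)) ->
  measurable (Jk : set (measurableTypeR R)) ->
  measurable (Jo : set (measurableTypeR R)) ->
  slice_measure J0 = lebesgue -> slice_measure Jk = lebesgue ->
  slice_measure Jo = lebesgue ->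
  ratio (law (cf k J0 Jk Jo)) h = ratio (law (cf l J0 Jk Jo)) h.
Proof.
move=> mJ0 mJk mJo E0 Ek Eo.
rewrite /ratio (law_swap _ _ _ k l mJ0)//; congr (_ / _); congr fine.
by apply: eq_measure_integral => A mA _; exact: law_swap.
Qed.

Lemma yz_law_gt0 (z e : R) (k : 'I_m.+1) : z \in I -> e \in I -> e < z ->
  (0 < law (YZ_cond I z z k) setT)%E.
Proof.
move=> zI eI ez; apply: slice_law_gt0 => //.
- by apply: (cfP k _ _ _ (fun J => measurable (J : set (measurableTypeR R)))) => //;
    exact: measurable_others.
- move=> i; rewrite /YZ_cond; case: ifP => _; first exact: slice_measure1_gt0.
  case: ifP => _; first exact: slice_measure1_gt0.
  apply: (slice_measure_itv_gt0 _ e z) => //; first exact: measurable_others.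
  move=> x /=; rewrite in_itv/= => /andP[ex xz]; split => //.
  by apply: (@interval_is_interval _ I e z); rewrite /= ?eI ?zI ?ex.
- move=> y yJ; apply: f_positive => i; have := yJ i.
  by rewrite /YZ_cond; case: ifP => [_ /= ->|_]//; case: ifP => [_ /= ->|_ []].
Qed.

Lemma box_law_finite (J0 Jk Jo : set R) (k : 'I_m.+1) :
  measurable (J0 : set (measurableTypeR R)) ->
  measurable (Jk : set (measurableTypeR R)) ->
  measurable (Jo : set (measurableTypeR R)) ->
  slice_measure J0 = lebesgue -> slice_measure Jk = lebesgue ->
  slice_measure Jo = lebesgue -> (law (cf k J0 Jk Jo) setT < +oo)%E.
Proof.
move=> mJ0 mJk mJo E0 Ek Eo.
have mJ i : measurable (cf k J0 Jk Jo i : set (measurableTypeR R)).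
  by rewrite /cf; case: ifP => // _; case: ifP.
rewrite (slice_law_signals X Y f kappa f_density kappa_law)//.
  apply: (@le_lt_trans _ _ 1%E); last exact: ltry.
  apply: probability_le1; apply: measurableI; first by rewrite preimage_setT.
  exact: (measurable_signal_event Y).
by move=> i; rewrite /cf; case: ifP => // _; case: ifP.
Qed.

Section monotone_observable.
Variables (h : R -> R) (M : R).
Hypotheses (h_nd : {homo h : x y / x <= y}) (mh : measurable_fun setT h)
  (hM : forall x, 0 <= h x <= M).

Let step i a b a' b' := @dependence_step R m I f kappa mf f0 f_positive
  XY_dependence h M i a b a' b' h_nd mh hM.

(* [positive_dependence] moves one endpoint at a time. *)
Lemma ratio_up (z p q r e : R) (k : 'I_m.+1) : good z ->
  z \in I -> p \in I -> q \in I -> r \in I -> e \in I ->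
  e < z -> z <= p -> p < q -> z < r ->
  ratio (law (itvs (cf k z z e) (cf k z z z))) h <=
  ratio (law (itvs (cf k p z e) (cf k q r z))) h.
Proof.
move=> gz zI pI qI rI eI ez zp pq zr; have zq := le_lt_trans zp pq.
have k0 : lift ord0 k != ord0 by [].
have nd0 (a0 ak ao b0 bk bo : R) : a0 < b0 -> ak < bk -> ao < bo ->
    forall i, cf k a0 ak ao i < cf k b0 bk bo i.
  by move=> ? ? ? i; rewrite /cf; case: ifP => // _; case: ifP.
have le0 (a0 ak ao b0 bk bo : R) : a0 <= b0 -> ak <= bk -> ao <= bo ->
    forall i, cf k a0 ak ao i <= cf k b0 bk bo i.
  by move=> ? ? ? i; rewrite /cf; case: ifP => // _; case: ifP.
have inI (a0 ak ao : R) : a0 \in I -> ak \in I -> ao \in I -> all_in I (cf k a0 ak ao).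
  by move=> ? ? ?; exact: (cfP k a0 ak ao (fun x => is_true (x \in I))).
have good_fin : (law (itvs (cf k z z e) (cf k z r z)) setT < +oo)%E.
  apply: (law_itvs_finite_good _ _ z) => //.
  by move=> i; rewrite /cf => /negbTE ->; case: ifP.
(* The order of the moves keeps all masses finite: the competitor is widened while [Y_1] is frozen
   at the good value [z]; then [Y_1] is widened, after which every side is nondegenerate; its left
   endpoint moves last. *)
apply: (@le_trans _ _ (ratio (law (itvs (cf k z z e) (cf k z r z))) h)).
  apply: (step (lift ord0 k)); try exact: inI.
  - by apply: le0 => //; exact: ltW.
  - by apply: le0 => //; exact: ltW.
  - exact: law_itvs_finite_yz.
  - exact: good_fin.
  - by move=> j; rewrite /cf => /negbTE ->.
  - by right; rewrite /cf eqxx /= (ltW zr).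
apply: (@le_trans _ _ (ratio (law (itvs (cf k z z e) (cf k q r z))) h)).
  apply: (step ord0); try exact: inI.
  - by apply: le0 => //; exact: ltW.
  - by apply: le0 => //; exact: ltW.
  - exact: good_fin.
  - by apply: law_itvs_finite_nondegenerate; exact: nd0.
  - by move=> j; rewrite /cf => /negbTE ->.
  - by right; rewrite /cf eqxx (ltW zq).
apply: (step ord0); try exact: inI.
- by apply: le0 => //; exact: ltW.
- by apply: le0 => //; exact: ltW.
- by apply: law_itvs_finite_nondegenerate; exact: nd0.
- by apply: law_itvs_finite_nondegenerate; exact: nd0.
- by move=> j; rewrite /cf => /negbTE ->.
- by left; rewrite /cf eqxx zp.
Qed.

(** The second half of the way from [z] to [z']: a nondegenerate box of the kind at which [ratio_up]
    arrives is raised until it shrinks to the point condition at [z']. *)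
Lemma ratio_down (z z' e : R) (l : 'I_m.+1) : good z' ->
  z \in I -> z' \in I -> e \in I -> e < z -> z < z' ->
  ratio (law (itvs (cf l z z e) (cf l z' z' z))) h <=
  ratio (law (itvs (cf l z' z' e) (cf l z' z' z'))) h.
Proof.
move=> gz' zI z'I eI ez zz'; have ez' := lt_trans ez zz'.
have nd0 (a0 ak ao b0 bk bo : R) : a0 < b0 -> ak < bk -> ao < bo ->
    forall i, cf l a0 ak ao i < cf l b0 bk bo i.
  by move=> ? ? ? i; rewrite /cf; case: ifP => // _; case: ifP.
have le0 (a0 ak ao b0 bk bo : R) : a0 <= b0 -> ak <= bk -> ao <= bo ->
    forall i, cf l a0 ak ao i <= cf l b0 bk bo i.
  by move=> ? ? ? i; rewrite /cf; case: ifP => // _; case: ifP.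
have inI (a0 ak ao : R) : a0 \in I -> ak \in I -> ao \in I -> all_in I (cf l a0 ak ao).
  by move=> ? ? ?; exact: (cfP l a0 ak ao (fun x => is_true (x \in I))).
have l0 : lift ord0 l != ord0 by [].
(* Right endpoints are raised to [z'] in the order of the buyers, those of index below [n] being
   done; for buyer 1 and [l] nothing changes. *)
pose b (n : nat) (i : 'I_m.+2) := if (i < n)%N then z' else cf l z' z' z i.
have b_fin n i : cf l z z e i < b n i.
  by rewrite /b; case: ifP => _; [|exact: nd0]; rewrite /cf; case: ifP => // _; case: ifP.
have bI n : all_in I (b n).
  by move=> i; rewrite /b; case: ifP => // _; exact: inI.
have raise n : ratio (law (itvs (cf l z z e) (cf l z' z' z))) h <=
    ratio (law (itvs (cf l z z e) (b n))) h.
  elim: n => [|n IH].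
    by rewrite (_ : b 0%N = cf l z' z' z)//; apply/funext.
  apply: le_trans IH _; have [nm|nm] := ltnP n m.+2; last first.
    rewrite (_ : b n.+1 = b n)//; apply/funext => i; rewrite /b.
    by rewrite !(leq_trans (ltn_ord i))// (leq_trans nm).
  apply: (step (Ordinal nm)) => //.
  - exact: inI.
  - by move=> i; exact/ltW/b_fin.
  - exact: inI.
  - by move=> i; exact/ltW/b_fin.
  - by apply: law_itvs_finite_nondegenerate; exact: b_fin.
  - by apply: law_itvs_finite_nondegenerate; exact: b_fin.
  - move=> j jn; split=> //; rewrite /b ltnS leq_eqVlt.
    by rewrite (_ : (j == n :> nat) = false)//; apply/negbTE.
  - right; split=> //; rewrite /b ltnn ltnSn /cf.
    by case: ifP => // _; case: ifP => // _; exact: ltW.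
apply: le_trans (raise m.+2) _.
have bE : b m.+2 = cf l z' z' z'.
  by apply/funext => i; rewrite /b ltn_ord /cf; case: ifP => // _; case: ifP.
have fin0 := law_itvs_finite_nondegenerate _ _ (b_fin m.+2).
rewrite {raise b_fin bI}bE {b} in fin0 *.
(* [Y_1] must shrink before the competitor [l]: goodness of [z'] controls the mass with only [Y_1]
   frozen. *)
have fin1 : (law (itvs (cf l z' z e) (cf l z' z' z')) setT < +oo)%E.
  apply: (law_itvs_finite_good _ _ z') => //.
  by move=> i; rewrite /cf => /negbTE ->; case: ifP.
apply: (@le_trans _ _ (ratio (law (itvs (cf l z' z e) (cf l z' z' z'))) h)).
  apply: (step ord0); try exact: inI.
  - by apply: le0 => //; exact: ltW.
  - by apply: le0 => //; exact: ltW.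
  - exact: fin0.
  - exact: fin1.
  - by move=> j; rewrite /cf => /negbTE ->.
  - by left; rewrite /cf eqxx (ltW zz').
apply: (step (lift ord0 l)); try exact: inI.
- by apply: le0 => //; exact: ltW.
- by apply: le0 => //; exact: ltW.
- exact: fin1.
- exact: law_itvs_finite_yz.
- by move=> j; rewrite /cf => /negbTE ->.
- by left; rewrite /cf eqxx /= (ltW zz').
Qed.

(** Lets the common left endpoint of the remaining competitors run down to the end of [I], which
    turns a closed box into a condition of the form [YZ_cond] or into a cell. *)
Lemma ratio_limit (J0 Jk : set R) (k : 'I_m.+1) (z : R) (e : nat -> R) :
  measurable (J0 : set (measurableTypeR R)) -> measurable (Jk : set (measurableTypeR R)) ->
  z \in I -> (forall n, e n \in I) -> (forall n, e n < z) ->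
  (forall a b, (a <= b)%N -> e b <= e a) ->
  (forall x, x \in I -> exists n, e n <= x) ->
  (law (cf k J0 Jk [set x | x \in I /\ (x <= z)%R]) setT < +oo)%E ->
  (0 < law (cf k J0 Jk [set x | x \in I /\ (x <= z)%R]) setT)%E ->
  ratio (law (cf k J0 Jk `[e n, z]%classic)) h @[n --> \oo] -->
  ratio (law (cf k J0 Jk [set x | x \in I /\ x <= z])) h.
Proof.
move=> mJ0 mJk zI eI ez e_nd e_cof oo pos.
set J := cf k J0 Jk _ in oo pos *; set Jn := fun n => cf k J0 Jk `[e n, z]%classic.
have mJn n i : measurable (Jn n i : set (measurableTypeR R)).
  rewrite /Jn /cf; case: ifP => // _; case: ifP => // _; exact: measurable_itv.
have smE n i : slice_measure (Jn n i) = slice_measure (J i).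
  rewrite /Jn /J /cf; case: ifP => // _; case: ifP => // _.
  by rewrite slice_measure_itvs_lebesgue// (slice_measure_others (e n)).
have ndJ i a b : (a <= b)%N -> Jn a i `<=` Jn b i.
  move=> ab; rewrite /Jn /cf; case: ifP => [_ //|_].
  case: ifP => [_ //|_] x /=.
  by rewrite !in_itv/= => /andP[ex ->]; rewrite (le_trans (e_nd _ _ ab)).
have JE i : J i = \bigcup_n Jn n i.
  rewrite /Jn /J /cf; case: ifP => _; first by rewrite bigcup_const//; exists 0%N.
  case: ifP => _; first by rewrite bigcup_const//; exists 0%N.
  apply/seteqP; split => [x [xI xz]|x [n _] /=].
    by have [n en] := e_cof x xI; exists n => //=; rewrite in_itv/= en.
  rewrite in_itv/= => /andP[ex xz]; split => //.
  by apply: (@interval_is_interval _ I (e n) z); rewrite /= ?eI ?zI ?ex.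
have lim (g : R -> R) : measurable_fun setT g -> (forall x, 0 <= g x) ->
    (\int[law (Jn n)]_x (g x)%:E)%E @[n --> \oo] --> (\int[law J]_x (g x)%:E)%E.
  move=> mg g0; apply: (cvg_integral_slice_law _ kappa mf f0) => //.
  - by apply/measurable_EFinP.
have h0 x : 0 <= h x by have /andP[] := hM x.
have intJ : (law J).-integrable setT (EFin \o h) by exact: (bounded_integrable _ _ M).
rewrite /ratio; apply: cvgM.
  apply: fine_cvg; rewrite fineK; first exact: lim.
  by have := integrable_fin_num _ intJ; exact.
apply: cvgV.
  by rewrite gt_eqF// fine_gt0// pos.
apply: fine_cvg; rewrite fineK; last by rewrite ge0_fin_numE.
have := lim (fun=> 1) (measurable_cst _) (fun=> ler01).
have E1 (nu : {measure set (measurableTypeR R) -> \bar R}) :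
    (\int[nu]_x (1%R)%:E = nu setT)%E.
  by rewrite integral_cst// mul1e.
by under eq_fun do rewrite E1; rewrite E1.
Qed.

Lemma yz_ratio_le_box (z p q r : R) (k : 'I_m.+1) : good z ->
  z \in I -> p \in I -> q \in I -> r \in I -> (exists2 e, e \in I & e < z) ->
  z <= p -> p < q -> z < r ->
  ratio (law (YZ_cond I z z k)) h <=
  ratio (law (cf k `[p, q]%classic `[z, r]%classic [set x | x \in I /\ x <= z])) h.
Proof.
move=> gz zI pI qI rI [e0 e0I e0z] zp pq zr.
have [e [eI e_nd e_le e_cof]] := cofinal_below I e0 e0I.
have ez n : e n < z by exact: le_lt_trans (e_le n) e0z.
have lim1 : ratio (law (cf k [set z] [set z] `[e n, z]%classic)) h @[n --> \oo] -->
    ratio (law (YZ_cond I z z k)) h.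
  apply: ratio_limit => //.
    exact: yz_finite.
  exact: (yz_law_gt0 _ e0).
have E0 := slice_measure_itvs_lebesgue p q pq.
have Ek := slice_measure_itvs_lebesgue z r zr.
have Eo := slice_measure_others e0 z e0I zI e0z.
have mpq : measurable (`[p, q]%classic : set (measurableTypeR R)) by exact: measurable_itv.
have mzr : measurable (`[z, r]%classic : set (measurableTypeR R)) by exact: measurable_itv.
have lim2 : ratio (law (cf k `[p, q]%classic `[z, r]%classic `[e n, z]%classic)) h
    @[n --> \oo] -->
    ratio (law (cf k `[p, q]%classic `[z, r]%classic [set x | x \in I /\ x <= z])) h.
  apply: ratio_limit => //.
    by apply: box_law_finite => //; exact: measurable_others.
  apply: slice_law_gt0 => //.
  - apply: (cfP k _ _ _ (fun J => measurable (J : set (measurableTypeR R)))) => //.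
    exact: measurable_others.
  - move=> i; rewrite /cf; case: ifP => _; first exact/slice_measure_itv_self_gt0/ltW.
    case: ifP => _; first exact/slice_measure_itv_self_gt0/ltW.
    apply: (slice_measure_itv_gt0 _ e0 z) => //; first exact: measurable_others.
    move=> x /=; rewrite in_itv/= => /andP[ex xz]; split => //.
    by apply: (@interval_is_interval _ I e0 z); rewrite /= ?e0I ?zI ?ex.
  - move=> y yJ; apply: f_positive => i; have := yJ i; rewrite /cf.
    case: ifP => [_|_].
      rewrite /= in_itv/= => yi.
      by apply: (@interval_is_interval _ I p q); rewrite /= ?pI ?qI.
    case: ifP => [_|_ []//].
    rewrite /= in_itv/= => yi.
    by apply: (@interval_is_interval _ I z r); rewrite /= ?zI ?rI.
apply: ler_cvg_to lim1 lim2 _; apply: nearW => n.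
have := ratio_up z p q r (e n) k gz zI pI qI rI (eI n) (ez n) zp pq zr.
by rewrite !itvs_cf !set_itv1.
Qed.

(** The competitor attaining the maximum may change from [k] to [l]. The exchange takes place in the
    middle of the chain, at the box with [Y_1] and one competitor in [[z, z']] and the others in
    [[e, z]]. *)
Lemma yz_ratio_mono (z z' : R) (k l : 'I_m.+1) : good z -> good z' ->
  z \in I -> z' \in I -> (exists2 e, e \in I & e < z) -> z < z' ->
  ratio (law (YZ_cond I z z k)) h <= ratio (law (YZ_cond I z' z' l)) h.
Proof.
move=> gz gz' zI z'I [e0 e0I e0z] zz'.
have [e [eI e_nd e_le e_cof]] := cofinal_below I e0 e0I.
have ez n : e n < z by exact: le_lt_trans (e_le n) e0z.
have ez' n : e n < z' by exact: lt_trans (ez n) zz'.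
have lim x j : x \in I -> (forall n, e n < x) ->
    ratio (law (cf j [set x] [set x] `[e n, x]%classic)) h @[n --> \oo] -->
    ratio (law (YZ_cond I x x j)) h.
  move=> xI ex.
  apply: ratio_limit => //.
    exact: yz_finite.
  exact: (yz_law_gt0 _ (e 0%N)).
apply: ler_cvg_to (lim _ _ zI ez) (lim _ _ z'I ez') _; apply: nearW => n.
have := ratio_up z z z' z' (e n) k gz zI zI z'I z'I (eI n) (ez n) (lexx z) zz' zz'.
have := ratio_down z z' (e n) l gz' zI z'I (eI n) (ez n) zz'.
rewrite !itvs_cf !set_itv1 (ratio_swap _ _ _ _ l k); try exact: measurable_itv;
  try exact: slice_measure_itvs_lebesgue.
by move=> h1 h2; exact: le_trans h2 h1.
Qed.

End monotone_observable.
End chains.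

(** * Bids *)

Section payoffs.
Context {R : realType}.
Implicit Types alpha b x : R.

Lemma posc_payoffE alpha b x : 0 <= alpha ->
  posc_payoff alpha b x = Num.min (x - b) ((1 - alpha) * (x - b)).
Proof.
move=> a0; rewrite /posc_payoff.
have [xb|xb] := leP 0 (x - b).
  have : 0 <= alpha * (x - b) by rewrite mulr_ge0.
  by rewrite minEle; case: ifP => //; lra.
have : alpha * (x - b) <= 0 by rewrite mulr_ge0_le0// ltW.
by rewrite mulr0 subr0 minEle; case: ifP => //; lra.
Qed.

Lemma posc_payoff_incr alpha b : 0 <= alpha < 1 -> {homo posc_payoff alpha b : x y / x < y}.
Proof.
move=> /andP[a0 a1] x y xy; rewrite !posc_payoffE//.
rewrite lt_min !gt_min; apply/andP; split.
  by rewrite ltrD2r xy.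
by rewrite ltr_pM2l ?subr_gt0// ltrD2r xy orbT.
Qed.

Lemma posc_payoff_decr alpha b b' x : 0 <= alpha < 1 -> b < b' ->
  posc_payoff alpha b' x < posc_payoff alpha b x.
Proof.
move=> /andP[a0 a1] bb'; rewrite !posc_payoffE//.
rewrite lt_min !gt_min; apply/andP; split.
  by rewrite ltrD2l ltrN2 bb'.
by rewrite ltr_pM2l ?subr_gt0// ltrD2l ltrN2 bb' orbT.
Qed.

Lemma posc_payoff_concave alpha l b b' x : 0 <= alpha -> 0 <= l <= 1 ->
  l * posc_payoff alpha b x + (1 - l) * posc_payoff alpha b' x <=
  posc_payoff alpha (l * b + (1 - l) * b') x.
Proof.
move=> a0 /andP[l0 l1]; rewrite /posc_payoff.
set p := Num.max 0 (x - b); set q := Num.max 0 (x - b').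
have pge : 0 <= p /\ x - b <= p by rewrite /p !le_max !lexx orbT.
have qge : 0 <= q /\ x - b' <= q by rewrite /q !le_max !lexx orbT.
have l1' : 0 <= 1 - l by rewrite subr_ge0.
have : Num.max 0 (x - (l * b + (1 - l) * b')) <= l * p + (1 - l) * q.
  rewrite ge_max addr_ge0 ?mulr_ge0 ?pge.1 ?qge.1//=.
  have h1 := ler_wpM2l l0 pge.2; have h2 := ler_wpM2l l1' qge.2.
  by move: h1 h2; rewrite !mulrBr; lra.
move=> /(ler_wpM2l a0); lra.
Qed.

Lemma plsc_payoff_incr alpha b : alpha < 1 -> {homo plsc_payoff alpha b : x y / x < y}.
Proof. by move=> a1 x y xy; rewrite /plsc_payoff ltr_pM2l ?subr_gt0// ltrD2r. Qed.

Lemma plsc_payoff_decr alpha b b' x : alpha < 1 -> b < b' ->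
  plsc_payoff alpha b' x < plsc_payoff alpha b x.
Proof. by move=> a1 bb'; rewrite /plsc_payoff ltr_pM2l ?subr_gt0// ltrD2l ltrN2. Qed.

Lemma measurable_posc_payoff alpha b : measurable_fun setT (posc_payoff alpha b).
Proof.
have m1 : measurable_fun setT (fun x : R => x - b).
  by apply: measurable_funB => //; exact: measurable_cst.
apply: measurable_funB => //; apply: measurable_funM; first exact: measurable_cst.
by apply: measurable_maxr => //; exact: measurable_cst.
Qed.

Lemma measurable_plsc_payoff alpha b : measurable_fun setT (plsc_payoff alpha b).
Proof.
apply: measurable_funM; first exact: measurable_cst.
by apply: measurable_funB => //; exact: measurable_cst.
Qed.

End payoffs.

Lemma Rintegral_lt {d : measure_display} {T : measurableType d} {R : realType}
    (nu : {measure set T -> \bar R}) (g h : T -> R) :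
  nu.-integrable setT (EFin \o g) -> nu.-integrable setT (EFin \o h) ->
  (0 < nu setT)%E -> (forall x, g x < h x) -> \int[nu]_x g x < \int[nu]_x h x.
Proof.
move=> ig ih nu0 gh; rewrite -subr_gt0 -RintegralB//.
have mgh : measurable_fun setT (fun x => h x - g x).
  by apply: measurable_funB; apply/measurable_EFinP; [case/integrableP: ih|case/integrableP: ig].
rewrite /Rintegral fine_gt0//; apply/andP; split.
  by apply: integral_gt0 => // x _; rewrite subr_gt0.
have ihg : nu.-integrable setT (EFin \o (fun x => h x - g x)).
  by have := integrableB measurableT ih ig; apply: eq_integrable.
exact: (integrable_lty measurableT ihg).
Qed.

Lemma Rintegral_dominated_cvg {d : measure_display} {T : measurableType d}
    {R : realType} (nu : {measure set T -> \bar R}) (g_ : nat -> T -> R) (g G : T -> R) :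
  (forall n, measurable_fun setT (g_ n)) -> measurable_fun setT g ->
  {ae nu, forall x, g_ n x @[n --> \oo] --> g x} ->
  nu.-integrable setT (EFin \o G) -> (forall n x, `|g_ n x| <= G x) ->
  nu.-integrable setT (EFin \o g) /\
  \int[nu]_x g_ n x @[n --> \oo] --> \int[nu]_x g x.
Proof.
move=> mg_ mg cvg_g iG gG.
have [|||||ig _ lim] := @dominated_convergence _ _ _ nu setT measurableT
  (fun n => EFin \o g_ n) (EFin \o g) (EFin \o G).
- by move=> n; exact/measurable_EFinP.
- exact/measurable_EFinP.
- by apply: filterS cvg_g => x gx _; apply: cvg_EFin => //; exact: nearW.
- exact: iG.
- by apply: aeW => x n _; rewrite lee_fin.
split => //; apply: fine_cvg; rewrite fineK//.
exact: integrable_fin_num.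
Qed.

Section bid_root.
Context {R : realType} (nu : {measure set (measurableTypeR R) -> \bar R}).
Hypotheses (nu_gt0 : (0 < nu setT)%E) (nu_fin : (nu setT < +oo)%E).
Variables (H : R -> R -> R) (c : R).
Hypothesis H_int : forall b, nu.-integrable setT (EFin \o H b).
Hypothesis H_decr : forall b b' x, b < b' -> H b' x < H b x.

Lemma integral_bid_decr : {homo (fun b => \int[nu]_x H b x) : b b' /~ b < b'}.
Proof. by move=> b b' bb'; apply: Rintegral_lt => // x; exact: H_decr. Qed.

Hypothesis H_conc : forall l b b' x, 0 <= l <= 1 ->
  l * H b x + (1 - l) * H b' x <= H (l * b + (1 - l) * b') x.
Hypothesis c_gt0 : 0 < c.
Hypothesis H_large : forall x, \forall n \near \oo, c <= H (- n%:R) x.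

Let mH b : measurable_fun setT (H b : measurableTypeR R -> R).
Proof. by apply/measurable_EFinP; case/integrableP: (H_int b). Qed.

(** The integral is concave and strictly decreasing in [b], so a root exists as soon as some bid
    gives a nonnegative integral; very low bids do. *)
Lemma bid_root_exists : exists b, \int[nu]_x H b x = 0.
Proof.
have [b0 b0ge0] : exists b, 0 <= \int[nu]_x H b x.
  (* Truncation at [c] makes these functions dominated by [|H 0 x| + c] and eventually constant at
     each point; their integrals tend to [c] times the mass, which is positive. *)
  pose g n x := Num.min (H (- n%:R) x) c.
  have mg n : measurable_fun setT (g n : measurableTypeR R -> R).
    by apply: measurable_minr => //; exact: measurable_cst.
  have icst : nu.-integrable setT (EFin \o cst c).
    by apply: (bounded_integrable _ _ c) => // x; rewrite lexx ltW.
  have iabs : nu.-integrable setT (EFin \o (fun x => `|H 0 x| + c)).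
    have := integrableD measurableT (integrable_norm (H_int 0)) icst.
    by apply: eq_integrable.
  have Hn0 n x : H 0 x <= H (- n%:R) x.
    case: n => [|n]; first by rewrite oppr0.
    by apply/ltW/H_decr; rewrite oppr_lt0 ltr0n.
  have gbound n x : `|g n x| <= `|H 0 x| + c.
    rewrite ler_norml /g; apply/andP; split.
      rewrite le_min; apply/andP; split.
        apply: le_trans (Hn0 n x); rewrite lerNl.
        apply: (@le_trans _ _ `|H 0 x|); first by rewrite -normrN ler_norm.
        by rewrite lerDl ltW.
      apply: (@le_trans _ _ 0); last exact: ltW.
      by rewrite oppr_le0 addr_ge0// ltW.
    by rewrite ge_min; apply/orP; right; rewrite lerDr.
  have [_ glim] : nu.-integrable setT (EFin \o cst c) /\
      \int[nu]_x g n x @[n --> \oo] --> \int[nu]_x (cst c x).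
    apply: (Rintegral_dominated_cvg nu g (cst c) (fun x => `|H 0 x| + c)) => //.
    apply: aeW => x; apply: cvg_near_cst; near=> n.
    apply/eqP; rewrite /g minEge; case: ifP => // /negbT.
    by rewrite -ltNge ltNge => /negP[]; near: n; exact: H_large.
  have pos : 0 < \int[nu]_x (cst c x).
    rewrite Rintegral_cst// mulr_gt0// fine_gt0//; apply/andP; split => //.
  have [n gn0] : exists n, 0 < \int[nu]_x g n x.
    have : \forall n \near \oo, 0 < \int[nu]_x g n x.
      exact: (cvgr_gt _ glim).
    by case=> n _ hn; exists n; apply: hn => /=.
  exists (- n%:R); apply: le_trans (ltW gn0) _.
  apply: le_Rintegral => //.
    apply: (le_integrable measurableT _ _ iabs); first exact/measurable_EFinP.
    move=> x _ /=; rewrite lee_fin; apply: le_trans (gbound n x) _.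
    by rewrite ler_norm.
  by move=> x _; rewrite /g ge_min lexx.
apply: (concave_decreasing_root _ b0) => //.
  exact: integral_bid_decr.
move=> l b b' l01.
rewrite -!RintegralZl// -RintegralD//.
- apply: le_Rintegral => // [|x _]; last exact: H_conc.
  by have := integrableD measurableT (integrableZl measurableT l (H_int b))
    (integrableZl measurableT (1 - l) (H_int b')); apply: eq_integrable.
- by have := integrableZl measurableT l (H_int b); apply: eq_integrable.
- by have := integrableZl measurableT (1 - l) (H_int b'); apply: eq_integrable.
Unshelve. all: by end_near. Qed.

End bid_root.

(** * Losses, and the comparison of the two bids *)

Section losses.
Context {R : realType}.
Implicit Types b x : R.

Definition loss b x : R := Num.max 0 (b - x).

Lemma measurable_loss b : measurable_fun setT (loss b).
Proof.
apply: measurable_maxr; first exact: measurable_cst.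
by apply: measurable_funB => //; exact: measurable_cst.
Qed.

Lemma loss_ge0 b x : 0 <= loss b x.
Proof. by rewrite le_max lexx. Qed.

End losses.

Section single_crossing.
Context {R : realType} (nu : {measure set (measurableTypeR R) -> \bar R}).
Hypotheses (nu_gt0 : (0 < nu setT)%E) (nu_fin : (nu setT < +oo)%E).
Variables (u : R -> R) (alpha : R).
Hypotheses (u_incr : {homo u : x y / x < y})
  (u_conc : convex_function [set: R^o] (fun x => - u x)) (u0 : u 0 = 0)
  (mu : measurable_fun setT u) (alpha01 : 0 < alpha < 1).
Hypothesis posc_int : forall b, nu.-integrable setT (EFin \o (u \o posc_payoff alpha b)).
Hypothesis plsc_int : forall b, nu.-integrable setT (EFin \o (u \o plsc_payoff alpha b)).

(** Below [b] the payoff is [x - b], and the supergradient of [u] at 0 gives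
    [u (x - b) <= k * (x - b)]. Hence the loss is at most the absolute utility divided by [k]. *)
Lemma loss_integrable b : nu.-integrable setT (EFin \o loss b).
Proof.
have [k k0 kP] := concave_supergradient u u_incr u_conc 0.
have mn : measurable_fun setT (loss b : measurableTypeR R -> R) := measurable_loss b.
apply: (le_integrable measurableT _ _
    (integrableZl measurableT k^-1 (integrable_norm (posc_int b)))).
  exact/measurable_EFinP.
move=> x _ /=; rewrite lee_fin ger0_norm ?loss_ge0// normrM normr_id gtr0_norm ?invr_gt0//.
rewrite ler_pdivlMl// /loss; have [xb|xb] := leP 0 (b - x); last by rewrite mulr0.
have xb0 : x - b <= 0 by lra.
rewrite /posc_payoff (max_idPl xb0) mulr0 subr0.
have := kP 0 (x - b); rewrite lexx xb0 orbT u0 !subr0 => /(_ isT) h.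
apply: (@le_trans _ _ (- u (x - b))); first by move: h; rewrite mulrBr mulrBr; lra.
by rewrite -normrN ler_norm.
Qed.

(* The two payoffs differ by [alpha * loss s x - e], which decreases in [x] and
   changes sign at one point [p]; there the supergradient of [u] turns the
   comparison of expected utilities into one of expected payments. *)
Lemma mean_loss_le (s t : R) :
  \int[nu]_x u (posc_payoff alpha s x) = 0 ->
  \int[nu]_x u (plsc_payoff alpha t x) = 0 ->
  alpha * ratio nu (loss s) <= (1 - alpha) * (t - s).
Proof.
move=> us ut; have /andP[a0 a1] := alpha01; have a1' : 0 < 1 - alpha by rewrite subr_gt0.
have m0 : 0 < fine (nu setT) by rewrite fine_gt0// nu_gt0.
set e := alpha * ratio nu (loss s); rewrite leNgt; apply/negP => lt_e.
have e0 : 0 <= e.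
  rewrite mulr_ge0 ?(ltW a0)// /ratio divr_ge0 ?(ltW m0)//.
  by apply: Rintegral_ge0 => x _; exact: loss_ge0.
(* The price at which the PLSC payoff has the same mean as the POSC payoff at [s]. The inequality to
   be refuted says that [t] lies below it. *)
pose b := s + e / (1 - alpha).
have tb : t < b by rewrite /b -ltrBlDl ltr_pdivlMr// mulrC.
(* The two payoffs cross at [x = s - e / alpha], where both are equal to [- (e / alpha)]. *)
have [k k0 kP] := concave_supergradient u u_incr u_conc (- (e / alpha)).
have ea0 : 0 <= e / alpha by rewrite divr_ge0// ltW.
have pE x : plsc_payoff alpha b x = (1 - alpha) * (x - s) - e.
  by rewrite /plsc_payoff /b; field; rewrite gt_eqF.
have qE x : posc_payoff alpha s x = (1 - alpha) * (x - s) - alpha * loss s x.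
  rewrite /posc_payoff /loss; have [h|h] := leP 0 (x - s).
    by rewrite (max_idPl (_ : s - x <= 0)); lra.
  by rewrite (max_idPr (_ : 0 <= s - x)); lra.
have eE : alpha * (e / alpha) = e by rewrite mulrC divfK// gt_eqF.
have pointwise x : u (posc_payoff alpha s x) - u (plsc_payoff alpha b x) <=
    k * (e - alpha * loss s x).
  have -> : e - alpha * loss s x = posc_payoff alpha s x - plsc_payoff alpha b x.
    by rewrite pE qE; lra.
  apply: kP; rewrite pE qE.
  have [h|h] := leP (loss s x) (e / alpha); apply/orP; [left|right].
    have sx : s - x <= e / alpha by apply: le_trans h; rewrite le_max lexx orbT.
    have h1 := ler_wpM2l (ltW a1') sx; have h2 := ler_wpM2l (ltW a0) h.
    by apply/andP; split; lra.
  have sx : loss s x = s - x.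
    by move: h; rewrite /loss; have [|] := leP 0 (s - x) => //; lra.
  rewrite sx in h *.
  have h1 := ler_wpM2l (ltW a1') (ltW h); have h2 := ler_wpM2l (ltW a0) (ltW h).
  by apply/andP; split; lra.
have icst : nu.-integrable setT (EFin \o cst e).
  by apply: (bounded_integrable _ _ e) => // x; rewrite e0 lexx.
have iloss : nu.-integrable setT (EFin \o (fun x => alpha * loss s x)).
  by have := integrableZl measurableT alpha (loss_integrable s); apply: eq_integrable.
have idiff : nu.-integrable setT (EFin \o (fun x => e - alpha * loss s x)).
  by have := integrableB measurableT icst iloss; apply: eq_integrable.
have : \int[nu]_x (u (posc_payoff alpha s x) - u (plsc_payoff alpha b x)) <=
    \int[nu]_x (k * (e - alpha * loss s x)).
  apply: le_Rintegral => //.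
  - by have := integrableB measurableT (posc_int s) (plsc_int b); apply: eq_integrable.
  - by have := integrableZl measurableT k idiff; apply: eq_integrable.
rewrite RintegralB//; [|exact: posc_int|exact: plsc_int].
rewrite us sub0r RintegralZl// RintegralB// RintegralZl//; last exact: loss_integrable.
rewrite Rintegral_cst//.
(* Equality of the means removes the right-hand side. So the mean utility at [b] is nonnegative,
   although it should be strictly below the mean utility zero at [t]. *)
have -> : e * fine (nu setT) - alpha * \int[nu]_x loss s x = 0.
  by rewrite /e /ratio mulrA divfK ?gt_eqF// subrr.
rewrite mulr0 oppr_le0 leNgt => /negP; apply; rewrite -ut.
apply: Rintegral_lt => //; [exact: plsc_int|exact: plsc_int|].
by move=> x; apply: u_incr; exact: plsc_payoff_decr.
Qed.

End single_crossing.

(** * The law of the value given [Y_1 = Z_1 = z] *)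

Section sums_of_measures.
Context {d : measure_display} {T : measurableType d} {R : realType}.
Context (n : nat) (nu : nat -> {measure set T -> \bar R}).
Implicit Types g : T -> R.

Lemma integrable_msum g : measurable_fun setT g ->
  (forall k : 'I_n, (nu k).-integrable setT (EFin \o g)) ->
  (msum nu n).-integrable setT (EFin \o g).
Proof.
move=> mg ig; apply/integrableP; split; first exact/measurable_EFinP.
have mng : measurable_fun setT (fun x => `|(EFin \o g) x|%E).
  by apply: measurableT_comp => //; exact/measurable_EFinP.
by rewrite ge0_integral_measure_sum// lte_sum_pinfty// => k _; case/integrableP: (ig k).
Qed.

Lemma Rintegral_msum g : measurable_fun setT g ->
  (forall k : 'I_n, (nu k).-integrable setT (EFin \o g)) ->
  \int[msum nu n]_x g x = \sum_(k < n) \int[nu k]_x g x.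
Proof.
move=> mg ig; have mEg : measurable_fun setT (EFin \o g) by exact/measurable_EFinP.
rewrite /Rintegral sum_fine; last by move=> k _; exact: integrable_fin_num.
congr fine; rewrite integralE.
rewrite !ge0_integral_measure_sum//; [|exact: measurable_funeneg|exact: measurable_funepos].
rewrite -fin_num_sumeN; last first.
  by move=> k _; exact/integrable_neg_fin_num/ig.
by rewrite -big_split/=; apply: eq_bigr => k _; rewrite [RHS]integralE.
Qed.

Lemma fine_msum : (forall k : 'I_n, (nu k setT < +oo)%E) ->
  fine (msum nu n setT) = \sum_(k < n) fine (nu k setT).
Proof. by move=> oo; rewrite /msum sum_fine// => k _; rewrite ge0_fin_numE. Qed.

End sums_of_measures.

Section ratios_of_sums.
Context {R : realType} (n : nat)
  (nu : nat -> {measure set (measurableTypeR R) -> \bar R}).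
Variable h : R -> R.
Hypotheses (mh : measurable_fun setT h)
  (nu_fin : forall k : 'I_n.+1, (nu k setT < +oo)%E)
  (nu_gt0 : forall k : 'I_n.+1, (0 < nu k setT)%E)
  (h_int : forall k : 'I_n.+1, (nu k).-integrable setT (EFin \o h)).

Let mass_gt0 (k : 'I_n.+1) : 0 < fine (nu k setT).
Proof. by rewrite fine_gt0// nu_gt0 nu_fin. Qed.

Let total_gt0 : 0 < \sum_(k < n.+1) fine (nu k setT).
Proof.
by rewrite big_ord_recl ltr_pwDl// ?mass_gt0// sumr_ge0// => k _; exact/ltW/mass_gt0.
Qed.

(** The ratio of a sum of measures is the average of the ratios, weighted by the masses; the same
    fact gives the lower bound in [le_ratio_msum]. *)
Lemma ratio_msum_le c : (forall k : 'I_n.+1, ratio (nu k) h <= c) ->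
  ratio (msum nu n.+1) h <= c.
Proof.
move=> hc; have mh' : measurable_fun (setT : set (measurableTypeR R)) h by exact: mh.
rewrite /ratio Rintegral_msum// fine_msum// ler_pdivrMr// mulr_sumr ler_sum// => k _.
by have := hc k; rewrite /ratio ler_pdivrMr.
Qed.

Lemma le_ratio_msum c : (forall k : 'I_n.+1, c <= ratio (nu k) h) ->
  c <= ratio (msum nu n.+1) h.
Proof.
move=> hc; have mh' : measurable_fun (setT : set (measurableTypeR R)) h by exact: mh.
rewrite /ratio Rintegral_msum// fine_msum// ler_pdivlMr// mulr_sumr ler_sum// => k _.
by have := hc k; rewrite /ratio ler_pdivlMr.
Qed.

End ratios_of_sums.

Section conditional_laws.
Context {R : realType} {m : nat}.
Context {d : measure_display} {T : measurableType d} {P : probability T R}.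
Variable Y : 'I_m.+2 -> {RV P >-> R}.
Variables (I : interval R) (f : R ^^ m.+2 -> R)
  (kappa : R.-pker (R ^^ m.+2) ~> measurableTypeR R).
Hypothesis f_density : joint_density Y f.
Hypothesis f_positive : forall y : R ^^ m.+2, all_in I (tnth y) -> 0 < f y.
Notation law J := (slice_law f kappa J).

Let mf : measurable_fun setT f.
Proof. by case: f_density. Qed.
Let f0 y : 0 <= f y.
Proof. by case: f_density. Qed.

(** Unnormalized law of [X_1] given [Y_1 = Z_1 = z], one summand for each competitor that may attain
    the maximum. [inord] appears because [msum] takes a family indexed by natural numbers. *)
Definition yz_law (z : R) : {measure set (measurableTypeR R) -> \bar R} :=
  msum (fun k => law (YZ_cond I z z (inord k))) m.+1.

Lemma measurable_YZ_cond z (k : 'I_m.+1) (i : 'I_m.+2) :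
  measurable (YZ_cond I z z k i : set (measurableTypeR R)).
Proof.
rewrite /YZ_cond; case: ifP => _; first exact: measurable_set1.
by case: ifP => _; [exact: measurable_set1|exact: measurable_others].
Qed.

Lemma slice_mass_lty z g : YZ_cexp_exists I f kappa z z g ->
  forall k, (law (YZ_cond I z z k) setT < +oo)%E.
Proof.
move=> [oo _] k; rewrite -(slice_massE _ kappa mf f0); last exact: measurable_YZ_cond.
apply: le_lt_trans oo; rewrite (bigD1 k)//= leeDl// sume_ge0// => i _.
by rewrite (slice_massE _ kappa mf f0)//; exact: measurable_YZ_cond.
Qed.

Lemma YZ_cexp_integrable z g : measurable_fun setT g -> YZ_cexp_exists I f kappa z z g ->
  (forall k, (law (YZ_cond I z z k)).-integrable setT (EFin \o g)) /\
  YZ_cexp I f kappa z z g = ratio (yz_law z) g.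
Proof.
move=> mg ex; have mg' : measurable_fun (setT : set (measurableTypeR R)) g by exact: mg.
have moo := slice_mass_lty z g ex.
have soo k : (slice_integral f kappa (YZ_cond I z z k) (fun x => `|g x|%R) < +oo)%E.
  have [_ oo] := ex; apply: le_lt_trans oo; rewrite (bigD1 k)//= leeDl// sume_ge0// => i _.
  apply: integral_ge0 => y _; apply: mule_ge0; last by rewrite lee_fin.
  by apply: integral_ge0 => x _; rewrite lee_fin.
have key k := slice_integralE _ kappa mf f0 _ g (measurable_YZ_cond z k) mg' (soo k).
split=> [k|]; first by have [] := key k.
rewrite /YZ_cexp /cexp /ratio; congr (_ / _).
  rewrite Rintegral_msum// => [|k]; last by have [] := key (inord k).
  rewrite -sum_fine.
    by apply: eq_bigr => k _; have [_ ->] := key k; rewrite inord_val.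
  by move=> k _; have [ik ->] := key k; exact: integrable_fin_num.
rewrite /yz_law /msum; congr fine; apply: eq_bigr => k _.
by rewrite inord_val (slice_massE _ kappa mf f0)//; exact: measurable_YZ_cond.
Qed.

Lemma yz_total_fin z : (forall k, (law (YZ_cond I z z k) setT < +oo)%E) ->
  (yz_law z setT < +oo)%E.
Proof. by move=> oo; rewrite /yz_law /= /msum lte_sum_pinfty. Qed.

Lemma yz_total_gt0 z e : z \in I -> e \in I -> e < z -> (0 < yz_law z setT)%E.
Proof.
move=> zI eI ez; rewrite /yz_law /= /msum big_ord_recl.
rewrite (@lt_le_trans _ _ (law (YZ_cond I z z (inord (@ord0 m))) setT))//; last first.
  by rewrite leeDl// sume_ge0.
exact: (yz_law_gt0 Y I f kappa f_density f_positive z e).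
Qed.

End conditional_laws.

(** Truncation of [g] to [[-n, n]] followed by a shift by [n] gives bounded nonnegative observables;
    the shift adds [n] to both ratios, and dominated convergence removes the truncation. *)
Lemma ratio_le_integrable {R : realType}
    (nu nu' : {measure set (measurableTypeR R) -> \bar R}) (g : R -> R) :
  (nu setT < +oo)%E -> (nu' setT < +oo)%E -> (0 < nu setT)%E -> (0 < nu' setT)%E ->
  (forall (h : R -> R) M, {homo h : x y / x <= y} -> measurable_fun setT h ->
    (forall x, 0 <= h x <= M) -> ratio nu h <= ratio nu' h) ->
  {homo g : x y / x <= y} -> measurable_fun setT g ->
  nu.-integrable setT (EFin \o g) -> nu'.-integrable setT (EFin \o g) ->
  ratio nu g <= ratio nu' g.
Proof.
move=> oo oo' pos pos' le_bounded g_nd mg ig ig'.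
pose t (n : nat) x := Num.max (- n%:R) (Num.min (g x) n%:R).
have n0 n : - n%:R <= n%:R :> R by rewrite (@le_trans _ _ 0)// ?oppr_le0 ?ler0n.
have mt n : measurable_fun setT (t n).
  apply: measurable_maxr; first exact: measurable_cst.
  by apply: measurable_minr => //; exact: measurable_cst.
have tb n x : - n%:R <= t n x <= n%:R.
  by rewrite /t le_max lexx/= ge_max n0 ge_min lexx orbT.
have tg n x : `|t n x| <= `|g x|.
  have n0' : 0 <= n%:R :> R by rewrite ler0n.
  rewrite /t; case: (leP (g x) n%:R) => [gn|gn].
    case: (leP (- n%:R) (g x)) => [//|gn']; rewrite normrN ger0_norm//.
    by rewrite -normrN (le_trans _ (ler_norm _))// lerNr ltW.
  by rewrite (max_idPr (n0 n)) ger0_norm// (le_trans _ (ler_norm _))// ltW.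
have t_nd n : {homo t n : x y / x <= y}.
  move=> x y xy; rewrite /t ge_max le_max lexx/= le_max; apply/orP; right.
  by rewrite le_min !ge_min g_nd// lexx orbT.
have lim (rho : {measure set (measurableTypeR R) -> \bar R}) :
    rho.-integrable setT (EFin \o g) ->
    ratio rho (t n) @[n --> \oo] --> ratio rho g.
  move=> irho; have mt' n : measurable_fun (setT : set (measurableTypeR R)) (t n) by exact: mt.
  have mg' : measurable_fun (setT : set (measurableTypeR R)) g by exact: mg.
  rewrite /ratio; apply: cvgMl.
  have [||_ //] := Rintegral_dominated_cvg rho t g (fun x => `|g x|) mt' mg' _ _ tg.
    apply: aeW => x; apply: cvg_near_cst; near=> n.
    have gn : `|g x| <= n%:R by near: n; exact: nbhs_infty_ger.
    apply/eqP; rewrite /t; move: gn; rewrite ler_norml => /andP[g1 g2].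
    by rewrite (min_idPl g2) (max_idPr g1).
  by apply: integrable_norm.
have shift (rho : {measure set (measurableTypeR R) -> \bar R}) n :
    (rho setT < +oo)%E -> (0 < rho setT)%E ->
    ratio rho (fun x => t n x + n%:R) = ratio rho (t n) + n%:R.
  move=> rhooo rho0; have rhof : 0 < fine (rho setT) by rewrite fine_gt0 ?rho0.
  have mt' : measurable_fun (setT : set (measurableTypeR R)) (t n) by exact: mt.
  have icst : rho.-integrable setT (EFin \o cst n%:R).
    by apply: (bounded_integrable _ _ n%:R) => // x; rewrite ler0n lexx.
  have it : rho.-integrable setT (EFin \o t n).
    apply: (le_integrable measurableT _ _ icst); first exact/measurable_EFinP.
    by move=> x _ /=; rewrite lee_fin [leRHS]ger0_norm// ler_norml tb.
  rewrite /ratio RintegralD// Rintegral_cst// mulrDl.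
  by rewrite mulfK ?gt_eqF.
apply: ler_cvg_to (lim _ ig) (lim _ ig') _; apply: nearW => n.
rewrite -(lerD2r n%:R) -!shift//.
apply: (le_bounded _ (n%:R + n%:R)).
- by move=> x y xy; rewrite lerD2r t_nd.
- by apply: measurable_funD => //; exact: measurable_cst.
- by move=> x; have /andP[h1 h2] := tb n x; rewrite lerD2r h2 andbT -lerBlDr sub0r.
Unshelve. all: by end_near. Qed.

Section order_of_conditional_laws.
Context {R : realType} {m : nat}.
Context {d : measure_display} {T : measurableType d} {P : probability T R}.
Variables X Y : 'I_m.+2 -> {RV P >-> R}.
Variables (I : interval R) (f : R ^^ m.+2 -> R)
  (kappa : R.-pker (R ^^ m.+2) ~> measurableTypeR R).
Hypotheses (XY_symmetric : symmetric_law X Y) (f_density : joint_density Y f).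
Hypothesis f_positive : forall y : R ^^ m.+2, all_in I (tnth y) -> 0 < f y.
Hypotheses (kappa_law : conditional_law X Y kappa)
  (XY_dependence : positive_dependence I f kappa).
Notation law J := (slice_law f kappa J).
Notation nu := (yz_law I f kappa).

(** Leaves out a least element of [I], at which the condition on the remaining competitors would
    degenerate to a point and change its reference measure. *)
Definition inner (z : R) : Prop := z \in I /\ exists2 e, e \in I & e < z.

Hypothesis yz_finite : forall z k, z \in I -> (law (YZ_cond I z z k) setT < +oo)%E.

Lemma inner_total z : inner z -> (0 < nu z setT)%E /\ (nu z setT < +oo)%E.
Proof.
move=> [zI [e eI ez]]; split; first exact: (yz_total_gt0 Y I f kappa f_density f_positive z e).
by apply: yz_total_fin => k; exact: yz_finite.
Qed.

Lemma yz_ratio_le_bounded (h : R -> R) M z z' :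
  {homo h : x y / x <= y} -> measurable_fun setT h -> (forall x, 0 <= h x <= M) ->
  inner z -> inner z' -> good f z -> good f z' -> z < z' ->
  ratio (nu z) h <= ratio (nu z') h.
Proof.
move=> h_nd mh hM [zI ez] [z'I ez'] gz gz' zz'.
have mh' : measurable_fun (setT : set (measurableTypeR R)) h by exact: mh.
have [e eI lt_ez] := ez; have [e' e'I lt_ez'] := ez'.
apply: ratio_msum_le => // [k|k|k|k]; [exact: yz_finite|..].
- exact: (yz_law_gt0 Y I f kappa f_density f_positive z e).
- by apply: (bounded_integrable _ _ M) => //; exact: yz_finite.
apply: le_ratio_msum => // [l|l|l|l]; [exact: yz_finite|..].
- exact: (yz_law_gt0 Y I f kappa f_density f_positive z' e').
- by apply: (bounded_integrable _ _ M) => //; exact: yz_finite.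
exact: (yz_ratio_mono X Y I f kappa XY_symmetric f_density f_positive kappa_law
  XY_dependence yz_finite h M).
Qed.

Section bid.
Variables (u : R -> R) (pay : R -> R -> R).
Hypotheses (u_incr : {homo u : x y / x < y})
  (u_conc : convex_function [set: R^o] (fun x => - u x)) (u0 : u 0 = 0)
  (mu : measurable_fun setT u).
Hypotheses (mpay : forall b, measurable_fun setT (pay b))
  (pay_incr : forall b, {homo pay b : x y / x < y})
  (pay_decr : forall b b' x, b < b' -> pay b' x < pay b x)
  (pay_conc : forall l b b' x, 0 <= l <= 1 ->
    l * pay b x + (1 - l) * pay b' x <= pay (l * b + (1 - l) * b') x)
  (pay_large : forall x, \forall n \near \oo, 1 <= pay (- n%:R) x).
Hypothesis pay_exists : forall z b, z \in I ->
  YZ_cexp_exists I f kappa z z (u \o pay b).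

Let bid z := xget 0 [set b | YZ_cexp I f kappa z z (u \o pay b) = 0].

Let mupay b : measurable_fun setT (u \o pay b).
Proof. exact: measurableT_comp. Qed.

Let u_le : {homo u : x y / x <= y}.
Proof. by move=> x y; rewrite le_eqVlt => /predU1P[->//|/u_incr/ltW]. Qed.

Lemma bid_payoff_integrable z b : z \in I -> (nu z).-integrable setT (EFin \o (u \o pay b)).
Proof.
move=> zI; have [ik _] := YZ_cexp_integrable Y I f kappa f_density z _ (mupay b) (pay_exists z b zI).
by apply: integrable_msum => //; exact: mupay.
Qed.

(** Once a root exists, [xget] returns one and its default value is irrelevant. The level that low
    bids reach is [u 1], which is positive since [u 0 = 0]. *)
Lemma bid_mean_eq0 z : inner z -> \int[nu z]_x u (pay (bid z) x) = 0.
Proof.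
move=> iz; have [nu0 nuoo] := inner_total z iz; have zI := iz.1.
have nuf : 0 < fine (nu z setT) by rewrite fine_gt0 ?nu0.
have cexpE b : YZ_cexp I f kappa z z (u \o pay b) = ratio (nu z) (u \o pay b).
  by have [_ ->] := YZ_cexp_integrable Y I f kappa f_density z _ (mupay b) (pay_exists z b zI).
have [b bE] : exists b, YZ_cexp I f kappa z z (u \o pay b) = 0.
  have [b|b b' x bb'|l b b' x l01||x|b bE] :=
      bid_root_exists (nu z) nu0 nuoo (fun b x => u (pay b x)) (u 1).
  - exact: bid_payoff_integrable.
  - exact/u_incr/pay_decr.
  - apply: le_trans (concave_le_conv u u_conc l _ _ l01) _.
    exact/u_le/pay_conc.
  - by rewrite -u0; exact/u_incr.
  - by have := pay_large x; apply: filterS => n; exact: u_le.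
  by exists b; rewrite cexpE /ratio /= bE mul0r.
have := xgetPex 0 (ex_intro [set b | YZ_cexp I f kappa z z (u \o pay b) = 0] b bE).
rewrite /= -/(bid z) cexpE /ratio => /eqP.
by rewrite mulf_eq0 invr_eq0 (gt_eqF nuf) orbF => /eqP.
Qed.

(** Were [bid z] the larger bid, its mean utility at [z'] would be negative. But that utility
    increases with the value, so by positive dependence its mean at [z'] is at least its mean at
    [z], which is zero. *)
Lemma bid_le z z' : inner z -> inner z' -> good f z -> good f z' -> z <= z' ->
  bid z <= bid z'.
Proof.
move=> iz iz' gz gz'; rewrite le_eqVlt => /predU1P[->//|zz'].
have E := bid_mean_eq0 z iz; have E' := bid_mean_eq0 z' iz'.
have [nu0 nuoo] := inner_total z iz; have [nu0' nuoo'] := inner_total z' iz'.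
move: (bid z) (bid z') E E' => b b' E E'.
have nuf : 0 < fine (nu z' setT) by rewrite fine_gt0 ?nu0'.
rewrite leNgt; apply/negP => bb'.
have : \int[nu z']_x u (pay b x) < \int[nu z']_x u (pay b' x).
  apply: Rintegral_lt => //; [exact: bid_payoff_integrable iz'.1|
    exact: bid_payoff_integrable iz'.1|].
  by move=> x; exact/u_incr/pay_decr.
rewrite E' ltNge => /negP; apply.
have : ratio (nu z) (u \o pay b) <= ratio (nu z') (u \o pay b).
  apply: ratio_le_integrable => //; last 2 first.
  - exact: bid_payoff_integrable iz.1.
  - exact: bid_payoff_integrable iz'.1.
  - by move=> h M *; exact: (yz_ratio_le_bounded h M).
  move=> x y; rewrite le_eqVlt => /predU1P[->//|xy]; exact/ltW/u_incr/pay_incr.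
by rewrite {1}/ratio /= E mul0r /ratio ler_pdivlMr// mul0r.
Qed.

End bid.
End order_of_conditional_laws.

(** Integrability of [g] under [rho] is not known in advance, so the left side is an extended real.
    The bounded comparison applies to [n - min (g, n)], which is nondecreasing with values in
    [[0, n]]; monotone convergence in [n] concludes. *)
Lemma integral_le_ratio {R : realType}
    (nu rho : {measure set (measurableTypeR R) -> \bar R}) (g : R -> R) :
  (nu setT < +oo)%E -> (rho setT < +oo)%E -> (0 < nu setT)%E -> (0 < rho setT)%E ->
  (forall (h : R -> R) M, {homo h : x y / x <= y} -> measurable_fun setT h ->
    (forall x, 0 <= h x <= M) -> ratio nu h <= ratio rho h) ->
  {homo g : x y /~ x <= y} -> measurable_fun setT g -> (forall x, 0 <= g x) ->
  nu.-integrable setT (EFin \o g) ->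
  (\int[rho]_x (g x)%:E <= (ratio nu g)%:E * rho setT)%E.
Proof.
move=> oo oo' pos pos' le_bounded g_ni mg g0 ig.
have mass0 (tau : {measure set (measurableTypeR R) -> \bar R}) :
    (tau setT < +oo)%E -> (0 < tau setT)%E -> 0 < fine (tau setT).
  by move=> tauoo tau0; rewrite fine_gt0 ?tau0.
pose t (n : nat) x := Num.min (g x) n%:R.
have mt n : measurable_fun setT (t n).
  by apply: measurable_minr => //; exact: measurable_cst.
have mt' n : measurable_fun (setT : set (measurableTypeR R)) (t n) by exact: mt.
have tb n x : 0 <= t n x <= n%:R by rewrite /t le_min g0 ler0n ge_min lexx orbT.
have bounded n : (\int[rho]_x (t n x)%:E <= (ratio nu g)%:E * rho setT)%E.
  have it (tau : {measure set (measurableTypeR R) -> \bar R}) : (tau setT < +oo)%E ->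
      tau.-integrable setT (EFin \o t n).
    by move=> tauoo; apply: (bounded_integrable _ _ n%:R).
  have ratioB (tau : {measure set (measurableTypeR R) -> \bar R}) :
      (tau setT < +oo)%E -> (0 < tau setT)%E ->
      ratio tau (fun x => n%:R - t n x) = n%:R - ratio tau (t n).
    move=> tauoo tau0; have tauf := mass0 _ tauoo tau0.
    have icst : tau.-integrable setT (EFin \o cst n%:R).
      by apply: (bounded_integrable _ _ n%:R) => // x; rewrite ler0n lexx.
    rewrite /ratio (RintegralB measurableT icst (it _ tauoo)) Rintegral_cst// mulrBl.
    by rewrite mulfK ?gt_eqF.
  have le1 : ratio rho (t n) <= ratio nu (t n).
    rewrite -lerN2 -(lerD2l n%:R) -!ratioB//.
    apply: (le_bounded _ n%:R).
    - by move=> x y xy; rewrite lerD2l lerN2 /t le_min !ge_min g_ni//= lexx orbT.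
    - by apply: measurable_funB => //; exact: measurable_cst.
    - by move=> x; have /andP[h1 h2] := tb n x; rewrite subr_ge0 h2 gerBl.
  have le2 : ratio nu (t n) <= ratio nu g.
    rewrite /ratio ler_pM2r ?invr_gt0 ?mass0//.
    by apply: le_Rintegral => // [|x _]; [exact: it|rewrite /t ge_min lexx].
  have := le_trans le1 le2; rewrite {1}/ratio ler_pdivrMr ?mass0// => h.
  rewrite -[rho setT]fineK ?ge0_fin_numE// -EFinM.
  rewrite -[leLHS]fineK; first by rewrite lee_fin.
  exact: (integrable_fin_num _ (it _ oo')).
have lim : (\int[rho]_x (t n x)%:E)%E @[n --> \oo] --> (\int[rho]_x (g x)%:E)%E.
  have -> : (\int[rho]_x (g x)%:E = \int[rho]_x limn (fun n => (t n x)%:E))%E.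
    apply: eq_integral => x _; apply/esym/cvg_lim => //.
    apply: cvg_EFin; first exact: nearW.
    apply: cvg_near_cst; near=> n.
    have gn : g x <= n%:R.
      by apply: le_trans (ler_norm _) _; near: n; exact: nbhs_infty_ger.
    by apply/eqP; rewrite /t/= (min_idPl gn).
  apply: cvg_monotone_convergence => //.
  - by move=> n; exact/measurable_EFinP.
  - by move=> n x _; rewrite lee_fin; have /andP[] := tb n x.
  - move=> x _ a b ab; rewrite lee_fin /t le_min !ge_min lexx/=.
    by rewrite ler_nat ab orbT.
by apply: (cvge_to_le lim); exact: nearW.
Unshelve. all: by end_near. Qed.

(** * The difference of the revenues *)

Lemma Z1_eq {R : realType} {m : nat} {d : measure_display} {T : measurableType d}
    {P : probability T R} (Y : 'I_m.+2 -> {RV P >-> R}) (k : 'I_m.+1) w :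
  (forall j, Y (lift ord0 j) w <= Y (lift ord0 k) w) -> Z1 Y w = Y (lift ord0 k) w.
Proof.
move=> max_k; apply/eqP; rewrite eq_le; apply/andP; split.
  by apply: bigmax_le => // j _; exact: max_k.
exact: (le_bigmax _ (fun j => Y (lift ord0 j) w)).
Qed.

Section revenue_difference.
Context {R : realType} {m : nat}.
Context {d : measure_display} {T : measurableType d} {P : probability T R}.
Variables X Y : 'I_m.+2 -> {RV P >-> R}.
Variables (I : interval R) (u : R -> R) (f : R ^^ m.+2 -> R)
  (kappa : R.-pker (R ^^ m.+2) ~> measurableTypeR R) (alpha : R).
Hypotheses (XY_symmetric : symmetric_law X Y) (f_density : joint_density Y f).
Hypothesis f_positive : forall y : R ^^ m.+2, all_in I (tnth y) -> 0 < f y.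
Hypotheses (kappa_law : conditional_law X Y kappa)
  (XY_dependence : positive_dependence I f kappa).
Hypotheses (u_increasing : {homo u : x y / x < y})
  (u_concave : convex_function [set: R^o] (fun x => - u x)) (u_zero : u 0 = 0).
Hypothesis u_finite : forall y : R ^^ m.+2, all_in I (tnth y) ->
  (kappa y).-integrable setT (EFin \o u).
Hypothesis alpha_01 : 0 < alpha < 1.
Hypotheses (posc_finite : forall y z b, y \in I -> z \in I ->
    YZ_cexp_exists I f kappa y z (u \o posc_payoff alpha b))
  (plsc_finite : forall y z b, y \in I -> z \in I ->
    YZ_cexp_exists I f kappa y z (u \o plsc_payoff alpha b)).
Notation nu := (yz_law I f kappa).
Notation law J := (slice_law f kappa J).
Notation s z := (s_bid I u f kappa alpha z z).
Notation t z := (t_bid I u f kappa alpha z z).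

Definition regular (z : R) : Prop := inner I z /\ good f z.

Let a0 : 0 <= alpha. Proof. by case/andP: alpha_01 => /ltW. Qed.
Let a1 : alpha < 1. Proof. by case/andP: alpha_01. Qed.
Let a01 : 0 <= alpha < 1. Proof. by rewrite a0 a1. Qed.

Let yz_finite z k : z \in I -> (law (YZ_cond I z z k) setT < +oo)%E.
Proof. by move=> zI; exact: (slice_mass_lty Y I f kappa f_density z _ (posc_finite z z 0 zI zI)). Qed.

(** Read off from the integrability of [u] at the signal profile constantly equal to [z]. *)
Lemma utility_measurable z : z \in I -> measurable_fun setT u.
Proof.
move=> zI; have [|mu _] := integrableP _ _ _ (u_finite [tuple z | _ < m.+2] _).
  by move=> i; rewrite tnth_mktuple.
have mu' : measurable_fun (setT : set (measurableTypeR R)) u by exact/measurable_EFinP.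
exact: mu'.
Qed.

Let plsc_large x : \forall n \near \oo, 1 <= plsc_payoff alpha (- n%:R) x.
Proof.
near=> n; rewrite /plsc_payoff opprK mulrC -ler_pdivrMr ?subr_gt0//.
rewrite -lerBlDl; apply: le_trans (ler_norm _) _.
by near: n; exact: nbhs_infty_ger.
Unshelve. all: by end_near. Qed.

Let posc_large x : \forall n \near \oo, 1 <= posc_payoff alpha (- n%:R) x.
Proof.
have := plsc_large x; apply: filter_app; near=> n => pn.
rewrite posc_payoffE// le_min pn andbT opprK -lerBlDl.
by apply: le_trans (ler_norm _) _; near: n; exact: nbhs_infty_ger.
Unshelve. all: by end_near. Qed.

Lemma s_bid_mean z : regular z -> \int[nu z]_x u (posc_payoff alpha (s z) x) = 0.
Proof.
move=> [iz gz]; have mu := utility_measurable z iz.1.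
apply: (bid_mean_eq0 Y I f kappa f_density f_positive yz_finite u (posc_payoff alpha)) => //.
- exact: measurable_posc_payoff.
- by move=> b b' x; exact: posc_payoff_decr.
- by move=> l b b' x; exact: posc_payoff_concave.
- by move=> z' b z'I; exact: posc_finite.
Qed.

Lemma t_bid_mean z : regular z -> \int[nu z]_x u (plsc_payoff alpha (t z) x) = 0.
Proof.
move=> [iz gz]; have mu := utility_measurable z iz.1.
apply: (bid_mean_eq0 Y I f kappa f_density f_positive yz_finite u (plsc_payoff alpha)) => //.
- exact: measurable_plsc_payoff.
- by move=> b b' x; exact: plsc_payoff_decr.
- by move=> l b b' x _; rewrite /plsc_payoff; lra.
- by move=> z' b z'I; exact: plsc_finite.
Qed.

Lemma s_bid_le z z' : regular z -> regular z' -> z <= z' -> s z <= s z'.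
Proof.
move=> [iz gz] [iz' gz'] zz'; have mu := utility_measurable z iz.1.
apply: (bid_le X Y I f kappa XY_symmetric f_density f_positive kappa_law XY_dependence
  yz_finite u (posc_payoff alpha)) => //.
- exact: measurable_posc_payoff.
- by move=> b; exact: posc_payoff_incr.
- by move=> b b' x; exact: posc_payoff_decr.
- by move=> l b b' x; exact: posc_payoff_concave.
- by move=> y b yI; exact: posc_finite.
Qed.

Lemma t_bid_le z z' : regular z -> regular z' -> z <= z' -> t z <= t z'.
Proof.
move=> [iz gz] [iz' gz'] zz'; have mu := utility_measurable z iz.1.
apply: (bid_le X Y I f kappa XY_symmetric f_density f_positive kappa_law XY_dependence
  yz_finite u (plsc_payoff alpha)) => //.
- exact: measurable_plsc_payoff.
- by move=> b; exact: plsc_payoff_incr.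
- by move=> b b' x; exact: plsc_payoff_decr.
- by move=> l b b' x _; rewrite /plsc_payoff; lra.
- by move=> y b yI; exact: plsc_finite.
Qed.

Lemma regular_mean_loss z : regular z ->
  (nu z).-integrable setT (EFin \o loss (s z)) /\
  alpha * ratio (nu z) (loss (s z)) <= (1 - alpha) * (t z - s z).
Proof.
move=> rz; have [[zI ez] gz] := rz; have mu := utility_measurable z zI.
have [nu0 nuoo] := inner_total Y I f kappa f_density f_positive yz_finite z rz.1.
have posc_int b : (nu z).-integrable setT (EFin \o (u \o posc_payoff alpha b)).
  apply: (bid_payoff_integrable Y I f kappa f_density u (posc_payoff alpha)) => //.
    exact: measurable_posc_payoff.
  by move=> y b' yI; exact: posc_finite.
have plsc_int b : (nu z).-integrable setT (EFin \o (u \o plsc_payoff alpha b)).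
  apply: (bid_payoff_integrable Y I f kappa f_density u (plsc_payoff alpha)) => //.
    exact: measurable_plsc_payoff.
  by move=> y b' yI; exact: plsc_finite.
split; first exact: (loss_integrable _ u alpha).
apply: (mean_loss_le (nu z) nu0 nuoo u) => //; [exact: s_bid_mean|exact: t_bid_mean].
Qed.

(** In the sequel [p = r] is the grid value after [z], so that up to ties buyer 1 wins on the cell
    and pays a price determined by the signal of [k]; [q] only bounds his signal from above. *)
Definition cell (z p q r : R) (k : 'I_m.+1) : 'I_m.+2 -> set R :=
  cf k `[p, q]%classic `[z, r]%classic [set x | x \in I /\ x <= z].

Definition cell_event z p q r k : set T := [set w | forall i, cell z p q r k i (Y i w)].

Lemma measurable_cell z p q r k i :
  measurable (cell z p q r k i : set (measurableTypeR R)).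
Proof.
rewrite /cell /cf; case: ifP => _; first exact: measurable_itv.
by case: ifP => _; [exact: measurable_itv|exact: measurable_others].
Qed.

Lemma measurable_cell_event z p q r k : measurable (cell_event z p q r k).
Proof. by apply: (measurable_signal_event Y) => i; exact: measurable_cell. Qed.

(** The loss decreases with the value, so positive dependence bounds its mean on the cell by its
    mean given [Y_1 = Z_1 = z], and the single-crossing comparison bounds the latter. *)
Lemma cell_loss_le z p q r k : regular z -> p \in I -> q \in I -> r \in I ->
  z <= p -> p < q -> z < r ->
  (alpha%:E * \int[P]_(w in cell_event z p q r k) (loss (s z) (X ord0 w))%:E <=
  ((1 - alpha) * (t z - s z))%:E * P (cell_event z p q r k))%E.
Proof.
move=> rz pI qI rI zp pq zr; have [[zI ez] gz] := rz; have [e eI lt_ez] := ez.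
have [nu0 nuoo] := inner_total Y I f kappa f_density f_positive yz_finite z rz.1.
have [il le_t] := regular_mean_loss z rz.
have ml : measurable_fun setT (loss (s z)) := measurable_loss (s z).
have ml' : measurable_fun (setT : set (measurableTypeR R)) (loss (s z)) by exact: ml.
have E0 := slice_measure_itvs_lebesgue p q pq.
have Ek := slice_measure_itvs_lebesgue z r zr.
have Eo := slice_measure_others I e z eI zI lt_ez.
have mpq : measurable (`[p, q]%classic : set (measurableTypeR R)) by exact: measurable_itv.
have mzr : measurable (`[z, r]%classic : set (measurableTypeR R)) by exact: measurable_itv.
have mo := measurable_others I z.
have cellE i : slice_measure (cell z p q r k i) =
    [the {sigma_finite_measure set (measurableTypeR R) -> \bar R} of lebesgue_measure].
  by rewrite /cell /cf; case: ifP => // _; case: ifP.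
set rho := law (cell z p q r k).
have rhooo : (rho setT < +oo)%E.
  exact: (box_law_finite X Y f kappa f_density kappa_law).
have rhoP : rho setT = P (cell_event z p q r k).
  rewrite /rho (slice_law_signals X Y f kappa f_density kappa_law) ?preimage_setT ?setTI//.
  exact: measurable_cell.
have rho0 : (0 < rho setT)%E.
  apply: (slice_law_gt0 f kappa) => //; try by case: f_density.
  - exact: measurable_cell.
  - move=> i; rewrite /cell /cf; case: ifP => _; first exact/slice_measure_itv_self_gt0/ltW.
    case: ifP => _; first exact/slice_measure_itv_self_gt0/ltW.
    apply: (slice_measure_itv_gt0 _ e z) => // x /=.
    rewrite in_itv/= => /andP[ex xz]; split => //.
    by apply: (@interval_is_interval _ I e z); rewrite /= ?eI ?zI ?ex.
  - move=> y yJ; apply: f_positive => i; have := yJ i; rewrite /cell /cf.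
    case: ifP => [_|_].
      rewrite /= in_itv/= => yi.
      by apply: (@interval_is_interval _ I p q); rewrite /= ?pI ?qI.
    case: ifP => [_|_ []//].
    rewrite /= in_itv/= => yi.
    by apply: (@interval_is_interval _ I z r); rewrite /= ?zI ?rI.
have le_bounded (h : R -> R) M : {homo h : x y / x <= y} -> measurable_fun setT h ->
    (forall x, 0 <= h x <= M) -> ratio (nu z) h <= ratio rho h.
  move=> h_nd mh hM; have mh' : measurable_fun (setT : set (measurableTypeR R)) h by exact: mh.
  apply: ratio_msum_le => // [l|l|l|l]; [exact: yz_finite|..].
  - exact: (yz_law_gt0 Y I f kappa f_density f_positive z e).
  - by apply: (bounded_integrable _ _ M) => //; exact: yz_finite.
  (* The summand for the maximal competitor [l] is compared with the cell of [l], which symmetry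
     then carries to the cell of [k]. *)
  apply: (le_trans (yz_ratio_le_box X Y I f kappa f_density f_positive kappa_law
    XY_dependence yz_finite h M h_nd mh hM z p q r _ gz zI pI qI rI ez zp pq zr)).
  by rewrite (ratio_swap X Y f kappa XY_symmetric f_density kappa_law h _ _ _ _ k).
have loss_ni : {homo loss (s z) : x y /~ x <= y}.
  by move=> x y xy; rewrite /loss ge_max !le_max lexx/= lerD2l lerN2 xy orbT.
have := integral_le_ratio _ _ _ nuoo rhooo nu0 rho0 le_bounded loss_ni ml (loss_ge0 _) il.
rewrite /rho (integral_slice_law_signals X Y f kappa f_density kappa_law)//; last first.
- by move=> x; rewrite lee_fin loss_ge0.
- exact/measurable_EFinP.
- exact: measurable_cell.
rewrite -/rho rhoP -/(cell_event z p q r k) => H.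
apply: (@le_trans _ _ (alpha%:E * ((ratio (nu z) (loss (s z)))%:E * P (cell_event z p q r k)))%E).
  by rewrite lee_wpmul2l.
by rewrite muleA -EFinM lee_wpmul2r.
Qed.

End revenue_difference.

Lemma signals_absolutely_continuous {R : realType} {m : nat} {d : measure_display}
    {T : measurableType d} {P : probability T R} (Y : 'I_m.+2 -> {RV P >-> R})
    (f : R ^^ m.+2 -> R) : joint_density Y f -> forall e : R, 0 < e ->
  exists2 r : R, 0 < r & forall (i : 'I_m.+2) (A : set (measurableTypeR R)), measurable A ->
    (lebesgue_measure A < r%:E)%E -> (P (Y i @^-1` A) < e%:E)%E.
Proof.
move=> f_density e e0.
have exr i : exists r : R, 0 < r /\ forall A : set (measurableTypeR R), measurable A ->
    (lebesgue_measure A < r%:E)%E -> (P (Y i @^-1` A) < e%:E)%E.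
  by have [r r0 rA] := signal_absolutely_continuous Y f f_density i e e0; exists r.
have [r rP] := choice exr.
exists (\big[Num.min/1]_i r i).
  by apply/bigmin_gtP; split => // i _; case: (rP i).
move=> i A mA Ar; case: (rP i) => _; apply => //; apply: lt_le_trans Ar _.
by rewrite lee_fin; exact: bigmin_le.
Qed.

(** * Grids of regular values *)

Section grid.
Context {R : realType} (I : interval R) (regular : R -> Prop).
Variable (M : set (measurableTypeR R)).
Hypotheses (mM : measurable M) (M0 : lebesgue_measure M = 0%E)
  (regularM : forall z, z \in I -> ~ M z -> regular z).

Lemma regular_between x y : x \in I -> y \in I -> x < y ->
  exists2 z, regular z & x < z < y.
Proof.
move=> xI yI xy; apply: contrapT => none.
have sub : (`]x, y[%classic : set (measurableTypeR R)) `<=` M.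
  move=> z; rewrite /= in_itv/= => xzy; apply: contrapT => Mz; apply: none.
  have zI : z \in I.
    have /andP[/ltW xz /ltW zy] := xzy.
    by apply: (@interval_is_interval _ I x y); rewrite /= ?xI ?yI ?xz.
  by exists z => //; exact: regularM.
have mxy : measurable (`]x, y[%classic : set (measurableTypeR R)) by exact: measurable_itv.
have : (lebesgue_measure (`]x, y[%classic : set (measurableTypeR R)) <= lebesgue_measure M)%E.
  by apply: le_measure => //; rewrite inE.
rewrite M0 lebesgue_measure_itv/= lte_fin xy -EFinB lee_fin.
by rewrite leNgt subr_gt0 xy.
Qed.

Hypothesis regularI : forall z, regular z -> z \in I.

(** Each new point is a regular value between [a + e / 2] and [a + e]: the upper bound controls the
    mesh, and the lower one makes the induction on the number of half steps end. *)
Lemma regular_grid (a b e : R) : regular a -> regular b -> a < b -> 0 < e ->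
  exists K (z : nat -> R), [/\ forall i, (i <= K)%N -> regular (z i), z 0%N = a, z K = b &
    forall i, (i < K)%N -> z i < z i.+1 <= z i + e].
Proof.
move=> ra rb ab e0; have [n bn] : exists n : nat, b <= a + e / 2 * n%:R.
  have e2 : 0 < e / 2 by rewrite divr_gt0.
  exists (Num.bound ((b - a) / (e / 2))).
  rewrite -lerBlDl -ler_pdivrMl// mulrC; apply/ltW/archi_boundP.
  by apply: divr_ge0; [rewrite subr_ge0|]; exact: ltW.
elim: n a ra ab bn => [|n IH] a ra ab bn.
  by exfalso; move: bn; rewrite mulr0 addr0 leNgt ab.
have [be|be] := leP b (a + e).
  exists 1%N, (fun i => if i is 0%N then a else b); split => //.
    by case=> [|[]].
  by case=> // _; rewrite ab.
have [x rx /andP[ax xe]] : exists2 x, regular x & a + e / 2 < x < a + e.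
  have inI y : a <= y <= b -> y \in I.
    by apply: (@interval_is_interval _ I a b); exact: regularI.
  by apply: regular_between; [apply: inI|apply: inI|]; lra.
have [||K [z [rz z0 zK zS]]] := IH x rx.
- exact: lt_trans be.
- by move: bn; rewrite -[n.+1%:R]natr1 [in leRHS]mulrDr mulr1; lra.
exists K.+1, (fun i => if i is i'.+1 then z i' else a); split => //.
  by case.
case=> [_|i iK]; last exact: zS.
by rewrite z0; lra.
Qed.

End grid.

Lemma measurable_buyer1_wins {R : realType} {m : nat} {d : measure_display}
    {T : measurableType d} {P : probability T R} (Y : 'I_m.+2 -> {RV P >-> R}) :
  measurable (buyer1_wins Y).
Proof.
have -> : buyer1_wins Y = \bigcap_(j in [set: 'I_m.+1]) [set w | Y (lift ord0 j) w < Y ord0 w].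
  apply/seteqP; split => [w /bigmax_ltP[_ wj] j _|w wj]; first exact: wj.
  by apply/bigmax_ltP; split=> [|j _]; exact: wj.
apply: fin_bigcap_measurable; first exact: finite_finset.
move=> j _; have mY i : measurable_fun setT (Y i : T -> R) by exact: measurable_funPT.
rewrite -[X in measurable X]setTI.
have := @measurable_fun_ltr _ _ _ setT (Y (lift ord0 j)) (Y ord0) (mY _) (mY _).
by move=> /(_ measurableT [set true] I).
Qed.

(** * The expected gain on the winning event *)

Section gain.
Context {R : realType} {m : nat}.
Context {d : measure_display} {T : measurableType d} {P : probability T R}.
Variables X Y : 'I_m.+2 -> {RV P >-> R}.
Variables (I : interval R) (alpha : R) (s t : R -> R) (regular : R -> Prop).
Hypothesis alpha_01 : 0 < alpha < 1.
Hypotheses (s_le : forall z z', regular z -> regular z' -> z <= z' -> s z <= s z')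
  (t_le : forall z z', regular z -> regular z' -> z <= z' -> t z <= t z').
Hypothesis regular_inner : forall z, regular z -> inner I z.
Hypothesis loss_le : forall z p q r k, regular z -> p \in I -> q \in I -> r \in I ->
  z <= p -> p < q -> z < r ->
  (alpha%:E * \int[P]_(w in cell_event Y I z p q r k) (loss (s z) (X ord0 w))%:E <=
  ((1 - alpha) * (t z - s z))%:E * P (cell_event Y I z p q r k))%E.
Variable psi : T -> R.
Hypothesis psiE : forall w, psi w =
  (1 - alpha) * (t (Z1 Y w) - s (Z1 Y w)) - alpha * loss (s (Z1 Y w)) (X ord0 w).
Hypothesis psi_int : P.-integrable (buyer1_wins Y) (EFin \o psi).

Let regularI z : regular z -> z \in I. Proof. by case/regular_inner. Qed.
Let a0 : 0 < alpha. Proof. by case/andP: alpha_01. Qed.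
Let a1 : 0 < 1 - alpha. Proof. by case/andP: alpha_01; rewrite subr_gt0. Qed.

Lemma cell_Z1 z p q r k w : cell_event Y I z p q r k w ->
  [/\ Z1 Y w = Y (lift ord0 k) w, z <= Y (lift ord0 k) w <= r,
     p <= Y ord0 w & forall j, j != k -> Y (lift ord0 j) w <= z].
Proof.
move=> C; have Ck := C (lift ord0 k); have C0 := C ord0.
rewrite /cell /cf eqxx /= in_itv/= in Ck; rewrite /cell /cf eqxx /= in_itv/= in C0.
have Co j : j != k -> Y (lift ord0 j) w <= z.
  move=> jk; have := C (lift ord0 j).
  by rewrite /cell /cf /= (inj_eq lift_inj) (negbTE jk) => -[].
split => //; last by case/andP: C0.
apply: Z1_eq => j; have [->//|jk] := eqVneq j k.
by apply: le_trans (Co j jk) _; case/andP: Ck.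
Qed.

(* On the cell, [psi] is at least [(1 - alpha) (t z - s z) - alpha loss (s z)] minus
   the increment of [s], since [t] and [s] increase and [loss] is 1-Lipschitz. *)
Lemma cell_gain_ge z p q r k D : regular z -> regular r -> p \in I -> q \in I ->
  z <= p -> p < q -> z < r -> measurable D -> D `<=` cell_event Y I z p q r k ->
  P D = P (cell_event Y I z p q r k) -> D `<=` buyer1_wins Y ->
  (forall w, D w -> regular (Y (lift ord0 k) w)) ->
  - ((s r - s z) * fine (P D)) <= \int[P]_(w in D) psi w.
Proof.
move=> rz rr pI qI zp pq zr mD DC PDC DA rD.
have mA := measurable_buyer1_wins Y.
have mC := measurable_cell_event Y I z p q r k.
set C := cell_event Y I z p q r k in DC PDC mC *.
have rI := regularI _ rr.
have le_loss := loss_le z p q r k rz pI qI rI zp pq zr; rewrite -/C in le_loss.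
have mX : measurable_fun setT (X ord0 : T -> R) by exact: measurable_funPT.
have mloss : measurable_fun setT (fun w => loss (s z) (X ord0 w)).
  by apply: measurableT_comp => //; exact: measurable_loss.
have PC : (P C \is a fin_num)%E by exact: fin_num_measure.
(* The finite right-hand side of [le_loss] is itself what makes the loss integrable on the cell,
   since [alpha > 0]. *)
have loss_fin : (\int[P]_(w in C) (loss (s z) (X ord0 w))%:E < +oo)%E.
  rewrite ltNge leye_eq; apply/negP => /eqP loss_oo; move: le_loss.
  rewrite loss_oo gt0_muley ?lte_fin// leye_eq => /eqP h.
  by have := fin_num_measure P C mC; rewrite -(fineK PC) in h *.
have iC : P.-integrable C (EFin \o (fun w => loss (s z) (X ord0 w))).
  apply/integrableP; split; first by apply: measurable_funTS; exact/measurable_EFinP.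
  apply: le_lt_trans loss_fin; apply: ge0_le_integral => //.
  - by apply: measurableT_comp => //; apply: measurable_funTS; exact/measurable_EFinP.
  - by apply: measurable_funTS; exact/measurable_EFinP.
  - by move=> w _ /=; rewrite lee_fin ger0_norm// loss_ge0.
have iD : P.-integrable D (EFin \o (fun w => loss (s z) (X ord0 w))).
  exact: integrableS iC.
have iDa : P.-integrable D (EFin \o (fun w => alpha * loss (s z) (X ord0 w))).
  by have := integrableZl mD alpha iD; apply: eq_integrable.
pose c := (1 - alpha) * (t z - s z); pose e := s r - s z.
have icst : P.-integrable D (EFin \o cst (c - e)).
  exact: finite_measure_integrable_cst.
(* [D] is the cell up to a null set: its integral of the nonnegative loss is at most that over [C],
   and the probabilities coincide. *)
have lossD : alpha * \int[P]_(w in D) loss (s z) (X ord0 w) <= c * fine (P D).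
  rewrite -lee_fin !EFinM PDC (fineK PC); apply: le_trans le_loss.
  rewrite lee_wpmul2l ?lee_fin ?(ltW a0)// /Rintegral fineK; last first.
    exact: integrable_fin_num.
  apply: ge0_subset_integral => //.
  - by apply: measurable_funTS; exact/measurable_EFinP.
  - by move=> w _; rewrite lee_fin loss_ge0.
apply: (@le_trans _ _ (\int[P]_(w in D) (c - e - alpha * loss (s z) (X ord0 w)))).
  rewrite RintegralB// RintegralZl// Rintegral_cst//.
  by move: lossD; rewrite /e; lra.
apply: le_Rintegral => //.
- by have := integrableB mD icst iDa; apply: eq_integrable.
- exact: integrableS psi_int.
move=> w Dw; have [ZE /andP[zY Yr] _ _] := cell_Z1 _ _ _ _ _ _ (DC _ Dw).
rewrite psiE ZE.
have rY := rD w Dw; set y := Y (lift ord0 k) w in zY Yr rY *.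
have s1 := s_le _ _ rz rY zY; have s2 := s_le _ _ rY rr Yr; have t1 := t_le _ _ rz rY zY.
have loss_shift : loss (s y) (X ord0 w) <= loss (s z) (X ord0 w) + (s y - s z).
  rewrite {1}/loss ge_max; have := loss_ge0 (s z) (X ord0 w).
  have : s z - X ord0 w <= loss (s z) (X ord0 w) by rewrite le_max lexx orbT.
  by move=> h1 h2; apply/andP; split; lra.
have h1 := ler_wpM2l (ltW a0) loss_shift.
have h2 := ler_wpM2l (ltW a1) t1.
by move: h1 h2; rewrite /c /e; lra.
Qed.

(* The increments of [s] telescope. *)
Lemma level_gain_ge (K : nat) (z : nat -> R) (b e : R) (W : set T) :
  0 <= e -> b \in I -> (forall i, (i <= K)%N -> regular (z i)) ->
  (forall i, (i < K)%N -> z i < z i.+1) -> z K < b ->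
  (forall i k, (i < K)%N ->
    fine (P (cell_event Y I (z i) (z i.+1) b (z i.+1) k)) * (s (z K) - s (z 0%N)) <= e) ->
  measurable W -> P (~` W) = 0%E ->
  (forall w i, W w -> regular (Y i w)) ->
  (forall w i j, W w -> i != j -> Y i w != Y j w) ->
  (forall w i l, W w -> (l <= K)%N -> Y i w != z l) ->
  let U := [set w | W w /\ exists i k, (i < K)%N /\
     cell_event Y I (z i) (z i.+1) b (z i.+1) k w] in
  [/\ measurable U, U `<=` buyer1_wins Y &
    - (m.+1%:R * e) <= \int[P]_(w in U) psi w].
Proof.
move=> e0 bI rz zS zKb small mO PO rO tieO gridO U.
have z_nd i j : (i <= j <= K)%N -> z i <= z j.
  case/andP; elim: j => [|j IH]; first by rewrite leqn0 => /eqP->.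
  rewrite leq_eqVlt => /predU1P[->//|ij jK].
  by apply: le_trans (ltW (zS _ jK)); apply: IH => //; exact: ltnW.
pose C (p : 'I_K * 'I_m.+1) := cell_event Y I (z p.1) (z p.1.+1) b (z p.1.+1) p.2.
(* Restriction to [W] makes all signals regular and removes ties and grid values. The closed cells
   then become disjoint and buyer 1 wins strictly on them, at no cost in probability. *)
pose D p := C p `&` W.
have mC p : measurable (C p) by exact: measurable_cell_event.
have mD p : measurable (D p) by exact: measurableI.
have PD p : P (D p) = P (C p).
  apply/eqP; rewrite eq_le le_measure ?inE//=; last by move=> w [].
  rewrite -(measureU0 (mD p) (measurableC mO) PO) le_measure ?inE//.
    by apply: measurableU => //; exact: measurableC.
  by move=> w Cw; have [Ow|Ow] := pselect (W w); [left|right].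
have DA p : D p `<=` buyer1_wins Y.
  move=> w [Cw Ow]; have [ZE /andP[_ Yr] Y0 _] := cell_Z1 _ _ _ _ _ _ Cw.
  rewrite /buyer1_wins /= ZE (le_lt_trans Yr)// lt_neqAle Y0 andbT eq_sym.
  exact: gridO.
have UE : U = \big[setU/set0]_(p : 'I_K * 'I_m.+1) D p.
  rewrite -bigcup_seq; apply/seteqP; split => w.
    by move=> [Ow [i [k [iK Cw]]]]; exists (Ordinal iK, k) => //=; rewrite mem_index_enum.
  by move=> [[i k] _ [Cw Ow]]; split => //; exists i, k.
(* Two competitors both attaining the maximum would be tied, and two grid intervals both containing
   its signal would put that signal on the grid. *)
have tD : trivIset [set` index_enum ('I_K * 'I_m.+1)%type] D.
  move=> [i k] [j l] _ _ [w [[Ck Ow] [Cl _]]].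
  have [_ /andP[/= k1 k2] _ ok] := cell_Z1 _ _ _ _ _ _ Ck.
  have [_ /andP[/= l1 l2] _ ol] := cell_Z1 _ _ _ _ _ _ Cl.
  have kl : k = l.
    apply/eqP/negPn/negP => kl; have /negP tie : Y (lift ord0 k) w != Y (lift ord0 l) w.
      by apply: tieO => //; rewrite (inj_eq lift_inj).
    apply: tie; rewrite eq_le (le_trans (ol _ kl) l1)/=.
    by rewrite eq_sym in kl; rewrite (le_trans (ok _ kl) k1).
  rewrite -{l}kl in l1 l2 Cl ol *; congr (_, _); apply/val_inj => /=.
  have excl (i' j' : 'I_K) : z i' <= Y (lift ord0 k) w <= z i'.+1 ->
      z j' <= Y (lift ord0 k) w <= z j'.+1 -> ~ (i' < j')%N.
    move=> /andP[_ i2] /andP[j1 _] ij.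
    have /negP off := gridO w (lift ord0 k) j' Ow (ltnW (ltn_ord j')).
    by apply: off; rewrite eq_le j1 andbT (le_trans i2)// z_nd// ij ltnW.
  have [ij|ji|//] := ltngtP (i : nat) j.
    by exfalso; apply: (excl i j) => //; apply/andP.
  by exfalso; apply: (excl j i) => //; apply/andP.
have mU : measurable U by rewrite UE; exact: bigsetU_measurable.
have UA : U `<=` buyer1_wins Y by move=> w [Ow [i [k [iK Cw]]]]; exact: (DA (Ordinal iK, k)).
split => //.
have mA := measurable_buyer1_wins Y.
have iD p : P.-integrable (D p) (EFin \o psi) by exact: integrableS psi_int.
have -> : \int[P]_(w in U) psi w = \sum_(p : 'I_K * 'I_m.+1) \int[P]_(w in D p) psi w.
  rewrite {1}/Rintegral UE integral_bigsetU_EFin//.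
  - by rewrite -sum_fine// => p _; exact: integrable_fin_num.
  - exact: index_enum_uniq.
  - by rewrite -UE; apply: measurable_int; exact: integrableS psi_int.
have s_nd i : (i < K)%N -> s (z i) <= s (z i.+1).
  by move=> iK; apply: s_le; [exact/rz/ltnW|exact: rz|exact/ltW/zS].
pose L := s (z K) - s (z 0%N).
have s_mono i j : (i <= j <= K)%N -> s (z i) <= s (z j).
  move=> ijK; have /andP[ij jK] := ijK.
  by apply: s_le (z_nd _ _ ijK); apply: rz => //; exact: leq_trans jK.
have L0 : 0 <= L by rewrite subr_ge0 s_mono// leqnn.
apply: (@le_trans _ _ (\sum_(p : 'I_K * 'I_m.+1)
    - ((s (z p.1.+1) - s (z p.1)) * fine (P (D p))))); last first.
  apply: ler_sum => -[i k] _ /=; apply: (cell_gain_ge _ (z i.+1) b _ k) => //.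
  - exact/rz/ltnW.
  - exact: rz.
  - exact/regularI/rz.
  - exact/ltW/zS.
  - by apply: le_lt_trans zKb; apply: z_nd; rewrite ltn_ord leqnn.
  - exact: zS.
  - by move=> w [].
  - by move=> w [_ Ow]; exact: rO.
rewrite sumrN lerN2.
(* If [s] does not grow along the grid, every increment vanishes. Otherwise each cell has
   probability at most [e / L] and the increments add up to [L], which costs [e] for each of the
   [m.+1] competitors. *)
have [L_eq0|L_neq0] := eqVneq L 0.
  rewrite big1 ?mulr_ge0 ?ler0n// => -[i k] _ /=.
  have -> : s (z i.+1) = s (z i).
    apply/eqP; rewrite eq_le s_nd// andbT.
    apply: (@le_trans _ _ (s (z K))); first by rewrite s_mono// leqnn ltn_ord.
    have /eqP := L_eq0; rewrite subr_eq0 => /eqP->.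
    by rewrite s_mono//= ltnW.
  by rewrite subrr mul0r.
have Lpos : 0 < L by rewrite lt_neqAle eq_sym L_neq0.
under eq_bigr => p _ do rewrite PD.
rewrite -(pair_bigA _ (fun (i : 'I_K) (k : 'I_m.+1) => (s (z i.+1) - s (z i)) *
  fine (P (cell_event Y I (z i) (z i.+1) b (z i.+1) k))))/=.
rewrite exchange_big/=.
have -> : m.+1%:R * e = \sum_(k < m.+1) e by rewrite sumr_const card_ord mulr_natl.
apply: ler_sum => k _.
apply: (@le_trans _ _ (\sum_(i < K) (s (z i.+1) - s (z i)) * (e / L))).
  apply: ler_sum => i _; apply: ler_wpM2l; first by rewrite subr_ge0 s_nd.
  by rewrite ler_pdivlMr//; exact: small.
rewrite -mulr_suml -(big_mkord xpredT (fun i => s (z i.+1) - s (z i))) telescope_sumr//.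
by rewrite mulrCA divff// mulr1.
Qed.

Variables (f : R ^^ m.+2 -> R) (M : set (measurableTypeR R)).
Hypotheses (f_density : joint_density Y f) (Y_in_I : forall i w, Y i w \in I).
Hypotheses (mM : measurable M) (M0 : lebesgue_measure M = 0%E)
  (regularM : forall z, z \in I -> ~ M z -> regular z).

Lemma level_exists (a b e : R) : a \in I -> b \in I -> a < b -> 0 < e ->
  exists Kz : nat * (nat -> R), let: (K, z) := Kz in
  [/\ forall i, (i <= K)%N -> regular (z i), z 0%N < a + e, b - e < z K < b,
    forall i, (i < K)%N -> z i < z i.+1 <= z i + e &
    forall i k, (i < K)%N -> fine (P (cell_event Y I (z i) (z i.+1) b (z i.+1) k)) *
      (s (z K) - s (z 0%N)) <= e].
Proof.
move=> aI bI ab e0; pose mid := (a + b) / 2.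
have [amid midb] : a < mid /\ mid < b by rewrite /mid; split; lra.
have inI y : a <= y <= b -> y \in I.
  by apply: (@interval_is_interval _ I a b).
have between := regular_between I regular M mM M0 regularM.
have [a' ra /andP[aa' a'm]] : exists2 z, regular z & a < z < Num.min (a + e) mid.
  apply: between => //; last by rewrite lt_min ltrDl e0.
  by apply: inI; rewrite le_min ge_min lerDl (ltW e0) (ltW amid) (ltW midb) orbT.
have [b' rb /andP[b'm bb']] : exists2 z, regular z & Num.max (b - e) mid < z < b.
  apply: between => //; last by rewrite gt_max gtrBl e0.
  by apply: inI; rewrite le_max ge_max gerBl (ltW e0) (ltW amid) (ltW midb) orbT.
move: a'm b'm; rewrite lt_min gt_max => /andP[a'e a'm] /andP[eb' mb'].
have a'b' : a' < b' by exact: lt_trans mb'.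
(* The end points are fixed before the mesh, so [L] is known when the mesh is chosen: a mesh of at
   most [r / 2] gives cells of probability at most [e / (L + 1)], hence at most [e] after
   multiplication by [L]. The added 1 covers [L = 0]. *)
pose L := s b' - s a'.
have L0 : 0 <= L by rewrite subr_ge0 s_le// ltW.
have eL : 0 < e / (L + 1) by rewrite divr_gt0// ltr_wpDl.
have [r r0 rP] := signals_absolutely_continuous Y f f_density _ eL.
have step0 : 0 < Num.min e (r / 2) by rewrite lt_min e0 divr_gt0.
have [K [z [rz z0 zK zS]]] := regular_grid I regular M mM M0 regularM regularI
  a' b' (Num.min e (r / 2)) ra rb a'b' step0.
exists (K, z); split => //; first by rewrite z0.
- by rewrite zK eb' bb'.
- move=> i /zS/andP[-> /le_trans]; apply.
  by rewrite lerD2l ge_min lexx.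
move=> i k iK; rewrite z0 zK -/L.
have /andP[zi zi'] := zS i iK.
have mitv : measurable (`[z i, z i.+1]%classic : set (measurableTypeR R)).
  exact: measurable_itv.
have small : (lebesgue_measure (`[z i, z i.+1]%classic : set (measurableTypeR R)) < r%:E)%E.
  rewrite lebesgue_measure_itv/= lte_fin zi -EFinB lte_fin ltrBlDl.
  by apply: le_lt_trans zi' _; rewrite ltrD2l gt_min; apply/orP; right; lra.
have {small} small := rP (lift ord0 k) _ mitv small.
have mC := measurable_cell_event Y I (z i) (z i.+1) b (z i.+1) k.
have PC : fine (P (cell_event Y I (z i) (z i.+1) b (z i.+1) k)) <= e / (L + 1).
  rewrite -lee_fin fineK; last exact: fin_num_measure.
  apply: le_trans (ltW small); apply: le_measure; rewrite ?inE//.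
    by rewrite -[X in measurable X]setTI; exact: measurable_funPT.
  by move=> w Cw; have [_ zYz _ _] := cell_Z1 _ _ _ _ _ _ Cw; rewrite /= in_itv.
apply: le_trans (ler_wpM2r L0 PC) _.
by rewrite mulrAC ler_pdivrMr ?ltr_wpDl// ler_pM2l// lerDl.
Qed.

(** Collects finitely many null events, one for each pair of buyers, so that later arguments can be
    made outcome by outcome. *)
Lemma generic_signals (G : set (measurableTypeR R)) : measurable G ->
  lebesgue_measure G = 0%E -> exists W : set T,
  [/\ measurable W, P (~` W) = 0%E,
    forall w i, W w -> ~ G (Y i w) &
    forall w i j, W w -> i != j -> Y i w != Y j w].
Proof.
move=> mG G0; have mY i : measurable_fun setT (Y i : T -> R) by exact: measurable_funPT.
pose B (p : 'I_m.+2 * 'I_m.+2) := [set w | G (Y p.1 w)] `|`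
  (if p.1 == p.2 then set0 else [set w | Y p.1 w = Y p.2 w]).
have mtie i j : measurable [set w | Y i w = Y j w].
  rewrite -[X in measurable X]setTI.
  have := @measurable_fun_eqr _ _ _ setT (Y i) (Y j) (mY i) (mY j).
  move=> /(_ measurableT [set true] Logic.I); congr (measurable (_ `&` _)).
  by apply/seteqP; split => w /= /eqP.
have mG' i : measurable [set w | G (Y i w)].
  by rewrite -[X in measurable X]setTI; exact: mY.
have mB p : measurable (B p) by apply: measurableU => //; case: ifP.
have PB p : P (B p) = 0%E.
  rewrite /B; case: ifPn => [_|ij]; first by rewrite setU0; exact: signal_null f_density _ _ mG G0.
  rewrite measureU0//; first exact: signal_null f_density _ _ mG G0.
  exact: signal_tie_null f_density _ _ ij.
exists (~` \bigcup_(p in [set` index_enum ('I_m.+2 * 'I_m.+2)%type]) B p); split.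
- by rewrite bigcup_seq; apply: measurableC; exact: bigsetU_measurable.
- rewrite setCK bigcup_seq.
  suff [] : measurable (\big[setU/set0]_p B p) /\ P (\big[setU/set0]_p B p) = 0%E by [].
  apply: (big_ind (fun A => measurable A /\ P A = 0%E)) => // A A' [mA A0] [mA' A'0].
  by split; [exact: measurableU|rewrite measureU0].
- by move=> w i Ow Gw; apply: Ow; exists (i, i); [rewrite /= mem_index_enum|left].
- move=> w i j Ow ij; apply/eqP => Yij; apply: Ow; exists (i, j).
    by rewrite /= mem_index_enum.
  by right; rewrite (negbTE ij).
Qed.

Lemma grid_cell (K : nat) (z : nat -> R) x : z 0%N <= x -> x <= z K ->
  z 0%N < z K -> exists i, (i < K)%N /\ z i <= x <= z i.+1.
Proof.
elim: K => [|K IH] z0 xK; first by rewrite ltxx.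
move=> zK; have [xK'|xK'] := leP x (z K); last by exists K; rewrite (ltW xK') xK.
have [z0K|z0K] := ltP (z 0%N) (z K).
  by have [i [iK ix]] := IH z0 xK' z0K; exists i; split => //; exact: ltnW.
exists K; rewrite xK andbT ltnSn; split => //.
exact: le_trans z0K _.
Qed.

(** Grids of mesh at most [1 / (n + 1)] on intervals exhausting [I] give events [U n] whose gains
    are at least [- (m + 1) / (n + 1)]. Almost every winning outcome lies in [U n] for all large
    [n], and dominated convergence passes to the limit. *)
Lemma gain_ge0 (x0 y0 : R) : x0 \in I -> y0 \in I -> x0 < y0 ->
  0 <= \int[P]_(w in buyer1_wins Y) psi w.
Proof.
move=> x0I y0I xy0.
have [ea [eaI ea_nd ea_le ea_cof]] := cofinal_below I x0 x0I.
have [eb [ebI eb_nd eb_cof]] := cofinal_above I y0 y0I.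
pose b n := Num.max y0 (eb n).
have bI n : b n \in I by rewrite /b; case: leP.
have ab n : ea n < b n.
  by apply: (le_lt_trans (ea_le n)); apply: (lt_le_trans xy0); rewrite le_max lexx.
pose e n : R := n.+1%:R^-1.
have e0 n : 0 < e n by rewrite invr_gt0.
have [Kz KzP] := choice (fun n => level_exists _ _ _ (eaI n) (bI n) (ab n) (e0 n)).
pose K n := (Kz n).1; pose z n := (Kz n).2.
have zP n : [/\ forall i, (i <= K n)%N -> regular (z n i), z n 0%N < ea n + e n,
    b n - e n < z n (K n) < b n,
    forall i, (i < K n)%N -> z n i < z n i.+1 <= z n i + e n &
    forall i k, (i < K n)%N ->
      fine (P (cell_event Y I (z n i) (z n i.+1) (b n) (z n i.+1) k)) *
      (s (z n (K n)) - s (z n 0%N)) <= e n].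
  by rewrite /K /z; have := KzP n; case: (Kz n).
(* The grid points of all levels are countably many, so one set [W] avoids them for all [n] at
   once. *)
pose G : set (measurableTypeR R) := \bigcup_n \bigcup_l [set z n l].
have cG : countable G.
  by apply: bigcup_countable => // n _; apply: bigcup_countable => // l _; exact: countable1.
have mG : measurable G.
  by apply: bigcup_measurable => n _; apply: bigcup_measurable => l _; exact: measurable_set1.
have MG0 : lebesgue_measure (M `|` G) = 0%E.
  by rewrite measureU0//; exact: countable_lebesgue_measure0.
have [W [mO PO MGO tieO]] := generic_signals (M `|` G) (measurableU _ _ mM mG) MG0.
have rO w i : W w -> regular (Y i w).
  by move=> Ow; apply: regularM => // MY; apply: (MGO w i Ow); left.
have gridO n w i l : W w -> (l <= K n)%N -> Y i w != z n l.
  move=> Ow _; apply/eqP => Yz; apply: (MGO w i Ow); right.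
  by exists n => //; exists l.
pose U n := [set w | W w /\ exists i k, (i < K n)%N /\
     cell_event Y I (z n i) (z n i.+1) (b n) (z n i.+1) k w].
have UP n : [/\ measurable (U n), U n `<=` buyer1_wins Y &
    - (m.+1%:R * e n) <= \int[P]_(w in U n) psi w].
  have [rz _ /andP[_ zb] zS small] := zP n.
  apply: level_gain_ge => //; first exact: ltW.
  - by move=> i /zS/andP[].
  - exact: gridO.
have mA := measurable_buyer1_wins Y.
have mU n : measurable (U n) by have [] := UP n.
have UA n : U n `<=` buyer1_wins Y by have [] := UP n.
have iA : P.-integrable setT (EFin \o (psi \_ (buyer1_wins Y))).
  by have /(integrable_mkcond _ mA) := psi_int; rewrite restrict_EFin.
have eventually_U w : W w -> buyer1_wins Y w -> \forall n \near \oo, U n w.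
  move=> Ow Aw; have [k _ kmax] := arg_maxP (fun j => Y (lift ord0 j) w) (erefl (xpredT (@ord0 m))).
  have {}kmax j : Y (lift ord0 j) w <= Y (lift ord0 k) w by exact: kmax.
  set y := Y (lift ord0 k) w.
  have Zy : Z1 Y w = y by exact: Z1_eq.
  have y_lt : y < Y ord0 w by rewrite -Zy.
  (* The distance from the highest competing signal to the nearest other signal, that of buyer 1
     included as the initial value. Once the mesh is below it, the grid interval around [y]
     separates [y] from all other signals. *)
  pose gap := \big[Num.min/Y ord0 w - y]_(j | j != k) (y - Y (lift ord0 j) w).
  have gap0 : 0 < gap.
    apply/bigmin_gtP; split; first by rewrite subr_gt0.
    move=> j jk; rewrite subr_gt0 lt_neqAle kmax andbT.
    by apply: tieO => //; rewrite (inj_eq lift_inj).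
  have gapY : y + gap <= Y ord0 w by rewrite -lerBrDl; exact: bigmin_le_id.
  have gapj j : j != k -> Y (lift ord0 j) w <= y - gap.
    by move=> jk; rewrite lerBrDl -lerBrDr; exact: bigmin_le_cond.
  (* A point of [I] strictly below [y] ensures that the grids eventually start below [y]. *)
  have [_ [x xI xy]] := regular_inner _ (rO w (lift ord0 k) Ow).
  have [n1 n1x] := ea_cof x xI; have [n2 n2Y] := eb_cof _ (Y_in_I ord0 w).
  have small (r : R) : 0 < r -> \forall n \near \oo, e n < r.
    by move=> r0; have := near_infty_natSinv_lt (PosNum r0).
  have yx0 : 0 < y - x by rewrite subr_gt0.
  near=> n.
  have en1 : e n < gap by near: n; exact: small.
  have en2 : e n < y - x by near: n; exact: small.
  have nn1 : (n1 <= n)%N by near: n; exact: nbhs_infty_ge.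
  have nn2 : (n2 <= n)%N by near: n; exact: nbhs_infty_ge.
  have [_ z0 /andP[zKb _] zS _] := zP n.
  have Yb : Y ord0 w <= b n by rewrite le_max (le_trans n2Y (eb_nd _ _ nn2)) orbT.
  have z0y : z n 0%N <= y by have := ea_nd _ _ nn1; lra.
  have yzK : y < z n (K n) by lra.
  have [i [iK /andP[zi zi']]] := grid_cell _ _ _ z0y (ltW yzK) (le_lt_trans z0y yzK).
  have /andP[_ zie] := zS i iK.
  split => //; exists i, k; split => // l; rewrite /cell /cf.
  have [->|/eqP l0] := eqVneq l ord0; first by rewrite /= in_itv/= Yb andbT; lra.
  have [->|lk] := eqVneq l (lift ord0 k); first by rewrite /= in_itv/= zi zi'.
  split => //; have [j lj|//] := unliftP ord0 l.
  have := gapj j; rewrite lj (inj_eq lift_inj) in lk *.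
  by move=> /(_ lk); lra.
have lim : \int[P]_w (psi \_ (U n)) w @[n --> \oo] -->
    \int[P]_w (psi \_ (buyer1_wins Y)) w.
  have mpsi n : measurable_fun setT (psi \_ (U n)).
    apply/(measurable_restrictT _ (mU n)); apply/measurable_EFinP; apply: measurable_int.
    exact: integrableS psi_int.
  have mpsiA : measurable_fun setT (psi \_ (buyer1_wins Y)).
    by apply/(measurable_restrictT _ mA)/measurable_EFinP; exact: measurable_int psi_int.
  have [|||_ //] := Rintegral_dominated_cvg P (fun n => psi \_ (U n)) _
    (fun w => `|(psi \_ (buyer1_wins Y)) w|) mpsi mpsiA.
  - exists (~` W); split => //; first exact: measurableC.
    move=> w /= ncv Ow; apply: ncv.
    have [Aw|Aw] := pselect (buyer1_wins Y w).
      apply: cvg_near_cst; have := eventually_U w Ow Aw; apply: filterS => n Uw.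
      by rewrite !patchE !mem_set.
    rewrite [X in _ --> X]patchE memNset//.
    apply: cvg_near_cst; apply: nearW => n.
    by rewrite patchE memNset// => /UA.
  - exact: integrable_norm.
  - move=> n w; rewrite !patchE; case: ifPn => [/set_mem/UA Aw|_].
      by rewrite mem_set.
    by rewrite normr0.
have lim0 : - (m.+1%:R * e n) @[n --> \oo] --> (0 : R).
  rewrite -oppr0 -(mulr0 m.+1%:R); apply: cvgN; apply: cvgMr; exact: cvg_harmonic.
rewrite Rintegral_mkcond; apply: (ler_cvg_to lim0 lim); apply: nearW => n.
by rewrite -Rintegral_mkcond; have [] := UP n.
Unshelve. all: by end_near. Qed.

End gain.

(** The exceptions are the null set of infinite slices, available because the density has total mass
    1, and the least element of [I], at most one point. *)
Lemma irregular_null {R : realType} {m : nat} {d : measure_display}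
    {T : measurableType d} {P : probability T R} (Y : 'I_m.+2 -> {RV P >-> R})
    (I : interval R) (f : R ^^ m.+2 -> R) : joint_density Y f ->
  exists M : set (measurableTypeR R), [/\ measurable M, lebesgue_measure M = 0%E &
    forall z, z \in I -> ~ M z -> regular I f z].
Proof.
move=> f_density; have [mf f0 dens] := f_density.
have [|M [mM M0 good_out]] := slice_finite_ae m.+1 f mf f0.
  rewrite -(dens _ measurableT) preimage_setT probability_setT; exact: ltry.
pose M' : set (measurableTypeR R) := [set z | z \in I /\ forall e, e \in I -> z <= e].
have cM' : countable M'.
  have [[z0 z0M]|none] := pselect (exists z, M' z); last first.
    rewrite (_ : M' = set0)//; apply/seteqP; split => // z Mz; exfalso; apply: none.
    by exists z.
  apply: sub_countable (countable1 z0); apply: subset_card_le => z [zI zmin] /=.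
  by apply/eqP; rewrite eq_le (zmin _ z0M.1) (z0M.2 _ zI).
exists (M `|` M'); split.
- by apply: measurableU => //; exact: countable_measurable.
- rewrite measureU0//; first exact: countable_measurable.
  exact: countable_lebesgue_measure0.
- move=> z zI Mz; split; last by apply: good_out => Mz'; apply: Mz; left.
  split => //; apply: contrapT => none; apply: Mz; right; split => // e eI.
  by rewrite leNgt; apply/negP => ez; apply: none; exists e.
Qed.

Theorem proposition3 (R : realType) (m : nat)
  (d : measure_display) (T : measurableType d) (P : probability T R)
  (X Y : 'I_m.+2 -> {RV P >-> R})
  (I : interval R) (u : R -> R)
  (f : R ^^ m.+2 -> R) (kappa : R.-pker (R ^^ m.+2) ~> measurableTypeR R)
  (alpha : R)
  (Y_in_I : forall n w, Y n w \in I)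
  (XY_symmetric : symmetric_law X Y)
  (f_density : joint_density Y f)
  (f_positive : forall y : R ^^ m.+2, all_in I (tnth y) -> 0 < f y)
  (kappa_law : conditional_law X Y kappa)
  (XY_dependence : positive_dependence I f kappa)
  (u_increasing : {homo u : x y / x < y})
  (u_concave : convex_function [set: R^o] (fun x => - u x))
  (u_zero : u 0 = 0)
  (u_finite : forall y : R ^^ m.+2, all_in I (tnth y) ->
     (kappa y).-integrable setT (EFin \o u))
  (u_positive : forall y : R ^^ m.+2, all_in I (tnth y) ->
     0 < \int[kappa y]_x u x)
  (alpha_01 : 0 < alpha < 1)
  (posc_finite : forall y z b, y \in I -> z \in I ->
     YZ_cexp_exists I f kappa y z (u \o posc_payoff alpha b))
  (plsc_finite : forall y z b, y \in I -> z \in I ->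
     YZ_cexp_exists I f kappa y z (u \o plsc_payoff alpha b))
  (posc_integrable : P.-integrable (buyer1_wins Y)
     (EFin \o posc_payment I u f kappa X Y alpha))
  (plsc_integrable : P.-integrable (buyer1_wins Y)
     (EFin \o plsc_payment I u f kappa X Y alpha)) :
  R_posc I u f kappa X Y alpha <= R_plsc I u f kappa X Y alpha.
Proof.
have mA := measurable_buyer1_wins Y.
rewrite -subr_ge0 /R_plsc /R_posc /event_mean -mulrBl -RintegralB//.
apply: divr_ge0; last by rewrite fine_ge0.
(* A winning outcome supplies the two distinct points of [I] from which the exhaustion of [I]
   starts. *)
have [[w0 Aw0]|none] := pselect (exists w, buyer1_wins Y w); last first.
  rewrite (_ : buyer1_wins Y = set0) ?Rintegral_set0//.
  by apply/seteqP; split => // w Aw; apply: none; exists w.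
have [M [mM M0 regularM]] := irregular_null Y I f f_density.
have s_le := s_bid_le X Y I u f kappa alpha XY_symmetric f_density f_positive kappa_law
  XY_dependence u_increasing u_concave u_zero u_finite alpha_01 posc_finite.
have t_le := t_bid_le X Y I u f kappa alpha XY_symmetric f_density f_positive kappa_law
  XY_dependence u_increasing u_concave u_zero u_finite alpha_01 posc_finite plsc_finite.
have loss_le := cell_loss_le X Y I u f kappa alpha XY_symmetric f_density f_positive
  kappa_law XY_dependence u_increasing u_concave u_zero u_finite alpha_01
  posc_finite plsc_finite.
set psi := fun w => plsc_payment I u f kappa X Y alpha w - posc_payment I u f kappa X Y alpha w.
have psi_int : P.-integrable (buyer1_wins Y) (EFin \o psi).
  by have := integrableB mA plsc_integrable posc_integrable; apply: eq_integrable.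
(* Subtracting the positive part of [x - b] from [x - b] leaves minus the positive part of [b - x],
   which is the loss. *)
have psiE w : psi w = (1 - alpha) * (t_bid I u f kappa alpha (Z1 Y w) (Z1 Y w) -
    s_bid I u f kappa alpha (Z1 Y w) (Z1 Y w)) -
    alpha * loss (s_bid I u f kappa alpha (Z1 Y w) (Z1 Y w)) (X ord0 w).
  rewrite /psi /plsc_payment /posc_payment /loss.
  move: (s_bid _ _ _ _ _ _ _) (t_bid _ _ _ _ _ _ _) (X ord0 w) => b c x.
  have [bx|bx] := leP 0 (x - b).
    by rewrite (max_idPl (_ : b - x <= 0)); lra.
  by rewrite (max_idPr (_ : 0 <= b - x)); lra.
have regular_inner z : regular I f z -> inner I z by case.
have xy : Y (lift ord0 ord0) w0 < Y ord0 w0.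
  by apply: le_lt_trans Aw0; exact: (le_bigmax _ (fun j => Y (lift ord0 j) w0)).
exact: (gain_ge0 X Y I alpha (fun z => s_bid I u f kappa alpha z z)
  (fun z => t_bid I u f kappa alpha z z) (regular I f) alpha_01 s_le t_le regular_inner
  loss_le psi psiE psi_int f M f_density Y_in_I mM M0 regularM
  _ _ (Y_in_I _ w0) (Y_in_I _ w0) xy).
Qed.
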